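(* Let $\{S_i\}_{i\in I}$ be a conformal iterated function system (CIFS) on $X\subset\mathbb{R}^d$ with limit set $F$, and let $h$ be the associated quantity defined from the pressure function (see context). If $P$ is any subset of $\bigcup_{i\in I}S_i(X)$ which intersects $S_i(X)$ in exactly one point for each $i\in I$, then: (1) $\overline{\dim}_{\mathrm B}F=\dim_{\mathrm P}F=\max\{h,\overline{\dim}_{\mathrm B}P\}$; (2) $\overline{\dim}_{\theta}F=\max\{h,\overline{\dim}_{\theta}P\}$ for all $\theta\in[0,1]$; (3) $\overline{\dim}^{\Phi}F=\max\{h,\overline{\dim}^{\Phi}P\}$ for every monotonically admissible function $\Phi$.
   Context: $|\cdot|$ denotes Euclidean diameter, $\|\cdot\|$ the Euclidean norm or a supremum norm, $B(x,r)$ the open ball, and $\mathcal{L}^d$ Lebesgue measure on $\mathbb{R}^d$. IIFS. Let $d\in\mathbb{N}$ and let $X\subset\mathbb{R}^d$ be compact, connected, with more than one point. An infinite iterated function system (IIFS) on $X$ is a collection of maps $S_i\colon X\to X$, $i\in I$, with $I$ a countable index set, such that there is $\rho\in[0,1)$ with $\|S_i(x)-S_i(y)\|\le\rho\|x-y\|$ for all $x,y\in X$, $i\in I$. Let $I^*=\bigcup_{n=1}^\infty I^n$ be the set of finite words; for $w=w_1\cdots w_n\in I^n$ let $S_w=S_{w_1}\circ\cdots\circ S_{w_n}$. For $w\in I^{\mathbb N}$, $w|_n$ denotes the word formed by its first $n$ letters. The limit set is $F=\bigcup_{w\in I^{\mathbb{N}}}\bigcap_{n=1}^\infty S_{w|_n}(X)$.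 CIFS. A CIFS is an IIFS such that: (i) (open set condition) $U:=\mathrm{Int}_{\mathbb{R}^d}X$ is non-empty, $S_i(U)\subset U$ for all $i\in I$, and $S_i(U)\cap S_j(U)=\varnothing$ for $i\ne j$; (ii) (cone condition) $\inf_{x\in X}\inf_{r\in(0,1)}\mathcal{L}^d(B(x,r)\cap\mathrm{Int}_{\mathbb{R}^d}X)/r^d>0$; (iii) (conformality) there exist $\epsilon>0$ and an open, bounded, connected $V\subset\mathbb{R}^d$ with $X\subset V$ such that each $S_i$ extends to a $C^{1+\epsilon}$ diffeomorphism from $V$ to an open subset of $V$ which is conformal, i.e. for all $x\in V$ the differential $S_i'|_x$ exists, is non-zero, is a similarity map ($\|S_i'|_x(y)\|=\|S_i'|_x\|\,\|y\|$ for all $y\in\mathbb{R}^d$), and is $\epsilon$-Hölder continuous in $x$; moreover there is $\rho\in(0,1)$ with $\|S_i'\|<\rho$ for all $i$, where $\|\cdot\|$ is the supremum norm over $V$; (iv) (bounded distortion) there is $K>0$ such that $\|S_w'|_y\|\le K\|S_w'|_x\|$ for all $x,y\in V$, $w\in I^*$. Pressure and $h$. For a map $\sigma=S_w$ let $R_\sigma=\sup_{x,y\in X,x\ne y}\|\sigma(x)-\sigma(y)\|/\|x-y\|$. Let $M_n=\{S_w:w\in I^n\}$ (a set of maps, so coinciding maps are counted once), $\phi_n(t)=\sum_{\sigma\in M_n}R_\sigma^t\in[0,\infty]$, and $\overline{P}(t)=\lim_{n\to\infty}\frac1n\log\phi_n(t)=\inf_n\frac1n\log\phi_n(t)\in[-\infty,\infty]$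 for $t\in(0,\infty)$ (with $\log\infty=\infty$, $\log 0=-\infty$). Put $h=\inf\{t>0:\overline{P}(t)<0\}$ ($\inf\varnothing=\infty$). Dimensions. $\dim_{\mathrm H},\dim_{\mathrm P},\overline{\dim}_{\mathrm B}$ are the Hausdorff, packing and upper box dimensions. For $\theta\in(0,1]$ and non-empty bounded $E\subset\mathbb{R}^d$, $\overline{\dim}_{\theta}E$ is the infimum of $s\ge0$ such that for all $\epsilon>0$ there is $\delta_0\in(0,1]$ such that for all $\delta\in(0,\delta_0)$ there is a cover $\{U_1,U_2,\ldots\}$ of $E$ with $\delta^{1/\theta}\le|U_i|\le\delta$ for all $i$ and $\sum_i|U_i|^s\le\epsilon$; so $\overline{\dim}_1=\overline{\dim}_{\mathrm B}$. Set $\overline{\dim}_0=\dim_{\mathrm H}$. A function $\Phi\colon(0,\Delta)\to\mathbb{R}$ is monotonically admissible if it is monotonic, $0<\Phi(\delta)\le\delta$ for all $\delta\in(0,\Delta)$, and $\Phi(\delta)/\delta\to0$ monotonically as $\delta\to0^+$. $\overline{\dim}^{\Phi}E$ is defined like $\overline{\dim}_\theta E$ with $\delta^{1/\theta}$ replaced by $\Phi(\delta)$ (for $\delta<\Delta$). *)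

(* Defs.v *)
From HB Require Import structures.
From mathcomp Require Import all_boot all_order all_algebra.
From mathcomp Require Import all_classical all_reals all_analysis.

Set Implicit Arguments.
Unset Strict Implicit.
Unset Printing Implicit Defensive.

Import Order.TTheory GRing.Theory Num.Theory.
Import numFieldNormedType.Exports.

Local Open Scope classical_set_scope.
Local Open Scope ring_scope.

(* The library norm of 'rV[R]_d is the sup norm.  It is only used below through
   topology, boundedness and the differential, none of which depends on the
   choice of norm. *)
Definition enorm (R : realType) (d : nat) (v : 'rV[R]_d) : R :=
  Num.sqrt (\sum_(i < d) v 0 i ^+ 2).

Definition eball (R : realType) (d : nat) (x : 'rV[R]_d) (r : R) :
  set 'rV[R]_d := [set y | enorm (y - x) < r].

Definition ecball (R : realType) (d : nat) (x : 'rV[R]_d) (r : R) :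
  set 'rV[R]_d := [set y | enorm (y - x) <= r].

(* The value 0 is adjoined so that the empty set has diameter 0, not -oo. *)
Definition ediam (R : realType) (d : nat) (U : set 'rV[R]_d) : \bar R :=
  ereal_sup ([set 0%E] `|`
    [set z | exists x y, [/\ U x, U y & z = (enorm (x - y))%:E]]).

Definition opnorm (R : realType) (d : nat) (L : 'rV[R]_d -> 'rV[R]_d) : R :=
  sup [set enorm (L v) | v in [set v | enorm v <= 1]].

Definition cbox (R : realType) (d : nat) (a b : 'rV[R]_d) : set 'rV[R]_d :=
  [set x | forall i, a 0 i <= x 0 i <= b 0 i].

(* The library has Lebesgue measure on R only.  This is the d-dimensional
   Lebesgue outer measure, which is Lebesgue measure on measurable sets. *)
Definition lebesgue_rV (R : realType) (d : nat) (A : set 'rV[R]_d) : \bar R :=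
  ereal_inf [set z | exists a b : nat -> 'rV[R]_d,
    [/\ forall k i, a k 0 i <= b k 0 i,
        A `<=` \bigcup_k cbox (a k) (b k) &
        z = (\sum_(0 <= k <oo) (\prod_(i < d) (b k 0 i - a k 0 i))%:E)%E]].

(* A map X -> X is represented by a total map of R^d of which only the values
   on X matter. *)
Definition comp_word (I T : Type) (S : I -> T -> T) (w : seq I) : T -> T :=
  foldr (fun i f => S i \o f) id w.

(* The index set may be finite or infinite; it is non-empty, since otherwise the
   limit set would be empty and have no dimension. *)
Definition is_IIFS (R : realType) (d : nat) (I : countType)
    (X : set 'rV[R]_d) (S : I -> 'rV[R]_d -> 'rV[R]_d) : Prop :=
  [/\ inhabited I,
      compact X,
      connected X,
      (exists x y, [/\ X x, X y & x != y]) &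
      (forall i, S i @` X `<=` X) /\
      (exists rho, [/\ 0 <= rho, rho < 1 & forall i x y, X x -> X y ->
         enorm (S i x - S i y) <= rho * enorm (x - y)])].

Definition limit_set (R : realType) (d : nat) (I : countType)
    (X : set 'rV[R]_d) (S : I -> 'rV[R]_d -> 'rV[R]_d) : set 'rV[R]_d :=
  \bigcup_(w in [set: nat -> I])
    \bigcap_(n in [set n | (0 < n)%N]) (comp_word S (mkseq w n) @` X).

Definition open_set_condition (R : realType) (d : nat) (I : countType)
    (X : set 'rV[R]_d) (S : I -> 'rV[R]_d -> 'rV[R]_d) : Prop :=
  [/\ X° !=set0,
      forall i, S i @` X° `<=` X° &
      forall i j, i != j -> (S i @` X°) `&` (S j @` X°) = set0].

Definition cone_condition (R : realType) (d : nat) (X : set 'rV[R]_d) : Prop :=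
  (0 < ereal_inf [set z | exists x r, [/\ X x, (0 < r < 1)%R &
    z = lebesgue_rV (eball x r `&` X°) * ((r ^+ d)^-1)%:E]])%E.

Definition holder_differential (R : realType) (d : nat) (eps : R)
    (f : 'rV[R]_d -> 'rV[R]_d) (W : set 'rV[R]_d) : Prop :=
  exists C : R, forall x y, W x -> W y ->
    opnorm (fun v => 'd f x v - 'd f y v) <= C * enorm (x - y) `^ eps.

(* Class C^(1+eps) on an open set: the differential is locally eps-Hoelder. *)
Definition C1plus (R : realType) (d : nat) (eps : R)
    (f : 'rV[R]_d -> 'rV[R]_d) (W : set 'rV[R]_d) : Prop :=
  (forall x, W x -> differentiable f x) /\
  (forall x, W x -> exists2 r, 0 < r &
     holder_differential eps f (W `&` eball x r)).

Definition C1plus_diffeo_into (R : realType) (d : nat) (eps : R)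
    (f : 'rV[R]_d -> 'rV[R]_d) (V : set 'rV[R]_d) : Prop :=
  [/\ open (f @` V), f @` V `<=` V, C1plus eps f V &
      exists2 g, (forall x, V x -> g (f x) = x) & C1plus eps g (f @` V)].

Definition conformal_on (R : realType) (d : nat) (eps : R)
    (f : 'rV[R]_d -> 'rV[R]_d) (V : set 'rV[R]_d) : Prop :=
  (forall x, V x ->
     [/\ differentiable f x,
         exists v, 'd f x v != 0 &
         forall v, enorm ('d f x v) = opnorm ('d f x) * enorm v]) /\
  holder_differential eps f V.

(* T is the family of extensions of the S i to V; outside V it is irrelevant. *)
Definition conformality (R : realType) (d : nat) (I : countType)
    (X : set 'rV[R]_d) (S : I -> 'rV[R]_d -> 'rV[R]_d)
    (V : set 'rV[R]_d) (T : I -> 'rV[R]_d -> 'rV[R]_d) : Prop :=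
  [/\ open V, bounded_set V, connected V, X `<=` V &
   [/\ forall i x, X x -> T i x = S i x,
       exists2 eps, 0 < eps & forall i,
         C1plus_diffeo_into eps (T i) V /\ conformal_on eps (T i) V &
       exists2 rho, 0 < rho < 1 & forall i,
         (ereal_sup [set (opnorm ('d (T i) x))%:E | x in V] < rho%:E)%E]].

Definition bounded_distortion (R : realType) (d : nat) (I : countType)
    (V : set 'rV[R]_d) (T : I -> 'rV[R]_d -> 'rV[R]_d) : Prop :=
  exists2 K, 0 < K & forall (w : seq I) x y, (0 < size w)%N -> V x -> V y ->
    opnorm ('d (comp_word T w) y) <= K * opnorm ('d (comp_word T w) x).

Definition is_CIFS (R : realType) (d : nat) (I : countType)
    (X : set 'rV[R]_d) (S : I -> 'rV[R]_d -> 'rV[R]_d) : Prop :=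
  [/\ is_IIFS X S, open_set_condition X S, cone_condition X &
      exists V T, conformality X S V T /\ bounded_distortion V T].

Definition lip_ratio (R : realType) (d : nat) (X : set 'rV[R]_d)
    (sigma : 'rV[R]_d -> 'rV[R]_d) : R :=
  sup [set z | exists x y,
    [/\ X x, X y, x != y & z = enorm (sigma x - sigma y) / enorm (x - y)]].

(* The maps are restricted to X, so that words whose maps agree on X are
   counted once. *)
Definition level_maps (R : realType) (d : nat) (I : countType)
    (X : set 'rV[R]_d) (S : I -> 'rV[R]_d -> 'rV[R]_d) (n : nat) :
    set ('rV[R]_d -> 'rV[R]_d) :=
  [set (comp_word S w) \_ X | w in [set w : seq I | size w = n]].

Definition phi_sum (R : realType) (d : nat) (I : countType)
    (X : set 'rV[R]_d) (S : I -> 'rV[R]_d -> 'rV[R]_d) (n : nat) (t : R) :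
    \bar R :=
  \esum_(sigma in level_maps X S n) (lip_ratio X sigma `^ t)%:E.

(* The term n = 0 is irrelevant to the limit. *)
Definition pressure (R : realType) (d : nat) (I : countType)
    (X : set 'rV[R]_d) (S : I -> 'rV[R]_d -> 'rV[R]_d) (t : R) : \bar R :=
  limn (fun n => ((n%:R^-1)%:E * lne (phi_sum X S n t))%E).

Definition pressure_h (R : realType) (d : nat) (I : countType)
    (X : set 'rV[R]_d) (S : I -> 'rV[R]_d -> 'rV[R]_d) : \bar R :=
  ereal_inf [set t%:E | t in [set t : R | 0 < t /\ (pressure X S t < 0)%E]].

Definition countable_cover (R : realType) (d : nat)
    (C : set (set 'rV[R]_d)) (E : set 'rV[R]_d) : Prop :=
  countable C /\ E `<=` \bigcup_(U in C) U.

Definition hausdorff_pre (R : realType) (d : nat) (s delta : R)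
    (E : set 'rV[R]_d) : \bar R :=
  ereal_inf [set (\esum_(U in C) (ediam U `^ s))%E |
    C in [set C : set (set 'rV[R]_d) | countable_cover C E /\
            forall U, C U -> (ediam U <= delta%:E)%E]].

Definition hausdorff_measure (R : realType) (d : nat) (s : R)
    (E : set 'rV[R]_d) : \bar R :=
  ereal_sup [set hausdorff_pre s delta E | delta in [set delta : R | 0 < delta]].

Definition dimH (R : realType) (d : nat) (E : set 'rV[R]_d) : \bar R :=
  ereal_inf [set s%:E | s in [set s : R | 0 <= s /\
                                hausdorff_measure s E = 0%E]].

(* A packing is a disjoint set of closed balls, given as (centre, radius),
   centred in E and of radius at most delta; it is automatically countable. *)
Definition is_packing (R : realType) (d : nat) (delta : R)
    (E : set 'rV[R]_d) (Q : set ('rV[R]_d * R)) : Prop :=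
  (forall p, Q p -> E p.1 /\ 0 < p.2 <= delta) /\
  trivIset Q (fun p => ecball p.1 p.2).

Definition packing_pre (R : realType) (d : nat) (s : R)
    (E : set 'rV[R]_d) : \bar R :=
  ereal_inf [set ereal_sup [set (\esum_(p in Q) (ediam (ecball p.1 p.2) `^ s))%E |
                              Q in is_packing delta E] |
    delta in [set delta : R | 0 < delta]].

Definition packing_measure (R : realType) (d : nat) (s : R)
    (E : set 'rV[R]_d) : \bar R :=
  ereal_inf [set (\sum_(0 <= k <oo) packing_pre s (A k))%E |
    A in [set A : nat -> set 'rV[R]_d | E `<=` \bigcup_k A k]].

Definition dimP (R : realType) (d : nat) (E : set 'rV[R]_d) : \bar R :=
  ereal_inf [set s%:E | s in [set s : R | 0 <= s /\
                                packing_measure s E = 0%E]].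

Definition covering_number (R : realType) (d : nat) (delta : R)
    (E : set 'rV[R]_d) : \bar R :=
  ereal_inf [set (n%:R)%:E | n in [set n : nat |
    exists U : 'I_n -> set 'rV[R]_d,
      (forall k, (ediam (U k) <= delta%:E)%E) /\
      E `<=` [set x | exists k, U k x]]].

Definition upper_dimB (R : realType) (d : nat) (E : set 'rV[R]_d) : \bar R :=
  limf_esup (fun delta : R =>
    (lne (covering_number delta E) * ((- ln delta)^-1)%:E)%E) (0 : R)^'+.

(* Only coverings by sets of diameter between phi delta and delta are allowed;
   phi is only used on ]0, Delta[. *)
Definition restricted_dim (R : realType) (d : nat) (Delta : R) (phi : R -> R)
    (E : set 'rV[R]_d) : \bar R :=
  ereal_inf [set s%:E | s in [set s : R | 0 <= s /\
    forall eps, 0 < eps -> exists2 delta0, 0 < delta0 <= Num.min 1 Delta &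
      forall delta, 0 < delta < delta0 ->
        exists C : set (set 'rV[R]_d),
          [/\ countable_cover C E,
              forall U, C U ->
                ((phi delta)%:E <= ediam U)%E /\ (ediam U <= delta%:E)%E &
              (\esum_(U in C) (ediam U `^ s) <= eps%:E)%E]]].

Definition upper_dim_theta (R : realType) (d : nat) (theta : R)
    (E : set 'rV[R]_d) : \bar R :=
  if theta == 0 then dimH E
  else restricted_dim 1 (fun delta => delta `^ theta^-1) E.

Definition monotone_on (R : realType) (D : set R) (f : R -> R) : Prop :=
  (forall x y, D x -> D y -> x <= y -> f x <= f y) \/
  (forall x y, D x -> D y -> x <= y -> f y <= f x).

Definition monotonically_admissible (R : realType) (Delta : R) (Phi : R -> R) :
    Prop :=
  let D := [set delta : R | 0 < delta < Delta] in
  [/\ 0 < Delta, monotone_on D Phi,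
      forall delta, D delta -> 0 < Phi delta <= delta,
      monotone_on D (fun delta => Phi delta / delta) &
      Phi delta / delta @[delta --> (0 : R)^'+] --> (0 : R)].

Definition upper_dim_Phi (R : realType) (d : nat) (Delta : R) (Phi : R -> R)
    (E : set 'rV[R]_d) : \bar R :=
  restricted_dim Delta Phi E.

(* Main.v *)
Require Import Defs.
From mathcomp Require Import all_boot all_order all_algebra finmap.
From mathcomp Require Import all_classical all_reals all_analysis.
From mathcomp Require Import ring lra.

Import Order.TTheory GRing.Theory Num.Theory.
Import numFieldNormedType.Exports.

Local Open Scope classical_set_scope.
Local Open Scope ring_scope.

(** Write [r w] for the Lipschitz ratio on [X] of the map [f w] of a word [w], and
    [F] for the limit set.

    Bounded distortion, the mean value inequality and the connectedness of [X] make
    every [f w] bi-Lipschitz on [X], with both constants within a fixed factor of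
    [r w]; and since the image of a ball contains a ball of comparable radius, the
    open set condition moves the images of a base point under different words of
    the same length apart in proportion to [r w] ([CIFS_bilip_system]).
    Everything else is derived from these facts.  Ratios are then multiplicative up
    to a constant, and so are the level sums.  Hence the pressure is a limit, a
    negative pressure makes the sum of [r w `^ s] over all words finite
    ([sum_above_h]), and below [pressure_h] all level sums are at least [1] for some
    larger exponent ([level_ge1_below_h]).

    Lower bound: if [s < pressure_h], some length and some dyadic size contain so
    many words that, after thinning them out to well separated images, [N] maps
    remain whose lower Lipschitz constant [lam] satisfies [N * lam `^ s >= 1].  The
    Cantor set of these maps lies in [F] and cannot be covered at small
    [s]-dimensional cost ([cantor_positive]), so [pressure_h <= dimH F].  The images
    of [X] under all words of a given length give the converse.

    Upper bound for restricted dimensions: let the sum of [r w `^ s] be finite and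
    let [P] have cheap covers.  At scale [delta], cut each code at the first word
    [w i] whose image has size at most [delta].  An image that is not too small is
    taken as a set of the cover, and these images cost a tail of the convergent sum.
    For a fixed [w], all smaller images are close to the images under [f w] of points
    of [P], and so are covered by the image of a cover of [P] at scale [delta / r w];
    its cost carries the factor [r w `^ s], which can be summed over [w]
    ([adm_limit_set]).  Conversely each point of [P] is close to a point of [F] in
    the same image, except for images that are large, whose points are covered one
    by one at a total cost that tends to zero ([adm_points]).

    The upper box dimension is the restricted dimension in which all diameters equal
    [delta].  Finally the packing dimension of [F] is its upper box dimension by the
    Baire category argument on the space of codes: if countably many sets cover [F],
    one of them is dense in some [f w @` F], a bi-Lipschitz copy of [F]
    ([baire_limit_set]). *)

Set Implicit Arguments.
Unset Strict Implicit.
Unset Printing Implicit Defensive.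

(** * Sums over arbitrary index sets *)

Lemma powR_exprn {R : realType} (a k : R) n : (0 <= a)%R ->
  ((a `^ k) ^+ n = (a ^+ n) `^ k)%R.
Proof.
by move=> a0; rewrite -(powR_mulrn n (powR_ge0 a k)) -(powR_mulrn n a0) powRAC.
Qed.

Section esum_extra.
Context {R : realType}.
Implicit Types (T : choiceType).
Local Open Scope ereal_scope.

Lemma le_esum_set T (A B : set T) (a : T -> \bar R) : A `<=` B ->
  \esum_(i in A) a i <= \esum_(i in B) a i.
Proof.
move=> AB; apply: le_ereal_sup => _ [X [fX XA] <-]; exists X => //.
by split=> // x /XA /AB.
Qed.

Lemma esum_ge1 T (A : set T) (a : T -> \bar R) x : A x -> 0 <= a x ->
  a x <= \esum_(i in A) a i.
Proof.
move=> Ax ax; rewrite -(esum_set1 ax); apply: le_esum_set => _ -> //.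
Qed.

Lemma esumZl T (A : set T) (a : T -> \bar R) (k : R) : (0 <= k)%R ->
  (forall i, 0 <= a i) ->
  \esum_(i in A) (k%:E * a i) = k%:E * \esum_(i in A) a i.
Proof.
move=> k0 a0.
have le1 (h : R) (b : T -> \bar R) : (0 <= h)%R -> (forall i, 0 <= b i) ->
    \esum_(i in A) (h%:E * b i) <= h%:E * \esum_(i in A) b i.
  move=> h0 b0; apply: ge_ereal_sup => _ [X [fX XA] <-].
  rewrite -ge0_mule_fsumr//; apply: lee_wpmul2l; first by rewrite lee_fin.
  by apply: ereal_sup_ubound; exists X.
apply/eqP; rewrite eq_le le1//=.
have [->|kn0] := eqVneq k 0%R; first by rewrite mul0e esum_ge0// => i _; rewrite mul0e.
have kp : (0 < k)%R by rewrite lt_neqAle eq_sym kn0.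
rewrite -lee_pdivlMl//; apply: le_trans (le1 _ _ _ _).
- by apply: le_esum => i _; rewrite muleA -EFinM mulVf// mul1e.
- by rewrite invr_ge0.
- by move=> i; rewrite mule_ge0// lee_fin.
Qed.

Lemma esumZe T (A : set T) (a : T -> \bar R) (k : \bar R) : 0 <= k ->
  (forall i, 0 <= a i) ->
  \esum_(i in A) (k * a i) = k * \esum_(i in A) a i.
Proof.
case: k => [k| |]//; first by rewrite lee_fin => k0 a0; exact: esumZl.
move=> _ a0.
have [[x Ax ax]|none] := pselect (exists2 x, A x & a x != 0).
  have ax0 : 0 < a x by rewrite lt_neqAle eq_sym ax a0.
  have sp : 0 < \esum_(i in A) a i by apply: lt_le_trans (esum_ge1 Ax (a0 x)).
  rewrite [RHS]gt0_mulye//; apply/eqP; rewrite -leye_eq.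
  apply: (@le_trans _ _ (+oo * a x)); first by rewrite gt0_mulye.
  by apply: (@esum_ge1 _ _ (fun i => +oo * a i)) => //; rewrite mule_ge0// leey.
have z x : A x -> a x = 0.
  by move=> Ax; apply/eqP; apply: contraT => ax; case: none; exists x.
rewrite [X in _ = _ * X]esum1// mule0 esum1// => x Ax.
by rewrite z// mule0.
Qed.

(** For a reindexing that is not injective, keep one preimage of each value. *)
Lemma esum_image_le T (T' : choiceType) (P : set T) (e : T -> T')
    (a : T' -> \bar R) : \esum_(j in e @` P) a j <= \esum_(i in P) a (e i).
Proof.
have [->|/set0P[x0 Px0]] := eqVneq P set0; first by rewrite image_set0 !esum_set0.
pose sec y := if pselect (exists2 x, P x & e x = y) is left h
  then projT1 (cid2 h) else x0.
have secP y : (e @` P) y -> P (sec y) /\ e (sec y) = y.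
  by move=> h; rewrite /sec; case: pselect => // h'; case: cid2.
have -> : e @` P = e @` (sec @` (e @` P)).
  apply/seteqP; split => [y yP|_ [_ [y yP <-] <-]].
    by exists (sec y); [exists y|case: (secP _ yP)].
  by have [_ ->] := secP _ yP.
rewrite esum_image; first by apply: le_esum_set => _ [y /secP[? _] <-].
move=> _ _ /set_mem[y yP <-] /set_mem[z zP <-].
by have [_ ->] := secP _ yP; have [_ ->] := secP _ zP => ->.
Qed.

(** An element of several [J k] is counted once on the left and several times on
    the right: the union is the second projection of the set of pairs. *)
Lemma esum_bigcup_le T (T' : choiceType) (K : set T') (J : T' -> set T)
    (a : T -> \bar R) : (forall x, 0 <= a x) ->
  \esum_(i in \bigcup_(k in K) J k) a i <= \esum_(k in K) \esum_(i in J k) a i.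
Proof.
move=> a0; rewrite esum_esum//.
have -> : \bigcup_(k in K) J k = (@snd T' T) @` (K `*`` J).
  apply/seteqP; split => [x [k Kk Jx]|_ [[k x] [/= Kk Jx] <-]].
    by exists (k, x).
  by exists k.
exact: (esum_image_le _ (@snd T' T) a).
Qed.

Lemma esum_bigcup_disjoint T (T' : choiceType) (K : set T') (J : T' -> set T)
    (a : T -> \bar R) : (forall x, 0 <= a x) ->
  (forall k l x, K k -> K l -> J k x -> J l x -> k = l) ->
  \esum_(i in \bigcup_(k in K) J k) a i = \esum_(k in K) \esum_(i in J k) a i.
Proof.
move=> a0 dJ; rewrite esum_esum//.
have -> : \bigcup_(k in K) J k = (@snd T' T) @` (K `*`` J).
  apply/seteqP; split => [x [k Kk Jx]|_ [[k x] [/= Kk Jx] <-]].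
    by exists (k, x).
  by exists k.
apply: (esum_image _ (@snd T' T) a) => -[k x] [l y] /set_mem[/= Kk Jx] /set_mem[/= Kl Jy] xy.
by move: Jx; rewrite xy => Jx; rewrite (dJ k l y).
Qed.

Lemma esumU_le T (A B : set T) (a : T -> \bar R) : (forall x, 0 <= a x) ->
  \esum_(i in A `|` B) a i <= \esum_(i in A) a i + \esum_(i in B) a i.
Proof.
move=> a0; rewrite (esumID A)//; apply: leeD; apply: le_esum_set.
  by move=> x [].
by move=> x [[]].
Qed.

(** The sum is a supremum of finite sums; a finite set that nearly attains it
    leaves at most [eps] outside. *)
Lemma esum_tail T (A : set T) (a : T -> \bar R) (eps : R) :
  (forall x, 0 <= a x) -> \esum_(i in A) a i < +oo -> (0 < eps)%R ->
  exists X : set T, [/\ finite_set X, X `<=` A &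
    \esum_(i in A `\` X) a i <= eps%:E].
Proof.
move=> a0 Afin e0.
have Af : \esum_(i in A) a i \is a fin_num by rewrite ge0_fin_numE// esum_ge0.
have [_ [X [fX XA] <-] lt] := ub_ereal_sup_adherent e0 Af.
exists X; split => //.
have {}lt : \esum_(i in A) a i - eps%:E < \sum_(i \in X) a i := lt.
move: lt Af; rewrite setDE.
have u0 : 0 <= \sum_(i \in X) a i by apply: fsume_ge0.
have v0 : 0 <= \esum_(i in A `&` ~` X) a i by apply: esum_ge0.
have -> : \esum_(i in A) a i = \sum_(i \in X) a i + \esum_(i in A `&` ~` X) a i.
  by rewrite (esumID X)// [A `&` X]setIidr// -esum_fset.
set u := \sum_(i \in X) _ in u0 *; set v := \esum_(i in _) _ in v0 *.
move=> + uvf; move: uvf; rewrite fin_numD => /andP[uf vf].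
rewrite -(fineK uf) -(fineK vf) -EFinN -!EFinD lte_fin lee_fin; lra.
Qed.

Lemma esum_sup_finite T (A : set T) (a : T -> \bar R) (M : \bar R) :
  (forall s : seq T, uniq s -> (forall x, x \in s -> A x) ->
     \sum_(x <- s) a x <= M) -> \esum_(i in A) a i <= M.
Proof.
move=> H; apply: ge_ereal_sup => _ [X [fX XA] <-].
rewrite fsbig_finite//=; apply: H; first exact: fset_uniq.
by move=> x; rewrite in_fset_set// inE => /XA.
Qed.

Lemma esum_ge_seq T (A : set T) (a : T -> \bar R) (s : seq T) :
  (forall x, 0 <= a x) -> uniq s -> (forall x, x \in s -> A x) ->
  \sum_(x <- s) a x <= \esum_(i in A) a i.
Proof.
move=> a0 us sA; rewrite fsbig_seq//.
by apply: ereal_sup_ubound; exists [set` s].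
Qed.

Lemma esum_const_seq T (A : set T) (k M : R) : (0 <= k)%R ->
  (forall s : seq T, uniq s -> (forall x, x \in s -> A x) -> ((size s)%:R <= M)%R) ->
  \esum_(i in A) k%:E <= (M * k)%:E.
Proof.
move=> k0 H; apply: esum_sup_finite => s us sA.
rewrite sumEFin lee_fin big_const_seq count_predT iter_addr_0 -[X in (X <= _)%R]mulr_natl.
by rewrite ler_wpM2r// H.
Qed.

Lemma esum_geometric (z : R) (a : nat -> \bar R) (M : R) :
  (0 <= z < 1)%R -> (0 <= M)%R -> (forall n, 0 <= a n <= (M * z ^+ n)%:E) ->
  \esum_(n in [set: nat]) a n <= (M / (1 - z))%:E.
Proof.
move=> /andP[z0 z1] M0 H.
apply: (@le_trans _ _ (\esum_(n in [set: nat]) (M * z ^+ n)%:E)).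
  by apply: le_esum => n _; case/andP: (H n).
rewrite -nneseries_esumT; last by move=> n; rewrite lee_fin mulr_ge0// exprn_ge0.
apply: lime_le; first by apply: is_cvg_nneseries => n _ _; rewrite lee_fin mulr_ge0// exprn_ge0.
apply: nearW => n; rewrite sumEFin lee_fin.
have -> : (\sum_(0 <= i < n) M * z ^+ i = M * (1 - z ^+ n) / (1 - z))%R.
  by rewrite -[LHS]/(series (geometric M z) n) geometric_seriesE ?lt_eqF.
apply: ler_wpM2r; first by rewrite invr_ge0 subr_ge0 ltW.
by rewrite ler_piMr// lerBlDr lerDl exprn_ge0.
Qed.

End esum_extra.

(** * Euclidean norm, balls and diameters *)

Section euclid.
Context {R : realType} {d : nat}.
Implicit Types (u v x y z : 'rV[R]_d) (r : R).

Definition dotp u v : R := \sum_(i < d) u 0 i * v 0 i.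

Lemma sumsq_ge0 v : 0 <= \sum_(i < d) v 0 i ^+ 2.
Proof. by apply: sumr_ge0 => i _; exact: sqr_ge0. Qed.

Lemma enorm_ge0 v : 0 <= enorm v. Proof. exact: sqrtr_ge0. Qed.

Lemma sqr_enorm v : enorm v ^+ 2 = dotp v v.
Proof. by rewrite sqr_sqrtr ?sumsq_ge0//; apply: eq_bigr => i _; rewrite expr2. Qed.

Lemma enorm0 : enorm (0 : 'rV[R]_d) = 0.
Proof. by rewrite /enorm big1 ?sqrtr0// => i _; rewrite mxE expr0n. Qed.

Lemma enormZ (a : R) v : enorm (a *: v) = `|a| * enorm v.
Proof.
rewrite /enorm -sqrtr_sqr -sqrtrM ?sqr_ge0//; congr Num.sqrt.
by rewrite mulr_sumr; apply: eq_bigr => i _; rewrite mxE exprMn.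
Qed.

Lemma enormN v : enorm (- v) = enorm v.
Proof. by rewrite -scaleN1r enormZ normrN1 mul1r. Qed.

Lemma edistC u v : enorm (u - v) = enorm (v - u).
Proof. by rewrite -enormN opprB. Qed.

Lemma coord_le_enorm v i : `|v 0 i| <= enorm v.
Proof.
rewrite -sqrtr_sqr ler_wsqrtr// (bigD1 i)//= lerDl.
by apply: sumr_ge0 => j _; exact: sqr_ge0.
Qed.

Lemma enorm_eq0 v : (enorm v == 0) = (v == 0).
Proof.
apply/eqP/eqP => [v0|->]; last exact: enorm0.
apply/rowP => i; rewrite mxE; apply/eqP; rewrite -normr_le0 -v0.
exact: coord_le_enorm.
Qed.

Lemma enorm_gt0 v : (0 < enorm v) = (v != 0).
Proof. by rewrite lt_neqAle enorm_ge0 andbT eq_sym enorm_eq0. Qed.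

Lemma edist_gt0 u v : (0 < enorm (u - v)) = (u != v).
Proof. by rewrite enorm_gt0 subr_eq0. Qed.

Lemma dotpC u v : dotp u v = dotp v u.
Proof. by apply: eq_bigr => i _; rewrite mulrC. Qed.

Lemma dotpDl u v w : dotp (u + v) w = dotp u w + dotp v w.
Proof. by rewrite -big_split; apply: eq_bigr => i _; rewrite mxE mulrDl. Qed.

Lemma dotpDr u v w : dotp u (v + w) = dotp u v + dotp u w.
Proof. by rewrite dotpC dotpDl ![dotp _ u]dotpC. Qed.

Lemma dotpZl (a : R) u v : dotp (a *: u) v = a * dotp u v.
Proof. by rewrite mulr_sumr; apply: eq_bigr => i _; rewrite mxE mulrA. Qed.

(** The Cauchy-Schwarz inequality, read off the square of the difference of the
    two normalised vectors. *)
Lemma dotp_le u v : dotp u v <= enorm u * enorm v.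
Proof.
have [->|u0] := eqVneq u 0.
  by rewrite enorm0 mul0r /dotp big1// => i _; rewrite mxE mul0r.
have [->|v0] := eqVneq v 0.
  by rewrite enorm0 mulr0 /dotp big1// => i _; rewrite mxE mulr0.
move: u0 v0; rewrite -!enorm_gt0 => u0 v0.
set a := enorm u in u0 *; set b := enorm v in v0 *.
have := sqr_enorm (b *: u + (- a) *: v).
have dZr (c : R) s t : dotp s (c *: t) = c * dotp s t by rewrite dotpC dotpZl dotpC.
rewrite dotpDl !dotpDr !dotpZl !dZr (dotpC v u) -!sqr_enorm -/a -/b.
have := sqr_ge0 (enorm (b *: u + (- a) *: v)).
move=> + E; rewrite {}E => H.
have {}H : 0 <= (2 * a * b) * (a * b - dotp u v).
  by apply: le_trans H _; rewrite le_eqVlt; apply/orP; left; apply/eqP; ring.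
by rewrite pmulr_rge0 ?subr_ge0// in H; rewrite !mulr_gt0.
Qed.

Lemma enormD u v : enorm (u + v) <= enorm u + enorm v.
Proof.
rewrite -(@ler_pXn2r _ 2)// ?nnegrE ?addr_ge0 ?enorm_ge0//.
rewrite sqr_enorm dotpDl !dotpDr -!sqr_enorm (dotpC v u).
have := dotp_le u v; nra.
Qed.

Lemma edistD u v w : enorm (u - w) <= enorm (u - v) + enorm (v - w).
Proof. by have := enormD (u - v) (v - w); rewrite addrA subrK. Qed.

Lemma mxnorm_le_enorm v : `|v| <= enorm v.
Proof.
have -> : `|v| = mx_norm v by [].
rewrite mx_normrE; apply: bigmax_le; first exact: enorm_ge0.
by move=> [i j] _ /=; rewrite ord1 coord_le_enorm.
Qed.

Lemma coord_le_mxnorm v i : `|v 0 i| <= `|v|.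
Proof.
have -> : `|v| = mx_norm v by [].
by rewrite mx_normrE; exact: (le_bigmax _ (fun ij => `|v ij.1 ij.2|) (0, i)).
Qed.

Lemma enorm_le_coord v r : (forall i, `|v 0 i| <= r) -> enorm v <= d%:R * r.
Proof.
move=> vr; have [d0|] := posnP d.
  by rewrite /enorm big1 ?sqrtr0 ?d0 ?mul0r// => i; have := ltn_ord i; rewrite {2}d0.
move=> d0.
have r0 : 0 <= r by apply: le_trans (vr (Ordinal d0)).
rewrite -(@ler_pXn2r _ 2)// ?nnegrE ?mulr_ge0 ?enorm_ge0// sqr_enorm.
apply: (@le_trans _ _ (\sum_(i < d) r ^+ 2)).
  by apply: ler_sum => i _; rewrite -expr2 -real_normK ?num_real// ler_pXn2r// ?nnegrE.
rewrite sumr_const card_ord exprMn -[_ *+ d]mulr_natl ler_wpM2r ?sqr_ge0//.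
by rewrite expr2 -natrM ler_nat leq_pmulr.
Qed.

Lemma enorm_le_mxnorm v : enorm v <= d%:R * `|v|.
Proof. by apply: enorm_le_coord => i; exact: coord_le_mxnorm. Qed.

Lemma nbhs_eballP x (A : set 'rV[R]_d) :
  nbhs x A <-> exists2 r, 0 < r & eball x r `<=` A.
Proof.
split=> [/nbhs_ballP[e /= e0 eA]|[r r0 rA]].
  exists e => // y xy; apply: eA; rewrite -ball_normE/= distrC.
  exact: le_lt_trans (mxnorm_le_enorm _) xy.
apply/nbhs_ballP; exists (r / d.+1%:R); first by rewrite /= divr_gt0.
move=> y; rewrite -ball_normE/= distrC => xy; apply: rA; rewrite /eball/=.
apply: le_lt_trans (enorm_le_mxnorm _) _.
rewrite ltr_pdivlMr// in xy; apply: le_lt_trans xy.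
by rewrite mulrC ler_wpM2l// ler_nat.
Qed.

Lemma eball_center x r : 0 < r -> eball x r x.
Proof. by rewrite /eball/= subrr enorm0. Qed.

Lemma ecball_center x r : 0 <= r -> ecball x r x.
Proof. by rewrite /ecball/= subrr enorm0. Qed.

Lemma eball_open x r : open (eball x r).
Proof.
rewrite openE => y xy; apply/nbhs_eballP; exists (r - enorm (y - x)).
  by rewrite subr_gt0.
move=> z; rewrite /eball/= ltrBrDr => zy.
exact: le_lt_trans (edistD _ y _) zy.
Qed.

Lemma nbhs_eball x r : 0 < r -> nbhs x (eball x r).
Proof. by move=> r0; apply/nbhs_eballP; exists r. Qed.

Lemma open_eball (A : set 'rV[R]_d) : open A ->
  forall x, A x -> exists2 r, 0 < r & eball x r `<=` A.
Proof. by rewrite openE => oA x /oA; rewrite /interior/= => /nbhs_eballP. Qed.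

Lemma closure_eball (A : set 'rV[R]_d) x : closure A x ->
  forall r, 0 < r -> exists2 y, A y & enorm (y - x) < r.
Proof.
by move=> cA r r0; have [y [Ay xy]] := cA _ (nbhs_eball x r0); exists y.
Qed.

Lemma ecball_closed x r : closed (ecball x r).
Proof.
move=> y cy; rewrite /ecball/=; apply/ler_addgt0Pl => e e0.
have [z xz zy] := closure_eball cy e0.
apply: le_trans (edistD _ z _) _; rewrite edistC.
by apply: lerD => //; exact: ltW.
Qed.

Lemma ecball_compact x r : compact (ecball x r).
Proof.
apply: bounded_closed_compact; last exact: ecball_closed.
rewrite /= /bounded_near; near=> M => y /= yr.
have -> : y = (y - x) + x by rewrite subrK.
apply: le_trans (ler_normD _ _) _.
apply: (@le_trans _ _ (r + `|x|)).
  by rewrite lerD2r; apply: le_trans (mxnorm_le_enorm _) yr.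
by near: M; apply: nbhs_pinfty_ge; rewrite num_real.
Unshelve. all: by end_near. Qed.

Lemma exists_unit : (0 < d)%N -> exists e : 'rV[R]_d, enorm e = 1.
Proof.
move=> d0; exists (delta_mx 0 (Ordinal d0)).
rewrite /enorm (bigD1 (Ordinal d0))//= big1 ?addr0 => [|i iN].
  by rewrite mxE !eqxx expr1n sqrtr1.
by rewrite mxE eqxx (negbTE iN) expr0n.
Qed.


Local Open Scope ereal_scope.

Lemma ediam_ge0 (U : set 'rV[R]_d) : 0 <= ediam U.
Proof. by apply: ereal_sup_ubound; left. Qed.

Lemma ediam_leP (U : set 'rV[R]_d) r : (0 <= r)%R ->
  ediam U <= r%:E <-> (forall x y, U x -> U y -> (enorm (x - y) <= r)%R).
Proof.
move=> r0; split=> [Ur x y Ux Uy|H].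
  rewrite -lee_fin; apply: le_trans Ur; apply: ereal_sup_ubound; right.
  by exists x, y.
apply: ge_ereal_sup => z [->|[x [y [Ux Uy ->]]]]; first by rewrite lee_fin.
by rewrite lee_fin; exact: H.
Qed.

Lemma ediam_ge (U : set 'rV[R]_d) x y : U x -> U y ->
  (enorm (x - y))%:E <= ediam U.
Proof. by move=> Ux Uy; apply: ereal_sup_ubound; right; exists x, y. Qed.

Lemma ediam_fin (U : set 'rV[R]_d) r : ediam U <= r%:E ->
  ediam U = (fine (ediam U))%:E.
Proof.
move=> Ur; rewrite fineK// ge0_fin_numE ?ediam_ge0//.
exact: le_lt_trans Ur (ltry _).
Qed.

Lemma fine_ediam_ge0 (U : set 'rV[R]_d) : (0 <= fine (ediam U))%R.
Proof. by rewrite fine_ge0// ediam_ge0. Qed.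

Lemma ediam_ecball x r : (0 < d)%N -> (0 <= r)%R -> ediam (ecball x r) = (2 * r)%:E.
Proof.
move=> d0 r0; apply/eqP; rewrite eq_le; apply/andP; split.
  apply/ediam_leP; first by rewrite mulr_ge0.
  move=> y z /= xy xz; apply: le_trans (edistD _ x _) _.
  by rewrite [enorm (x - z)]edistC mulr2n mulrDl !mul1r lerD.
have [e e1] := exists_unit d0.
have H (a : R) : (`|a| = r)%R -> ecball x r (x + a *: e)%R.
  by move=> ar; rewrite /ecball/= addrC addKr enormZ e1 mulr1 ar.
have := ediam_ge (H r (ger0_norm r0)) (H (- r)%R (etrans (normrN r) (ger0_norm r0))).
have -> : (x + r *: e - (x + (- r) *: e) = (2 * r) *: e)%R.
  by rewrite opprD addrACA subrr add0r scaleNr opprK -scalerDl mulr2n mulrDl mul1r.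
by rewrite enormZ e1 mulr1 ger0_norm ?mulr_ge0.
Qed.

End euclid.

(** * Mean value inequality and conformal diffeomorphisms *)

Section calculus.
Context {R : realType} {d : nat}.
Implicit Types (f g : 'rV[R]_d -> 'rV[R]_d) (V : set 'rV[R]_d).

Lemma is_derive_dotp_path f (x u e : 'rV[R]_d) (t : R) :
  differentiable f (x + t *: u) ->
  is_derive t (1 : R) (fun s : R => dotp (f (x + s *: u)) e)
    (dotp ('d f (x + t *: u) u) e).
Proof.
move=> df.
pose G (i : 'I_d) := fun v => f v 0 i : R.
have quot i : (fun h : R => h^-1 *: (((fun s : R => G i (x + s *: u)) \o shift t)
      (h *: (1 : R)) - (fun s : R => G i (x + s *: u)) t)) =
    (fun h : R => h^-1 *: ((G i \o shift (x + t *: u)) (h *: u) - G i (x + t *: u))).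
  apply/funext => h /=; congr (_ *: (G i _ - _)).
  by rewrite [h *: (1 : R)]mulr1 scalerDl addrA addrAC addrC addrA addrAC.
have dG i : derivable (G i) (x + t *: u) u.
  by have /derivable_mxP := diff_derivable df (v := u); exact.
have dH i : is_derive t (1 : R) (fun s : R => G i (x + s *: u))
    ('D_u (G i) (x + t *: u)).
  by apply: DeriveDef; rewrite /derivable/derive quot//; exact: dG.
have -> : (fun s : R => dotp (f (x + s *: u)) e) =
    \sum_(i < d) (e 0 i *: (fun s : R => G i (x + s *: u))).
  by apply/funext => s; rewrite fct_sumE; apply: eq_bigr => i _ /=; rewrite mulrC.
have -> : dotp ('d f (x + t *: u) u) e =
    \sum_(i < d) (e 0 i *: 'D_u (G i) (x + t *: u)).
  rewrite -deriveE//; apply: eq_bigr => i _.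
  by rewrite derive_mx ?mxE 1?mulrC//; exact: diff_derivable.
by apply: is_derive_sum => i; apply: is_deriveZ.
Qed.

(** A mean value inequality for vector-valued maps: the scalar theorem is
    applied to the component of [f] along its own increment. *)
Lemma mean_value_segment f (x y : 'rV[R]_d) (M : R) :
  (forall t, 0 <= t <= 1 -> differentiable f (x + t *: (y - x)) /\
     enorm ('d f (x + t *: (y - x)) (y - x)) <= M * enorm (y - x)) ->
  enorm (f y - f x) <= M * enorm (y - x).
Proof.
move=> H.
set e := f y - f x; set u := y - x in H *.
have [e0|e0] := eqVneq e 0.
  have [] := H 0 _; first by rewrite lexx ler01.
  by move=> _ H0; rewrite e0 enorm0; apply: le_trans H0; exact: enorm_ge0.
pose phi := fun s : R => dotp (f (x + s *: u)) e.
pose dphi := fun s : R => dotp ('d f (x + s *: u) u) e.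
have dphiP (s : R) : 0 <= s <= 1 -> is_derive s (1 : R) phi (dphi s).
  by move=> s01; apply: is_derive_dotp_path; case: (H s s01).
have cphi : {within `[0, 1], continuous phi}.
  apply: derivable_within_continuous => s; rewrite in_itv/= => /dphiP ds.
  exact: ex_derive.
have [s s01] : exists2 c, c \in `]0, 1[%R & phi 1 - phi 0 = dphi c * (1 - 0).
  apply: MVT => // s; rewrite in_itv/= => /andP[s0 s1]; apply: dphiP.
  by rewrite !ltW.
rewrite subr0 mulr1 /phi scale1r scale0r addr0.
have -> : x + u = y by rewrite addrC subrK.
have -> : dotp (f y) e - dotp (f x) e = enorm e ^+ 2.
  by rewrite sqr_enorm {3}/e dotpDl -(scaleN1r (f x)) dotpZl mulN1r.
move: s01; rewrite in_itv/= => /andP[s0 s1] E.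
have [_ Hs] := H s (introT andP (conj (ltW s0) (ltW s1))).
have := dotp_le ('d f (x + s *: u) u) e.
rewrite -/(dphi s) -E expr2 => le1.
have epos : 0 < enorm e by rewrite enorm_gt0.
by rewrite ler_pM2r// in le1; exact: le_trans Hs.
Qed.

Lemma opnorm_simil (L : 'rV[R]_d -> 'rV[R]_d) (a : R) : (0 < d)%N -> 0 <= a ->
  (forall v, enorm (L v) = a * enorm v) -> opnorm L = a.
Proof.
move=> d0 a0 La; have [e e1] := @exists_unit R d d0.
have ub : ubound [set enorm (L v) | v in [set v | enorm v <= 1]] a.
  by move=> _ [v /= v1 <-]; rewrite La ler_piMr.
have aS : [set enorm (L v) | v in [set v | enorm v <= 1]] a.
  by exists e; rewrite /= ?La e1 ?mulr1.
apply/eqP; rewrite eq_le; apply/andP; split.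
  by apply: sup_le_ub => //; exists a.
by apply: sup_ubound => //; exists a.
Qed.

Lemma opnorm_diff_id (x : 'rV[R]_d) : (0 < d)%N ->
  opnorm ('d (id : 'rV[R]_d -> 'rV[R]_d) x) = 1.
Proof. by move=> d0; apply: opnorm_simil => // v; rewrite diff_val mul1r. Qed.

(** One notion for the given maps and for all their compositions: of the inverse [g]
    only its differentiability on the open image of [V] is recorded. *)
Definition simil_diffeo V f g :=
  [/\ open (f @` V),
      forall x, V x -> g (f x) = x,
      forall x, V x -> differentiable f x,
      forall y, (f @` V) y -> differentiable g y &
      forall x, V x -> exists2 a, 0 < a &
        forall v, enorm ('d f x v) = a * enorm v].

Lemma simil_diffeo_id V : open V -> simil_diffeo V id id.
Proof.
move=> oV; split=> //; first by rewrite image_id.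
by move=> x _; exists 1 => // v; rewrite diff_val mul1r.
Qed.

Lemma simil_diffeo_comp V f g f2 g2 : f @` V `<=` V ->
  simil_diffeo V f g -> simil_diffeo V f2 g2 -> simil_diffeo V (f2 \o f) (g \o g2).
Proof.
move=> fV [of_ gf df dg sf] [of2 gf2 df2 dg2 sf2].
have fVx x : V x -> V (f x) by move=> Vx; apply: fV; exists x.
split.
- rewrite openE => _ [x Vx <-] /=; rewrite /interior/=.
  have f2fx : (f2 @` V) (f2 (f x)) by exists (f x) => //; exact: fVx.
  have n1 : nbhs (f2 (f x)) (f2 @` V) by apply: open_nbhs_nbhs.
  (* [f2] is open on [V] because its inverse [g2] is continuous *)
  have n2 : nbhs (f2 (f x)) (g2 @^-1` (f @` V)).
    apply: (differentiable_continuous (dg2 _ f2fx)).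
    rewrite gf2; last exact: fVx.
    by apply: open_nbhs_nbhs; split => //; exists x.
  apply: filterS2 n1 n2 => _ [z Vz <-] /= [z' Vz']; rewrite gf2// => zz.
  by exists z' => //=; rewrite zz.
- by move=> x Vx /=; rewrite gf2 ?gf//; exact: fVx.
- move=> x Vx; apply: differentiable_comp; first exact: df.
  by apply: df2; exact: fVx.
- move=> _ [x Vx <-] /=; apply: differentiable_comp.
    by apply: dg2; exists (f x) => //; exact: fVx.
  by rewrite gf2; [apply: dg; exists x|exact: fVx].
- move=> x Vx; have [a a0 sa] := sf _ Vx; have [b b0 sb] := sf2 _ (fVx _ Vx).
  exists (b * a); first exact: mulr_gt0.
  move=> v; rewrite diff_comp; [|exact: df|exact: (df2 _ (fVx _ Vx))].
  by rewrite /= sb sa mulrA.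
Qed.

Lemma simil_diffeo_opnorm V f g x : (0 < d)%N -> simil_diffeo V f g -> V x ->
  0 < opnorm ('d f x) /\ forall v, enorm ('d f x v) = opnorm ('d f x) * enorm v.
Proof.
move=> d0 [_ _ _ _ sf] Vx; have [a a0 sa] := sf _ Vx.
by rewrite (opnorm_simil d0 (ltW a0) sa).
Qed.

(** Differentiating [f \o g = id] on the open image inverts the similarity
    ratio. *)
Lemma simil_diffeo_inv V f g x v : (0 < d)%N -> simil_diffeo V f g -> V x ->
  opnorm ('d f x) * enorm ('d g (f x) v) = enorm v.
Proof.
move=> d0 sdf Vx; have [_ <-] := simil_diffeo_opnorm d0 sdf Vx.
case: sdf => of_ gf df dg sf.
have ffx : (f @` V) (f x) by exists x.
have dfgx : differentiable f (g (f x)) by rewrite gf//; exact: df.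
have dfg := diff_comp (dg _ ffx) dfgx.
have E : \forall y \near f x, (f \o g) y = y.
  have n1 : nbhs (f x) (f @` V) by apply: open_nbhs_nbhs.
  by apply: filterS n1 => _ [z Vz <-] /=; rewrite gf.
have H := deriveE v (differentiable_comp (dg _ ffx) dfgx).
have H2 := congr1 (fun h => h v) (diff_comp (dg _ ffx) dfgx).
have {}H := etrans H H2.
have D : 'D_v (f \o g) (f x) = v.
  have [->|v0] := eqVneq v 0; first by rewrite derive0.
  by rewrite (near_eq_derive _ E) derive_id.
rewrite D /= in H.
clear H2; rewrite gf// in H.
congr (enorm _).
exact: esym H.
Qed.

End calculus.

Section inner_ball.
Context {R : realType} {d : nat}.
Implicit Types (f g : 'rV[R]_d -> 'rV[R]_d) (V A : set 'rV[R]_d).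

Lemma closure_eballP A (x : 'rV[R]_d) :
  (forall r, 0 < r -> exists2 y, A y & enorm (y - x) < r) -> closure A x.
Proof.
move=> H B /nbhs_eballP[r r0 rB]; have [y Ay yx] := H r r0.
by exists y; split => //; apply: rB.
Qed.

Lemma compact_uniform_ball (X V : set 'rV[R]_d) : compact X -> open V -> X `<=` V ->
  exists2 rho : R, 0 < rho & forall x, X x -> ecball x rho `<=` V.
Proof.
move=> cX oV XV.
have /compact_near_coveringP := cX.
move=> /(_ R (0^'+) (fun rho x => ecball x rho `<=` V) _) H.
have : \forall rho \near (0 : R)^'+, X `<=` (fun x => ecball x rho `<=` V).
  apply: H => x Xx.
  have [r r0 rV] := open_eball oV (XV _ Xx).
  near=> y rho => z /= yz; apply: rV; rewrite /eball/=.
  apply: le_lt_trans (edistD _ y _) _.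
  rewrite [r]splitr; apply: ler_ltD.
    apply: le_trans yz _; near: rho; apply: nbhs_right_le; exact: divr_gt0.
  by near: y; apply: nbhs_eball; exact: divr_gt0.
move=> H1.
have : \forall rho \near (0 : R)^'+, 0 < rho /\ X `<=` (fun x => ecball x rho `<=` V).
  by near=> rho; split; [near: rho; exact: nbhs_right_gt|near: rho].
by move=> /filter_ex[rho [rho0 Hrho]]; exists rho.
Unshelve. all: by end_near. Qed.

Lemma compact_bounded_dist (X : set 'rV[R]_d) : compact X ->
  exists2 D : R, 0 < D & forall x y, X x -> X y -> enorm (x - y) <= D.
Proof.
move=> /compact_bounded bX.
have /filter_ex[M [M0 XM]] : \forall M \near +oo, 0 < M /\ forall x, X x -> `|x| <= M.
  by near=> M; split; near: M; [apply: nbhs_pinfty_gt; rewrite num_real|].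
exists (d%:R * (M + M) + 1) => [|x y Xx Xy].
  by rewrite ltr_wpDl// mulr_ge0// addr_ge0 ?ltW.
apply: le_trans (enorm_le_mxnorm _) _; rewrite -[leLHS]addr0 lerD// ler_wpM2l//.
by apply: le_trans (ler_normB _ _) _; apply: lerD; exact: XM.
Unshelve. all: by end_near. Qed.

(** Follow the segment from the image of the centre for as long as it stays in the
    image of the open ball.  Pulled back by [g], which is [L]-Lipschitz along it, the
    segment is too short to reach the boundary of that ball, so it never leaves. *)
Lemma inner_ball V f g (x : 'rV[R]_d) (rho L : R) : (0 < d)%N ->
  simil_diffeo V f g -> 0 < rho -> ecball x rho `<=` V -> 0 < L ->
  (forall z v, V z -> enorm ('d g (f z) v) <= L * enorm v) ->
  eball (f x) (rho / L) `<=` f @` eball x rho.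
Proof.
move=> d0 sd rho0 xV L0 gL y yx; rewrite /eball/= in yx.
have [of_ gf df dg _] := sd.
have Vx : V x by apply: xV; apply: ecball_center; exact: ltW.
set W := f @` eball x rho.
set u := y - f x in yx.
pose z (t : R) := f x + t *: u.
have z0 : z 0 = f x by rewrite /z scale0r addr0.
have z1 : z 1 = y by rewrite /z scale1r addrC subrK.
have zd s t : enorm (z s - z t) = `|s - t| * enorm u.
  by rewrite /z opprD addrACA subrr add0r -scalerBl enormZ.
pose A := [set t : R | 0 <= t <= 1 /\ forall s, 0 <= s <= t -> W (z s)].
have W0 : W (z 0) by rewrite z0; exists x => //; exact: eball_center.
have A0 : A 0.
  split; first by rewrite lexx ler01.
  by move=> s /andP[s0 s1]; have -> : s = 0 by apply/eqP; rewrite eq_le s1.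
have supA : has_sup A by split; [exists 0|exists 1 => t [/andP[]]].
pose tau := sup A.
have tau0 : 0 <= tau by apply: ub_le_sup => //; case: supA.
have tau1 : tau <= 1 by apply: ge_sup; [exists 0|move=> t [/andP[]]].
have Wlt s : 0 <= s < tau -> W (z s).
  move=> /andP[s0 st].
  have [t [_ At] st'] := sup_adherent (eps := tau - s) ltac:(by rewrite subr_gt0) supA.
  by apply: At; rewrite s0/= ltW//; rewrite opprB addrC subrK in st'.
have WV s : W s -> (f @` V) s.
  by move=> [b bx <-]; exists b => //; apply: xV; rewrite /ecball/= ltW.
have u0 : 0 <= enorm u := enorm_ge0 u.
have [b bx fb] : (f @` ecball x rho) (z tau).
  have cl : closed (f @` ecball x rho).
    apply: compact_closed; first exact: norm_hausdorff.
    apply: continuous_compact; last exact: ecball_compact.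
    apply: continuous_in_subspaceT => b /[!inE] bx.
    by apply: differentiable_continuous; apply: df; exact: xV.
  apply: cl; apply: closure_eballP => r r0.
  have [tau_eq0|tau_gt0] : tau = 0 \/ 0 < tau.
    by move: tau0; rewrite le_eqVlt => /orP[/eqP|]; [left|right].
    exists (z 0); first by rewrite z0; exists x => //; apply: ecball_center; exact: ltW.
    by rewrite tau_eq0 subrr enorm0.
  pose s := Num.max 0 (tau - r / (1 + enorm u)).
  have ru : 0 < r / (1 + enorm u) by rewrite divr_gt0// ltr_pwDl.
  have s1 : s < tau by rewrite /s gt_max tau_gt0/= ltrBlDr ltrDl.
  have s0 : 0 <= s by rewrite /s le_max lexx.
  have [b bx fb] := Wlt s (introT andP (conj s0 s1)).
  exists (z s); first by exists b => //; rewrite /ecball/= ltW.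
  rewrite zd ler0_norm ?subr_le0 ?ltW// opprB.
  apply: (@le_lt_trans _ _ (r / (1 + enorm u) * enorm u)).
    apply: ler_wpM2r => //; rewrite lerBlDr -lerBlDl.
    by rewrite /s le_max lexx orbT.
  by rewrite mulrAC ltr_pdivrMr ?ltr_pwDl// ltr_pM2l// ltrDr.
have zV t : 0 <= t <= 1 -> (f @` V) (z (t * tau)).
  move=> /andP[t0 t1].
  have : t * tau <= tau by rewrite ler_piMl.
  rewrite le_eqVlt => /orP[/eqP ->|tt]; first by rewrite -fb; exists b => //; exact: xV.
  by apply: WV; apply: Wlt; rewrite mulr_ge0.
have gb : enorm (b - x) <= L * enorm (z tau - f x).
  have <- : g (z tau) = b by rewrite -fb gf//; exact: xV.
  have {1}<- : g (f x) = x by rewrite gf.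
  apply: mean_value_segment => t t01.
  have -> : f x + t *: (z tau - f x) = z (t * tau).
    by rewrite /z [f x + tau *: u]addrC addrK scalerA.
  by have [c Vc <-] := zV t t01; split; [apply: dg; exists c|exact: gL].
have bx' : enorm (b - x) < rho.
  apply: le_lt_trans gb _; rewrite -z0 zd subr0 ger0_norm//.
  rewrite mulrC -ltr_pdivlMr//; apply: le_lt_trans yx.
  by rewrite ler_piMl.
have Wtau : W (z tau) by rewrite -fb; exists b.
suff tau_eq1 : tau = 1 by rewrite -z1 -tau_eq1.
apply/eqP; rewrite eq_le tau1/= leNgt; apply/negP => tau_lt1.
have [r r0 rW] : exists2 r, 0 < r & eball (z tau) r `<=` W.
  apply/nbhs_eballP; rewrite -fb.
  have n1 : nbhs (f b) (f @` V).
    by apply: open_nbhs_nbhs; split => //; exists b => //; exact: xV.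
  have n2 : nbhs (f b) (g @^-1` eball x rho).
    apply: (differentiable_continuous (dg _ _)); first by exists b => //; exact: xV.
    rewrite gf; last exact: xV.
    by apply: open_nbhs_nbhs; split; [exact: eball_open|].
  by apply: filterS2 n1 n2 => _ [c Vc <-] /=; rewrite gf// => cx; exists c.
have ru : 0 < r / (1 + enorm u) by rewrite divr_gt0// ltr_pwDl.
pose t := Num.min 1 (tau + r / (1 + enorm u) / 2).
have tt : tau < t by rewrite /t lt_min tau_lt1/= ltrDl divr_gt0.
suff /(ub_le_sup (proj2 supA)) : A t by rewrite leNgt tt.
split; first by rewrite (ltW (le_lt_trans tau0 tt)) /t ge_min lexx.
move=> s /andP[s0 st]; have [s_lt|s_ge] := ltP s tau; first by apply: Wlt; rewrite s0.
apply: rW; rewrite /eball/= zd ger0_norm ?subr_ge0//.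
apply: (@le_lt_trans _ _ (r / (1 + enorm u) / 2 * enorm u)).
  apply: ler_wpM2r => //; rewrite lerBlDl.
  by apply: le_trans st _; rewrite /t ge_min lexx orbT.
have : r / (1 + enorm u) / 2 * enorm u <= r / (1 + enorm u) * enorm u.
  by apply: ler_wpM2r => //; lra.
move=> /le_lt_trans; apply.
by rewrite mulrAC ltr_pdivrMr ?ltr_pwDl// ltr_pM2l// ltrDr.
Qed.

End inner_ball.

(** * Uniform bi-Lipschitz bounds for a conformal family *)

Section family_geometry.
Context {R : realType} {d : nat} {W : Type}.
Variables (X V : set 'rV[R]_d) (f : W -> 'rV[R]_d -> 'rV[R]_d) (m : W -> R)
  (L : R) (x0 : 'rV[R]_d).
Hypothesis d0 : (0 < d)%N.
Hypothesis oV : open V.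
Hypothesis XV : X `<=` V.
Hypothesis cX : compact X.
Hypothesis conX : connected X.
Hypothesis Xx0 : X x0.
Hypothesis L_gt0 : 0 < L.
Hypothesis m_gt0 : forall w, 0 < m w.
Hypothesis diffF : forall w x v, V x -> enorm ('d (f w) x v) <= L * m w * enorm v.
Hypothesis invF : forall w, exists g, simil_diffeo V (f w) g /\
  forall z v, V z -> enorm ('d g (f w z) v) <= L / m w * enorm v.

Lemma family_local_upper w x y rho : ecball x rho `<=` V -> enorm (y - x) <= rho ->
  enorm (f w y - f w x) <= L * m w * enorm (y - x).
Proof.
move=> xV yx; apply: mean_value_segment => t /andP[t0 t1].
have Vt : V (x + t *: (y - x)).
  apply: xV; rewrite /ecball/= addrC addKr enormZ ger0_norm//.
  by apply: le_trans yx; rewrite ler_piMl ?enorm_ge0.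
split; last exact: diffF.
by have [g [[_ _ df _ _] _]] := invF w; exact: df.
Qed.

Lemma family_inner_ball w x rho : 0 < rho -> ecball x rho `<=` V ->
  eball (f w x) (rho * m w / L) `<=` f w @` eball x rho.
Proof.
move=> rho0 xV; have [g [sg gb]] := invF w.
have := @inner_ball _ _ V (f w) g x rho (L / m w) d0 sg rho0 xV _ gb.
by rewrite invf_div mulrA; apply; rewrite divr_gt0.
Qed.

(** Away from the diagonal the increments of [f w] are controlled by linking
    points of [X] through short steps.  Rather than counting steps, observe that
    the points of [X] at bounded cost from [x0] form a subset that is both open
    and closed in [X]. *)
Lemma family_bounded : exists2 C : R, 0 < C &
  forall w x, X x -> enorm (f w x - f w x0) <= C * m w.
Proof.
have [rho rho0 rhoV] := compact_uniform_ball cX oV XV.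
pose B := [set y | X y /\ exists M, forall w, enorm (f w y - f w x0) <= M * m w].
have step y z : B y -> X z -> enorm (z - y) <= rho -> B z.
  move=> [Xy [M yM]] Xz zy; split => //; exists (L * rho + M) => w.
  apply: le_trans (edistD _ (f w y) _) _; rewrite mulrDl lerD//.
  apply: le_trans (family_local_upper w (rhoV _ Xy) zy) _.
  by rewrite [leRHS]mulrAC ler_wpM2l// mulr_ge0// ltW// m_gt0.
have BX : B = X.
  apply: conX.
  - exists x0; split => //; exists 0 => w.
    by rewrite subrr enorm0 mul0r.
  - exists (\bigcup_(y in B) eball y rho).
      by apply: bigcup_open => y _; exact: eball_open.
    apply/seteqP; split => [y By|y [Xy [z Bz zy]]].
      by split; [case: By|exists y => //; exact: eball_center].
    by apply: step Bz Xy _; exact: ltW.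
  - exists (~` \bigcup_(y in X `\` B) eball y rho).
      by apply: open_closedC; apply: bigcup_open => y _; exact: eball_open.
    apply/seteqP; split => [y By|y [Xy nz]].
      split; first by case: By.
      by move=> [z [Xz nBz] zy]; apply: nBz; apply: step By Xz _; rewrite edistC ltW.
    apply: contrapT => nBy; apply: nz; exists y => //; exact: eball_center.
have /compact_near_coveringP := cX.
move=> /(_ R (pinfty_nbhs R)
  (fun M y => X y -> forall w, enorm (f w y - f w x0) <= M * m w) _) H.
have {}H : \forall M \near +oo, X `<=`
    (fun y => X y -> forall w, enorm (f w y - f w x0) <= M * m w).
  apply: H => y; rewrite -BX => -[Xy [M yM]].
  near=> z N.
  have zy : enorm (z - y) <= rho.
    by apply: ltW; near: z; exact: nbhs_eball.
  have MN : L * rho + M <= N.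
    by near: N; apply: nbhs_pinfty_ge; rewrite num_real.
  move=> Xz w; apply: le_trans (edistD _ (f w y) _) _.
  apply: (@le_trans _ _ ((L * rho + M) * m w)).
    rewrite mulrDl lerD//.
    apply: le_trans (family_local_upper w (rhoV _ Xy) zy) _.
    by rewrite [leRHS]mulrAC ler_wpM2l// mulr_ge0// ltW// m_gt0.
  by apply: ler_wpM2r MN; exact: ltW.
have : \forall M \near +oo, 0 < M /\ X `<=`
    (fun y => X y -> forall w, enorm (f w y - f w x0) <= M * m w).
  by near=> M; split; [near: M; apply: nbhs_pinfty_gt; rewrite num_real|near: M].
move=> /filter_ex[C [C0 HC]]; exists C => // w x Xx; exact: HC.
Unshelve. all: by end_near. Qed.

Lemma family_upper : exists2 C : R, 0 < C & forall w x y, X x -> X y ->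
  enorm (f w x - f w y) <= C * m w * enorm (x - y).
Proof.
have [rho rho0 rhoV] := compact_uniform_ball cX oV XV.
have [C C0 HC] := family_bounded.
exists (L + 2 * C / rho).
  by rewrite addr_gt0// divr_gt0// mulr_gt0.
move=> w x y Xx Xy; have [xy|xy] := leP (enorm (x - y)) rho.
  apply: le_trans (family_local_upper w (rhoV _ Xy) xy) _.
  apply: ler_wpM2r; first exact: enorm_ge0.
  apply: ler_wpM2r; first exact: ltW.
  by rewrite lerDl divr_ge0 ?mulr_ge0// ltW.
apply: (@le_trans _ _ (2 * C * m w)).
  apply: le_trans (edistD _ (f w x0) _) _; rewrite -mulrA mulr2n mulrDl mul1r.
  by apply: lerD; [exact: HC|rewrite edistC; exact: HC].
apply: (@le_trans _ _ (2 * C / rho * m w * enorm (x - y))).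
  rewrite [leRHS](_ : _ = (2 * C * m w) * (enorm (x - y) / rho)); last by ring.
  by rewrite ler_peMr ?ler_pdivlMr ?mul1r ?ltW// !mulr_gt0.
apply: ler_wpM2r; first exact: enorm_ge0.
apply: ler_wpM2r; first exact: ltW.
by rewrite lerDr ltW.
Qed.

(** Image points that are close enough are joined by a segment inside the image of a
    ball, along which the inverse has a small derivative; otherwise their distance is
    already a fixed proportion of [m w]. *)
Lemma family_lower : exists2 c : R, 0 < c & forall w x y, X x -> X y ->
  c * m w * enorm (x - y) <= enorm (f w x - f w y).
Proof.
have [rho rho0 rhoV] := compact_uniform_ball cX oV XV.
have [D D0 XD] := compact_bounded_dist cX.
pose c := Num.min (L^-1) (rho / L / D).
have c0 : 0 < c by rewrite lt_min invr_gt0 L_gt0/= !divr_gt0.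
exists c => // w x y Xx Xy.
have [xy|xy] := leP (rho * m w / L) (enorm (f w x - f w y)).
  apply: le_trans xy.
  apply: (@le_trans _ _ (rho / L / D * m w * D)).
    apply: ler_pM; rewrite ?enorm_ge0//; last exact: XD.
      by rewrite mulr_ge0// ltW.
    by rewrite ler_wpM2r// ?ge_min ?lexx ?orbT// ltW.
  rewrite mulrAC divfK ?gt_eqF// mulrAC; exact: lexx.
have [g [[of_ gf df dg _] gb]] := invF w.
have Vx := XV Xx; have Vy := XV Xy.
have : enorm (g (f w x) - g (f w y)) <= L / m w * enorm (f w x - f w y).
  apply: mean_value_segment => t /andP[t0 t1].
  have : (f w @` eball y rho) (f w y + t *: (f w x - f w y)).
    apply: family_inner_ball => //; first exact: rhoV.
    rewrite /eball/= addrC addKr enormZ ger0_norm//.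
    by apply: le_lt_trans xy; rewrite ler_piMl ?enorm_ge0.
  move=> [z zy <-]; have Vz : V z by apply: (rhoV _ Xy); exact: ltW.
  by split; [apply: dg; exists z|exact: gb].
rewrite !gf// => H.
apply: (@le_trans _ _ (L^-1 * m w * enorm (x - y))).
  rewrite ler_wpM2r ?enorm_ge0// ler_wpM2r ?ge_min ?lexx// ltW//.
have /(ler_wpM2l (ltW (divr_gt0 (m_gt0 w) L_gt0))) := H.
rewrite mulrA (_ : m w / L * (L / m w) = 1); first by rewrite mul1r mulrC (mulrC (m w)) mulrC.
by rewrite mulrA divfK ?gt_eqF// mulfV// gt_eqF.
Qed.

End family_geometry.

Section word_maps.
Context {R : realType} {d : nat} {I : countType}.
Variables (X V : set 'rV[R]_d) (T : I -> 'rV[R]_d -> 'rV[R]_d) (K : R)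
  (x0 : 'rV[R]_d).
Hypothesis d0 : (0 < d)%N.
Hypothesis oV : open V.
Hypothesis XV : X `<=` V.
Hypothesis cX : compact X.
Hypothesis conX : connected X.
Hypothesis TV : forall i, T i @` V `<=` V.
Hypothesis sdT : forall i, exists g, simil_diffeo V (T i) g.
Hypothesis distT : forall (w : seq I) x y, (0 < size w)%N -> V x -> V y ->
  opnorm ('d (comp_word T w) y) <= K * opnorm ('d (comp_word T w) x).
Hypothesis Xx0 : X x0.

Local Notation f w := (comp_word T w).
Let K1 : R := Num.max K 1.


Lemma word_maps_into w x : V x -> V (f w x).
Proof. by move=> Vx; elim: w => //= i w IH; apply: (TV (i := i)); exists (f w x). Qed.

Lemma word_simil_diffeo w : exists g, simil_diffeo V (f w) g.
Proof.
elim: w => [|i w [g sg]]; first by exists id; exact: simil_diffeo_id.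
have [gi sgi] := sdT i; exists (g \o gi).
have wV : f w @` V `<=` V by move=> _ [x Vx <-]; exact: word_maps_into.
change (f (i :: w)) with (T i \o f w).
exact: simil_diffeo_comp wV sg sgi.
Qed.

Lemma word_ratio_gt0 w x : V x -> 0 < opnorm ('d (f w) x).
Proof. by have [g sg] := word_simil_diffeo w => /(simil_diffeo_opnorm d0 sg)[]. Qed.

Lemma word_diffE w x v : V x ->
  enorm ('d (f w) x v) = opnorm ('d (f w) x) * enorm v.
Proof.
by have [g sg] := word_simil_diffeo w => /(simil_diffeo_opnorm d0 sg)[_ ->].
Qed.

Lemma word_distortion w x y : V x -> V y ->
  opnorm ('d (f w) y) <= K1 * opnorm ('d (f w) x).
Proof.
move=> Vx Vy; case: w => [|i w].
  change (f [::]) with (@id 'rV[R]_d).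
  have aux (a b k : R) : a = 1 -> b = 1 -> 1 <= k -> a <= k * b.
    by move=> -> ->; rewrite mulr1.
  by apply: aux (opnorm_diff_id y d0) (opnorm_diff_id x d0) _; rewrite le_max lexx orbT.
have w0 : (0 < size (i :: w))%N by [].
apply: le_trans (distT w0 Vx Vy) _.
by rewrite ler_wpM2r ?le_max ?lexx// ltW// word_ratio_gt0.
Qed.

(** The derivative ratio at the base point serves as the size of each word map:
    by bounded distortion it is comparable with the derivative at every point. *)
Lemma word_family : exists2 m : seq I -> R, forall w, 0 < m w &
  (forall w x v, V x -> enorm ('d (f w) x v) <= K1 * m w * enorm v) /\
  (forall w, exists g, simil_diffeo V (f w) g /\
     forall z v, V z -> enorm ('d g (f w z) v) <= K1 / m w * enorm v).
Proof.
have Vx0 : V x0 := XV Xx0.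
exists (fun w => opnorm ('d (f w) x0)); first by move=> w; exact: word_ratio_gt0.
split=> [w x v Vx|w].
  have aux (a b e k : R) : 0 <= e -> b <= k -> a = b * e -> a <= k * e.
    by move=> e0 bk ->; rewrite ler_wpM2r.
  exact: aux (enorm_ge0 v) (word_distortion w Vx0 Vx) (word_diffE w v Vx).
have [g sg] := word_simil_diffeo w; exists g; split => // z v Vz.
have aux (e k a b h : R) : 0 <= e -> 0 < a -> a <= k * b -> b * e = h -> e <= k / a * h.
  move=> e0 a0 ak <-; rewrite mulrA ler_peMl//.
  by rewrite mulrAC ler_pdivlMr// mul1r.
exact: aux (enorm_ge0 _) (word_ratio_gt0 w Vx0) (word_distortion w Vz Vx0)
  (simil_diffeo_inv v d0 sg Vz).
Qed.

End word_maps.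

(** * The bi-Lipschitz system of a conformal iterated function system *)

(** The interface between conformal geometry and dimension theory: up to the
    factor [c], Lipschitz ratios govern both the sizes of images and the
    distances between them. *)
Record bilip_system (R : realType) (d : nat) (I : countType)
    (X : set 'rV[R]_d) (S : I -> 'rV[R]_d -> 'rV[R]_d)
    (c rho : R) (p : 'rV[R]_d) : Prop := BilipSystem {
  bs_inh : inhabited I;
  bs_compact : compact X;
  bs_two : exists x y, [/\ X x, X y & x != y];
  bs_into : forall i x, X x -> X (S i x);
  bs_c : 0 < c <= 1;
  bs_rho : 0 < rho < 1;
  bs_upper : forall w x y, X x -> X y ->
    enorm (comp_word S w x - comp_word S w y) <=
      lip_ratio X (comp_word S w) * enorm (x - y);
  bs_lower : forall w x y, X x -> X y ->
    c * lip_ratio X (comp_word S w) * enorm (x - y) <=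
      enorm (comp_word S w x - comp_word S w y);
  bs_gt0 : forall w, 0 < lip_ratio X (comp_word S w);
  bs_decay : forall w, lip_ratio X (comp_word S w) <= rho ^+ size w;
  bs_base : X p;
  bs_sep : forall w v, size w = size v -> w != v ->
    c * lip_ratio X (comp_word S w) <= enorm (comp_word S w p - comp_word S v p)
}.

Section from_CIFS.
Context {R : realType} {d : nat} {I : countType}.
Implicit Types (X V : set 'rV[R]_d) (S T : I -> 'rV[R]_d -> 'rV[R]_d).

Lemma comp_word_into X S w x : (forall i x, X x -> X (S i x)) -> X x ->
  X (comp_word S w x).
Proof. by move=> SX Xx; elim: w => //= i w IH; apply: SX. Qed.

Lemma comp_word_eq X S T w x : (forall i x, X x -> X (S i x)) ->
  (forall i x, X x -> T i x = S i x) -> X x -> comp_word T w x = comp_word S w x.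
Proof.
move=> SX TS Xx; elim: w => //= i w ->; apply: TS; exact: comp_word_into.
Qed.

Lemma comp_word_cat S w v : comp_word S (w ++ v) = comp_word S w \o comp_word S v.
Proof. by elim: w => //= i w ->. Qed.

Lemma comp_word_catE S w v x :
  comp_word S (w ++ v) x = comp_word S w (comp_word S v x).
Proof. by rewrite comp_word_cat. Qed.

Lemma comp_word_contracts X S (rho : R) w x y : (forall i x, X x -> X (S i x)) ->
  0 <= rho -> (forall i x y, X x -> X y ->
     enorm (S i x - S i y) <= rho * enorm (x - y)) -> X x -> X y ->
  enorm (comp_word S w x - comp_word S w y) <= rho ^+ size w * enorm (x - y).
Proof.
move=> SX rho0 Srho Xx Xy; elim: w => [|i w IH] /=; first by rewrite mul1r.
apply: le_trans (Srho _ _ _ _ _) _; try exact: comp_word_into.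
by rewrite exprS -mulrA ler_wpM2l.
Qed.

Lemma lip_ratio_le X (f : 'rV[R]_d -> 'rV[R]_d) (M : R) :
  (exists x y, [/\ X x, X y & x != y]) ->
  (forall x y, X x -> X y -> enorm (f x - f y) <= M * enorm (x - y)) ->
  lip_ratio X f <= M.
Proof.
move=> [x [y [Xx Xy xy]]] H; apply: sup_le_ub.
  by exists (enorm (f x - f y) / enorm (x - y)); exists x, y.
by move=> _ [a [b [Xa Xb ab ->]]]; rewrite ler_pdivrMr ?edist_gt0//; exact: H.
Qed.

Lemma le_lip_ratio X (f : 'rV[R]_d -> 'rV[R]_d) (M : R) x y :
  (forall x y, X x -> X y -> enorm (f x - f y) <= M * enorm (x - y)) ->
  X x -> X y -> enorm (f x - f y) <= lip_ratio X f * enorm (x - y).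
Proof.
move=> H Xx Xy; have [->|xy] := eqVneq x y; first by rewrite !subrr enorm0 mulr0.
rewrite -ler_pdivrMr ?edist_gt0//; apply: sup_ubound; last by exists x, y.
exists M => _ [a [b [Xa Xb ab ->]]]; rewrite ler_pdivrMr ?edist_gt0//; exact: H.
Qed.

(** The open set condition at the first letter passes to words of equal length
    because word maps are injective. *)
Lemma word_images_disjoint X V S T w v :
  X `<=` V -> (forall i x, X x -> X (S i x)) ->
  (forall i x, X x -> T i x = S i x) ->
  (forall i, exists g, simil_diffeo V (T i) g) ->
  (forall i, S i @` X° `<=` X°) ->
  (forall i j, i != j -> (S i @` X°) `&` (S j @` X°) = set0) ->
  size w = size v -> w != v ->
  (comp_word S w @` X°) `&` (comp_word S v @` X°) = set0.
Proof.
move=> XV SX TS sdT SU Sij.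
have SUw u x : X° x -> X° (comp_word S u x).
  by move=> Ux; elim: u => //= i u IH; apply: (SU i); exists (comp_word S u x).
elim: w v => [[]//|i w IH [//|j v]] /= [wv] ne.
apply/seteqP; split => // z [[x Ux <-] [y Uy]] /= E.
have [ij|ij] := eqVneq i j; last first.
  have : ((S i @` X°) `&` (S j @` X°)) (S i (comp_word S w x)).
    by split; [exists (comp_word S w x)|exists (comp_word S v y)] => //; exact: SUw.
  by rewrite Sij.
move: E ne; rewrite -ij => E ne.
have {}E : comp_word S v y = comp_word S w x.
  have [g [_ gT _ _ _]] := sdT i.
  have XU u a : X° a -> X (comp_word S u a) by move=> /SUw /interior_subset; exact.
  by rewrite -[LHS]gT ?TS ?E -?TS ?gT//; (try apply: XV); exact: XU.
have ne' : w != v by apply/eqP => e; move: ne; rewrite e eqxx.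
have E0 := IH v wv ne'; have : (comp_word S w @` X° `&` comp_word S v @` X°) (comp_word S w x).
  by split; [exists x|exists y].
by rewrite E0.
Qed.

(** The Lipschitz ratio of a word map is comparable with its size [m w], so bounds in
    terms of [m w] become bounds in terms of the ratio.  The image of a small ball
    about [p] inside the interior of [X] contains a ball of radius proportional to
    [m w] about the image of [p], and the images of the interior under two words of
    the same length are disjoint; this separates the images of [p]. *)
Lemma CIFS_bilip_system X S : (0 < d)%N -> is_CIFS X S ->
  exists c rho p, bilip_system X S c rho p.
Proof.
move=> d0 [[inhI cX conX two [SX' [rho0 [rho0_ge0 rho0_lt1 Srho0]]]]].
move=> [[p Up] SU Sij] _ [V [T [[oV _ _ XV [TS [eps eps0 Teps] _]] [K K0 dist]]]].
have SX i x : X x -> X (S i x) by move=> Xx; apply: (SX' i); exists x.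
have TV i : T i @` V `<=` V by case: (Teps i) => -[].
have sdT i : exists g, simil_diffeo V (T i) g.
  have [[oTV _ [dT _] [g gT [dg _]]] [cT _]] := Teps i.
  exists g; split => // x Vx.
  have [dx [v v0] sx] := cT x Vx.
  exists (opnorm ('d (T i) x)); last exact: sx.
  rewrite lt_neqAle eq_sym; apply/andP; split.
    apply: contraNneq v0 => m0; rewrite -enorm_eq0 sx m0 mul0r//.
  have [e e1] := @exists_unit R d d0.
  have := sx e; rewrite e1 mulr1 => <-; exact: enorm_ge0.
have Xp : X p by exact: interior_subset.
pose K1 : R := Num.max K 1.
have K1_gt0 : 0 < K1 by rewrite lt_max K0.
have [m m_gt0 [dm im]] := word_family d0 oV XV TV sdT dist Xp.
have [C C0 HC] := family_upper oV XV cX conX Xp K1_gt0 m_gt0 dm im.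
have [c c0 Hc] := family_lower d0 oV XV cX K1_gt0 m_gt0 im.
have TSw w x : X x -> comp_word T w x = comp_word S w x by exact: comp_word_eq.
have Sup w x y : X x -> X y ->
    enorm (comp_word S w x - comp_word S w y) <= C * m w * enorm (x - y).
  by move=> Xx Xy; rewrite -!TSw//; exact: HC.
have Slo w x y : X x -> X y ->
    c * m w * enorm (x - y) <= enorm (comp_word S w x - comp_word S w y).
  by move=> Xx Xy; rewrite -!TSw//; exact: Hc.
set r := fun w => lip_ratio X (comp_word S w).
have Sr w x y : X x -> X y ->
    enorm (comp_word S w x - comp_word S w y) <= r w * enorm (x - y).
  by apply: le_lip_ratio; exact: Sup.
have rC w : r w <= C * m w by apply: lip_ratio_le => //; exact: Sup.
have r_gt0 w : 0 < r w.
  have [x [y [Xx Xy xy]]] := two.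
  have := le_trans (Slo w x y Xx Xy) (Sr w x y Xx Xy).
  rewrite ler_pM2r ?edist_gt0//; apply: lt_le_trans; exact: mulr_gt0.
have [b b0 bU] : exists2 b, 0 < b & ecball p b `<=` X°.
  have [e e0 eX] := open_eball (open_interior _) Up.
  exists (e / 2); first exact: divr_gt0.
  move=> x px; apply: eX; apply: le_lt_trans px _.
  by rewrite ltr_pdivrMr// ltr_pMr// ltr1n.
pose c1 := Num.min 1 (Num.min (c / C) (b / K1 / C)).
have c1_gt0 : 0 < c1 by rewrite !lt_min ltr01 !divr_gt0.
pose rho1 := Num.max rho0 (1 / 2).
exists c1, rho1, p; split => //.
- by rewrite c1_gt0 ge_min lexx.
- by rewrite lt_max gt_max rho0_lt1/= divr_gt0 ?orbT//= ltr_pdivrMr// mul1r ltr1n.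
- move=> w x y Xx Xy; apply: le_trans (Slo w x y Xx Xy).
  rewrite ler_wpM2r ?enorm_ge0//.
  apply: (@le_trans _ _ (c / C * (C * m w))).
    apply: ler_pM; [exact: ltW|exact: ltW (r_gt0 w)| |exact: rC].
    by rewrite !ge_min lexx orbT.
  by rewrite mulrA divfK ?gt_eqF.
- move=> w; apply: (@le_trans _ _ (rho0 ^+ size w)).
    apply: lip_ratio_le => // x y Xx Xy; exact: (comp_word_contracts w SX rho0_ge0 Srho0 Xx Xy).
  by apply: lerXn2r; rewrite ?nnegrE ?le_max ?lexx ?rho0_ge0.
- move=> w v sz wv; rewrite leNgt; apply/negP => lt1.
  have : eball (comp_word T w p) (b * m w / K1) (comp_word S v p).
    rewrite /eball/= TSw// edistC; apply: lt_le_trans lt1 _.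
    apply: (@le_trans _ _ (b / K1 / C * (C * m w))).
      apply: ler_pM; [exact: ltW|exact: ltW (r_gt0 w)| |exact: rC].
      by rewrite !ge_min lexx !orbT.
    by rewrite mulrA divfK ?gt_eqF// mulrAC.
  have bV : ecball p b `<=` V by move=> x /bU /interior_subset/XV.
  move=> /(family_inner_ball d0 K1_gt0 m_gt0 im b0 bV)[z zb E].
  have Uz : X° z by apply: bU; exact: ltW.
  have := word_images_disjoint XV SX TS sdT SU Sij sz wv.
  have : (comp_word S w @` X° `&` comp_word S v @` X°) (comp_word S v p).
    split; [exists z => //; rewrite -E TSw//; exact: interior_subset|by exists p].
  by move=> + E0; rewrite E0.
Qed.

End from_CIFS.

(** * Codes and the limit set *)

Section coding.
Context {R : realType} {d : nat} {I : countType}.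
Variables (X : set 'rV[R]_d) (S : I -> 'rV[R]_d -> 'rV[R]_d) (c rho : R)
  (p : 'rV[R]_d).
Hypothesis BS : bilip_system X S c rho p.

Local Notation f := (comp_word S).
Local Notation r w := (lip_ratio X (comp_word S w)).
Local Notation F := (limit_set X S).

Lemma word_into w x : X x -> X (f w x).
Proof. exact: comp_word_into (bs_into BS). Qed.

Lemma ratio_nil : r [::] = 1.
Proof.
have two := bs_two BS.
apply/eqP; rewrite eq_le; apply/andP; split.
  by apply: lip_ratio_le => // x y Xx Xy; rewrite mul1r.
have [x [y [Xx Xy xy]]] := two.
have := bs_upper BS [::] Xx Xy => /= H.
by rewrite -(ler_pM2r (_ : 0 < enorm (x - y))) ?edist_gt0// mul1r.
Qed.

Lemma ratio_cat_le w v : r (w ++ v) <= r w * r v.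
Proof.
apply: lip_ratio_le => [|x y Xx Xy]; first exact: bs_two BS.
rewrite comp_word_cat /=.
apply: le_trans (bs_upper BS _ (word_into _ Xx) (word_into _ Xy)) _.
by rewrite -mulrA ler_wpM2l ?(bs_upper BS)// ltW// (bs_gt0 BS).
Qed.

(** The lower Lipschitz bound of the outer word is what makes ratios supermultiplicative
    up to [c]. *)
Lemma ratio_cat_ge w v : c * (r w * r v) <= r (w ++ v).
Proof.
have [x0 [y0 [Xx0 Xy0 xy0]]] := bs_two BS.
have cr w' : 0 < c * r w' by rewrite mulr_gt0 ?(bs_gt0 BS)//; case/andP: (bs_c BS).
rewrite mulrA -ler_pdivlMl//; apply: lip_ratio_le => [|x y Xx Xy]; first exact: bs_two BS.
rewrite -mulrA ler_pdivlMl//.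
apply: le_trans (bs_lower BS _ (word_into _ Xx) (word_into _ Xy)) _.
have := bs_upper BS (w ++ v) Xx Xy; rewrite comp_word_cat /=; exact.
Qed.

Lemma ratio_le1 w : r w <= 1.
Proof.
apply: le_trans (bs_decay BS w) _; case/andP: (bs_rho BS) => r0 r1.
by rewrite exprn_ile1 ?ltW.
Qed.

Lemma image_cat w v : f (w ++ v) @` X `<=` f w @` X.
Proof.
move=> _ [x Xx <-]; exists (f v x); first exact: word_into.
by rewrite comp_word_cat.
Qed.

Lemma image_into w : f w @` X `<=` X.
Proof. by move=> _ [x Xx <-]; exact: word_into. Qed.

Lemma mkseqD (w : nat -> I) n m :
  mkseq w (n + m) = mkseq w n ++ mkseq (fun k => w (n + k)%N) m.
Proof.
rewrite /mkseq iotaD map_cat add0n; congr (_ ++ _).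
by rewrite -[n in iota n m]addn0 iotaDl -map_comp.
Qed.

Lemma image_mkseq_le (w : nat -> I) n m : (n <= m)%N ->
  f (mkseq w m) @` X `<=` f (mkseq w n) @` X.
Proof. by move=> nm; rewrite -(subnKC nm) mkseqD; exact: image_cat. Qed.

Lemma limit_setP x : F x <-> exists w : nat -> I, forall n, (f (mkseq w n) @` X) x.
Proof.
split=> [[w _ H]|[w H]]; last by exists w => // n _; exact: H.
exists w => n; move: (H n.+1 isT).
exact: image_mkseq_le.
Qed.

Lemma limit_set_sub : F `<=` X.
Proof. by move=> x /limit_setP[w /(_ 0%N)] /image_into. Qed.

Lemma image_dist w D x y : (forall x y, X x -> X y -> enorm (x - y) <= D) ->
  (f w @` X) x -> (f w @` X) y -> enorm (x - y) <= D * r w.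
Proof.
move=> XD [a Xa <-] [b Xb <-]; apply: le_trans (bs_upper BS w Xa Xb) _.
by rewrite mulrC ler_wpM2r ?XD// ltW// (bs_gt0 BS).
Qed.

Lemma image_closed w : closed (f w @` X).
Proof.
apply: compact_closed; first exact: norm_hausdorff.
apply: continuous_compact; last exact: (bs_compact BS).
apply/subspace_continuousP => x Xx B /nbhs_eballP[e e0 eB].
have r0 := bs_gt0 BS w.
rewrite /= /nbhs/= /within/=.
have : nbhs x (eball x (e / r w)) by apply: nbhs_eball; rewrite divr_gt0.
apply: filterS => y yx Xy; apply: eB; apply: le_lt_trans (bs_upper BS w Xy Xx) _.
by rewrite mulrC -ltr_pdivlMr.
Qed.

(** The images of [X] along a code are nested and compact. *)
Lemma code_point (w : nat -> I) : exists x, forall n, (f (mkseq w n) @` X) x.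
Proof.
pose u n := f (mkseq w n) p.
have u_in n k : (n <= k)%N -> (f (mkseq w n) @` X) (u k).
  by move=> /(image_mkseq_le (w := w)); apply; exists p => //; exact: (bs_base BS).
have [x [Xx clx]] : X `&` cluster (u @ \oo) !=set0.
  apply: (bs_compact BS); exists 0%N => // k _ /=.
  exact: image_into (u_in 0%N k isT).
exists x => n; apply: image_closed => B nB.
have : (u @ \oo) (f (mkseq w n) @` X) by exists n => // k /= nk; exact: u_in.
by move=> /clx /(_ nB).
Qed.

Lemma limit_set_inh : exists x, F x.
Proof.
have [i] := bs_inh BS; have [x Hx] := code_point (fun=> i).
by exists x; apply/limit_setP; exists (fun=> i).
Qed.

Definition cat_code (w : seq I) (z : nat -> I) : nat -> I :=
  fun n => nth (z (n - size w)%N) w n.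

Lemma mkseq_cat_code w z n : mkseq (cat_code w z) (size w + n) = w ++ mkseq z n.
Proof.
rewrite mkseqD; congr (_ ++ _).
  apply: (@eq_from_nth _ (z 0%N)); rewrite size_mkseq// => k kw.
  by rewrite nth_mkseq//; apply: set_nth_default.
by apply: eq_map => k; rewrite /cat_code nth_default ?leq_addr// addKn.
Qed.

Lemma limit_set_word w x : F x -> F (f w x).
Proof.
move=> /limit_setP[z Hz]; apply/limit_setP; exists (cat_code w z) => n.
apply: (image_mkseq_le (leq_addl (size w) n)).
rewrite mkseq_cat_code; have [y Xy <-] := Hz n; exists y => //.
by rewrite comp_word_cat.
Qed.

Lemma limit_set_in_image w : exists x, F x /\ (f w @` X) x.
Proof.
have [x Fx] := limit_set_inh; exists (f w x); split; first exact: limit_set_word.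
by exists x => //; exact: limit_set_sub.
Qed.

Lemma ratio_to0 (e : R) : 0 < e -> exists N, forall w, (N <= size w)%N -> r w <= e.
Proof.
move=> e0; have /andP[rho0 rho1] := bs_rho BS.
have : (fun n => rho ^+ n) @ \oo --> (0 : R) by apply: cvg_expr; rewrite ger0_norm ?ltW.
move=> /cvgrPdist_le/(_ e e0)[N _ HN]; exists N => w Nw.
have := HN (size w) Nw; rewrite sub0r normrN ger0_norm; last by rewrite exprn_ge0 ?ltW.
move=> H.
exact: le_trans (bs_decay BS w) H.
Qed.

End coding.

(** * Level sums and pressure *)

Section quasi_additive.
Context {R : realType}.

(** [a] is subadditive and [a - C] is superadditive, so every quotient
    [(a m - C) / m] lies below every quotient [a n / n]; the supremum of the
    former is the limit. *)
Lemma quasi_additive_limit (a : nat -> R) (C : R) : 0 <= C ->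
  (forall n m, a (n + m)%N <= a n + a m) ->
  (forall n m, a n + a m - C <= a (n + m)%N) ->
  exists L : R, [/\ (fun n => n%:R^-1 * a n) @ \oo --> L,
    forall n, (0 < n)%N -> n%:R * L <= a n &
    forall n, a n <= n%:R * L + C].
Proof.
move=> C0 sub sup_.
have subM n m : (0 < m)%N -> a (m * n)%N <= m%:R * a n.
  elim: m => [//|[_|m IH] _]; first by rewrite mul1n mul1r.
  rewrite mulSn -natr1 mulrDl mul1r addrC; apply: le_trans (sub _ _) _.
  by rewrite lerD2l; exact: IH.
have supM n m : (0 < m)%N -> m%:R * (a n - C) <= a (m * n)%N - C.
  elim: m => [//|[_|m IH] _]; first by rewrite mul1n mul1r.
  rewrite mulSn -natr1 mulrDl mul1r.
  have := IH isT; have := sup_ n (m.+1 * n)%N; lra.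
pose Q := [set (a m.+1 - C) / m.+1%:R | m in [set: nat]].
have Qub n : (0 < n)%N -> ubound Q (a n / n%:R).
  move=> n0 _ [m _ <-]; rewrite ler_pdivrMr ?ltr0n// mulrAC ler_pdivlMr ?ltr0n//.
  rewrite mulrC [leRHS]mulrC; apply: le_trans (supM _ _ n0) _.
  apply: le_trans (subM _ _ (isT : (0 < m.+1)%N)).
  by rewrite mulnC gerBl.
have Q0 : Q !=set0 by exists ((a 1%N - C) / 1%:R), 0%N.
have hQ : has_sup Q by split => //; exists (a 1%N / 1%:R); exact: Qub.
pose L := sup Q.
have HL n : (0 < n)%N -> n%:R * L <= a n.
  by move=> n0; rewrite mulrC -ler_pdivlMr ?ltr0n//; apply: ge_sup => //; exact: Qub.
have HU n : a n <= n%:R * L + C.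
  case: n => [|n]; first by rewrite mul0r add0r; have := sup_ 0%N 0%N; rewrite addn0; lra.
  rewrite -lerBlDr mulrC -ler_pdivrMr ?ltr0n//.
  by apply: ub_le_sup; [case: hQ|exists n].
exists L; split => //.
have H0 : (fun n : nat => n.+1%:R^-1 * C) @ \oo --> (0 : R).
  rewrite -(mul0r C); apply: cvgMl; exact: cvg_harmonic.
apply/cvgrPdist_le => e e0.
move/cvgrPdist_le : H0 => /(_ e e0)[N _ HN].
exists N.+1 => // -[//|n] /= Nn.
have := HN n Nn; rewrite /= sub0r normrN ger0_norm; last first.
  by rewrite mulr_ge0// invr_ge0 ler0n.
have n0 : 0 < n.+1%:R :> R by rewrite ltr0n.
rewrite mulrC ler_pdivrMr// => He.
rewrite distrC ger0_norm; last first.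
  by rewrite subr_ge0 mulrC ler_pdivlMr// mulrC HL.
rewrite lerBlDr mulrC ler_pdivrMr// mulrDl [L * _]mulrC.
by have := HU n.+1; lra.
Qed.

End quasi_additive.

Section pressure.
Context {R : realType} {d : nat} {I : countType}.
Variables (X : set 'rV[R]_d) (S : I -> 'rV[R]_d -> 'rV[R]_d) (c rho : R)
  (p : 'rV[R]_d).
Hypothesis BS : bilip_system X S c rho p.

Local Notation f := (comp_word S).
Local Notation r w := (lip_ratio X (comp_word S w)).
Local Notation F := (limit_set X S).

Definition words (n : nat) : set (seq I) := [set w | size w = n].

Definition level (n : nat) (t : R) : \bar R :=
  \esum_(w in words n) ((r w) `^ t)%:E.

Lemma lip_ratio_patch g : lip_ratio X (g \_ X) = lip_ratio X g.
Proof.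
rewrite /lip_ratio; congr sup; apply/seteqP; split => z [x [y [Xx Xy xy ->]]];
  by exists x, y; split => //; rewrite !patchE !mem_set.
Qed.

(** The images of the base point tell the words of one length apart, so counting maps
    is counting words. *)
Lemma phi_sumE n t : phi_sum X S n t = level n t.
Proof.
rewrite /phi_sum /level_maps (esum_image (words n)); last first.
  move=> w v /set_mem wn /set_mem vn E; apply/eqP; apply: contraT => wv.
  have := bs_sep BS (etrans wn (esym vn)) wv.
  have pX : p \in X by rewrite inE; exact: (bs_base BS).
  have := congr1 (fun g => g p) E; rewrite !patchE pX => ->.
  rewrite subrr enorm0 leNgt mulr_gt0 ?(bs_gt0 BS)//; first by case/andP: (bs_c BS).
by apply: eq_esum => w _; rewrite lip_ratio_patch.
Qed.

Local Open Scope ereal_scope.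

Lemma level_gt0 n t : 0 < level n t.
Proof.
have [i] := bs_inh BS.
apply: (@lt_le_trans _ _ ((r (nseq n i)) `^ t)%:E).
  by rewrite lte_fin powR_gt0// (bs_gt0 BS).
apply: (@esum_ge1 _ _ _ (fun w => ((r w) `^ t)%:E)) => /=; first by rewrite /words/= size_nseq.
by rewrite lee_fin powR_ge0.
Qed.

Lemma level_ge0 n t : 0 <= level n t. Proof. exact: ltW (level_gt0 n t). Qed.

Lemma level_cat n m (a : seq I -> \bar R) : (forall w, 0 <= a w) ->
  \esum_(w in words (n + m)) a w =
  \esum_(u in words n) \esum_(v in words m) a (u ++ v).
Proof.
move=> a0; rewrite esum_esum//.
have -> : words (n + m) = (fun k : seq I * seq I => k.1 ++ k.2) @` (words n `*`` (fun=> words m)).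
  apply/seteqP; split => [w wn|_ [[u v] /= [un vm] <-]].
    exists (take n w, drop n w); last by rewrite /= cat_take_drop.
    by split; rewrite /words/= ?size_take ?size_drop wn ?addKn//; case: ltnP => // h;
      apply/eqP; rewrite eqn_leq h leq_addr.
  by rewrite /words/= size_cat un vm.
rewrite (esum_image (words n `*`` (fun=> words m)) (fun k : seq I * seq I => k.1 ++ k.2))//.
move=> [u v] [u' v'] /set_mem[/= un vm] /set_mem[/= un' vm'] /eqP.
by rewrite eqseq_cat ?un ?un'// => /andP[/eqP -> /eqP ->].
Qed.

Lemma level_prod n m t : \esum_(u in words n) \esum_(v in words m)
    ((r u) `^ t * (r v) `^ t)%:E = level n t * level m t.
Proof.
transitivity (\esum_(u in words n) (level m t * ((r u) `^ t)%:E)).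
  apply: eq_esum => u _; rewrite muleC -esumZl ?powR_ge0//.
  by move=> v; rewrite lee_fin powR_ge0.
rewrite esumZe ?level_ge0//; first by rewrite muleC.
by move=> u; rewrite lee_fin powR_ge0.
Qed.

Lemma level_cat_le n m t : (0 <= t)%R -> level (n + m) t <= level n t * level m t.
Proof.
move=> t0; rewrite -level_prod /level level_cat; last first.
  by move=> w; rewrite lee_fin powR_ge0.
apply: le_esum => u _; apply: le_esum => v _; rewrite lee_fin.
have u0 := ltW (bs_gt0 BS u); have v0 := ltW (bs_gt0 BS v).
rewrite -powRM//; apply: ge0_ler_powR => //; rewrite ?nnegrE ?mulr_ge0//.
  exact: ltW (bs_gt0 BS _).
exact: ratio_cat_le BS u v.
Qed.

Lemma level_cat_ge n m t : (0 <= t)%R ->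
  (c `^ t)%:E * (level n t * level m t) <= level (n + m) t.
Proof.
move=> t0; rewrite -level_prod /level level_cat; last first.
  by move=> w; rewrite lee_fin powR_ge0.
rewrite -esumZl ?powR_ge0//; last first.
  by move=> u; apply: esum_ge0 => v _; rewrite lee_fin mulr_ge0 ?powR_ge0.
apply: le_esum => u _; rewrite -esumZl ?powR_ge0//; last first.
  by move=> v; rewrite lee_fin mulr_ge0 ?powR_ge0.
apply: le_esum => v _; rewrite -EFinM lee_fin.
have u0 := ltW (bs_gt0 BS u); have v0 := ltW (bs_gt0 BS v).
have c0 : (0 <= c)%R by case/andP: (bs_c BS) => /ltW.
rewrite -powRM// -powRM ?mulr_ge0//; apply: ge0_ler_powR => //.
- by rewrite nnegrE !mulr_ge0.
- by rewrite nnegrE; exact: ltW (bs_gt0 BS _).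
- exact: ratio_cat_ge BS u v.
Qed.

Lemma level0 t : level 0 t = 1.
Proof.
have -> : level 0 t = \esum_(w in [set [::] : seq I]) ((r w) `^ t)%:E.
  by congr esum; apply/seteqP; split => w; [move=> /size0nil|move=> ->].
by rewrite esum_set1 (ratio_nil BS) powR1.
Qed.

Lemma level_fin n t : (0 <= t)%R -> level 1 t < +oo -> level n t < +oo.
Proof.
move=> t0 l1; elim: n => [|n IH]; first by rewrite level0 ltry.
rewrite -add1n; apply: le_lt_trans (level_cat_le _ _ t0) _.
by rewrite lte_mul_pinfty ?level_ge0// ge0_fin_numE ?level_ge0.
Qed.

Lemma level_inf n t : (0 <= t)%R -> level 1 t = +oo -> level n.+1 t = +oo.
Proof.
move=> t0 l1; apply/eqP; rewrite -leye_eq -add1n.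
apply: le_trans (level_cat_ge _ _ t0).
rewrite l1 gt0_mulye ?level_gt0// gt0_muley// lte_fin powR_gt0//.
by case/andP: (bs_c BS).
Qed.

Lemma pressure_infinite t : (0 <= t)%R -> level 1 t = +oo -> pressure X S t = +oo.
Proof.
move=> t0 l1; apply/cvg_lim => //.
apply: (@cvg_trans _ ((fun=> +oo) @ \oo)); last exact: cvg_cst.
apply: near_eq_cvg; exists 1%N => // -[//|n] _ /=.
rewrite phi_sumE (level_inf _ t0 l1) /= gt0_muley// lte_fin invr_gt0 ltr0n//.
Qed.

(** The logarithms of the level sums are subadditive because ratios are
    submultiplicative, and superadditive up to [ln (c `^ t)] because ratios are
    supermultiplicative up to [c]. *)
Lemma pressure_finite t : (0 <= t)%R -> level 1 t < +oo -> exists L C : R,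
  [/\ pressure X S t = L%:E,
     forall n, (0 < n)%N -> (expR (n%:R * L))%:E <= level n t &
     forall n, level n t <= (expR C * expR L ^+ n)%:E].
Proof.
move=> t0 l1.
have lf n : level n t = (fine (level n t))%:E.
  by rewrite fineK// ge0_fin_numE ?level_ge0//; exact: level_fin.
have lp n : (0 < fine (level n t))%R by rewrite -lte_fin -lf level_gt0.
have /andP[c0 c1] := bs_c BS.
pose a n := ln (fine (level n t)).
have [|n m|n m|L [aL La aU]] := @quasi_additive_limit R a (- ln (c `^ t)).
- by rewrite oppr_ge0 ln_powR mulr_ge0_le0// ln_le0.
- rewrite /a -lnM ?posrE// ler_ln ?posrE// ?mulr_gt0//.
  by rewrite -lee_fin EFinM -!lf; exact: level_cat_le.
- rewrite /a opprK addrC -lnM ?posrE// -lnM ?posrE ?mulr_gt0 ?powR_gt0//.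
  rewrite ler_ln ?posrE ?mulr_gt0 ?powR_gt0//.
  by rewrite -lee_fin !EFinM -!lf; exact: level_cat_ge.
exists L, (- ln (c `^ t))%R; split.
- apply/cvg_lim => //.
  have -> : (fun n => (n%:R^-1)%:E * lne (phi_sum X S n t)) = EFin \o (fun n => n%:R^-1 * a n)%R.
    by apply/funext => n /=; rewrite phi_sumE lf lne_EFin// EFinM.
  by apply/fine_cvgP; split; [exact: nearW|exact: aL].
- move=> n n0; rewrite lf lee_fin -[leRHS]lnK ?posrE// ler_expR; exact: La.
- move=> n; rewrite lf lee_fin -[leLHS]lnK ?posrE// -expRM_natl -expRD ler_expR.
  by rewrite addrC; exact: aU.
Qed.

(** By subadditivity the limit lies below each normalised logarithm. *)
Lemma pressure_lt0 t n : (0 <= t)%R -> (0 < n)%N -> level n t < 1 ->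
  pressure X S t < 0.
Proof.
move=> t0 n0 ln1.
have l1 : level 1 t < +oo.
  rewrite ltey; apply/negP => /eqP l1.
  by move: ln1 n0; case: n => // n; rewrite (level_inf _ t0 l1).
have [L [C [-> HL _]]] := pressure_finite t0 l1.
have := le_lt_trans (HL n n0) ln1; rewrite lte_fin -[ltRHS]expR0 ltr_expR lte_fin.
by rewrite pmulr_rlt0// ltr0n.
Qed.

(** Under negative pressure the level sums decay geometrically in the length. *)
Lemma sum_all_words_lty t : (0 <= t)%R -> pressure X S t < 0 ->
  \esum_(w in [set: seq I]) ((r w) `^ t)%:E < +oo.
Proof.
move=> t0 P0.
have l1 : level 1 t < +oo.
  by rewrite ltey; apply/negP => /eqP l1; move: P0; rewrite pressure_infinite.
have [L [C [PL _ HC]]] := pressure_finite t0 l1.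
move: P0; rewrite PL lte_fin => L0.
have -> : [set: seq I] = \bigcup_(n in [set: nat]) words n.
  by apply/seteqP; split => // w _; exists (size w).
apply: le_lt_trans (esum_bigcup_le _ _ _) _.
  by move=> w; rewrite lee_fin powR_ge0.
apply: le_lt_trans (@esum_geometric _ (expR L) _ (expR C) _ _ _) (ltry _).
- by rewrite expR_ge0 -[ltRHS]expR0 ltr_expR.
- exact: expR_ge0.
- by move=> n; rewrite level_ge0 HC.
Qed.

Lemma ratio_powR_anti s t w : (t <= s)%R -> ((r w) `^ s <= (r w) `^ t)%R.
Proof.
by move=> ts; apply: ger_powR => //; rewrite (bs_gt0 BS) (ratio_le1 BS).
Qed.

Lemma sum_above_h s : pressure_h X S < s%:E ->
  (0 < s)%R /\ \esum_(w in [set: seq I]) ((r w) `^ s)%:E < +oo.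
Proof.
move=> /ereal_inf_lt[_ [t [t0 Pt] <-]]; rewrite lte_fin => ts.
split; first exact: lt_trans ts.
apply: le_lt_trans (sum_all_words_lty (ltW t0) Pt).
by apply: le_esum => w _; rewrite lee_fin ratio_powR_anti// ltW.
Qed.

Lemma level_ge1_below_h s : (0 <= s)%R -> s%:E < pressure_h X S ->
  exists2 t, (s < t)%R & forall n, (0 < n)%N -> 1 <= level n t.
Proof.
move=> s0 sh.
have [t st th] : exists2 t : R, (s < t)%R & t%:E < pressure_h X S.
  case: (pressure_h X S) sh => [u| |] //; last by exists (s + 1)%R; rewrite ?ltry ?ltrDl.
  rewrite lte_fin => su; exists ((s + u) / 2)%R; rewrite ?lte_fin; lra.
exists t => // n n0; rewrite leNgt; apply/negP => ln1.
have t0 : (0 < t)%R by exact: le_lt_trans st.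
have Pt := pressure_lt0 (ltW t0) n0 ln1.
have : pressure_h X S <= t%:E by apply: ereal_inf_lbound; exists t.
by rewrite leNgt th.
Qed.

Lemma pressure_h_ge0 : 0 <= pressure_h X S.
Proof. by apply: le_ereal_inf_tmp => _ [t [t0 _] <-]; rewrite lee_fin ltW. Qed.

End pressure.

(** * Lower bound for the Hausdorff dimension *)

Section cantor.
Context {R : realType} {d : nat} {I : countType}.
Variables (X : set 'rV[R]_d) (S : I -> 'rV[R]_d -> 'rV[R]_d) (c rho : R)
  (p : 'rV[R]_d).
Hypothesis BS : bilip_system X S c rho p.

Local Notation f := (comp_word S).
Local Notation F := (limit_set X S).

Variables (N n : nat) (J : 'I_N -> seq I) (lam gam s : R).
Hypothesis n0 : (0 < n)%N.
Hypothesis N2 : (1 < N)%N.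
Hypothesis Jn : forall j, size (J j) = n.
Hypothesis lam01 : 0 < lam < 1.
Hypothesis gam0 : 0 < gam.
Hypothesis s0 : 0 <= s.
Hypothesis lamN : 1 <= N%:R * lam `^ s.
Hypothesis low : forall j x y, X x -> X y ->
  lam * enorm (x - y) <= enorm (f (J j) x - f (J j) y).
Hypothesis sep : forall i j x y, i != j -> (f (J i) @` X) x -> (f (J j) @` X) y ->
  gam <= enorm (x - y).

Let blocks (a : nat -> 'I_N) (m : nat) : seq I := flatten (mkseq (J \o a) m).

Let blocksS a m : blocks a m.+1 = J (a 0%N) ++ blocks (fun k => a k.+1) m.
Proof. by rewrite /blocks -add1n mkseqD. Qed.

Lemma block_point (a : nat -> 'I_N) :
  exists x, F x /\ forall m, (f (blocks a m) @` X) x.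
Proof.
have [i0] := bs_inh BS.
pose w k := nth i0 (J (a (k %/ n)%N)) (k %% n)%N.
have wE m : mkseq w (m * n) = blocks a m.
  elim: m => [|m IH]; first by rewrite mul0n.
  rewrite mulSn addnC mkseqD IH /blocks /mkseq -[m.+1]addn1 iotaD map_cat flatten_cat /=.
  rewrite cats0 add0n; congr (_ ++ _).
  apply: (@eq_from_nth _ i0); rewrite size_map size_iota ?Jn// => k kn.
  by rewrite (nth_map 0%N) ?size_iota// nth_iota// add0n /w divnMDl// divn_small// addn0
     modnMDl modn_small.
have [x Hx] := code_point BS w; exists x; split; first by apply/(limit_setP BS); exists w.
by move=> m; rewrite -wE.
Qed.

Let pt a : 'rV[R]_d := projT1 (cid (block_point a)).
Let ptF a : F (pt a). Proof. by rewrite /pt; case: cid => x []. Qed.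
Let pt_in a m : (f (blocks a m) @` X) (pt a).
Proof. by rewrite /pt; case: cid => x []. Qed.

(** Each of the [k] common blocks scales distances by at least [lam], and the first
    blocks that differ have images at distance at least [gam]. *)
Lemma block_dist k a b x y : (forall j, (j < k)%N -> a j = b j) -> a k != b k ->
  (f (blocks a k.+1) @` X) x -> (f (blocks b k.+1) @` X) y ->
  gam * lam ^+ k <= enorm (x - y).
Proof.
have lam0 : 0 < lam by case/andP: lam01.
elim: k a b x y => [|k IH] a b x y ab abk.
  rewrite expr0 mulr1 !blocksS => Hx Hy.
  by apply: (sep abk); [apply: (image_cat BS Hx)|apply: (image_cat BS Hy)].
rewrite blocksS [blocks b _]blocksS -(ab 0%N isT).
move=> [x' Xx' <-] [y' Xy' <-].
have E g z := comp_word_catE S (J (a 0%N)) (blocks g k.+1) z.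
rewrite (E _ x') (E _ y') {E}.
apply: le_trans (low (a 0%N) (word_into BS _ Xx') (word_into BS _ Xy')).
rewrite exprS mulrCA; apply: ler_wpM2l; first exact: ltW.
apply: (IH (fun k => a k.+1) (fun k => b k.+1)) => [j jk|||].
- exact: ab.
- exact: abk.
- by exists x'.
- by exists y'.
Qed.

Let Nr0 : 0 < N%:R :> R. Proof. by rewrite ltr0n (leq_trans _ N2). Qed.

(** [v] consists of letters common to all codes of points of [U].  If [U] has positive
    diameter, [v] is as long as [block_dist] allows, and then the mass of its cylinder
    is comparable to the power of the diameter.  The error [e] is for sets of diameter
    zero, whose codes agree forever. *)
Lemma cylinder_of_set (U : set 'rV[R]_d) (e : R) : 0 < e ->
  exists v : seq 'I_N,
    ((N%:R ^- size v)%:E <= (gam `^ s)^-1%:E * (ediam U `^ s) + e%:E)%E /\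
    forall a, U (pt a) -> mkseq a (size v) = v.
Proof.
move=> e0; have /andP[lam0 lam1] := lam01.
have g0 : 0 < gam `^ s by rewrite powR_gt0.
have [gU|Ug] := leP (gam%:E) (ediam U).
  exists [::]; split => //; rewrite expr0 invr1.
  apply: (@le_trans _ _ ((gam `^ s)^-1%:E * (gam%:E `^ s))%E).
    by rewrite poweR_EFin -EFinM mulVf ?gt_eqF.
  apply: (@le_trans _ _ ((gam `^ s)^-1%:E * (ediam U `^ s))%E).
    apply: lee_wpmul2l; first by rewrite lee_fin invr_ge0 ltW.
    apply: gt0_ler_poweR => //; rewrite in_itv/= ?leey ?andbT ?ediam_ge0//.
    by rewrite lee_fin ltW.
  by rewrite leeDl// lee_fin ltW.
have Uf := ediam_fin (ltW Ug).
set u := fine (ediam U) in Uf; have u0 : 0 <= u := fine_ediam_ge0 U.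
have ug : u < gam by rewrite -lte_fin -Uf.
pose bad m := gam * lam ^+ m <= u.
have agree m : (forall k, (k < m)%N -> ~~ bad k) ->
    forall a b, U (pt a) -> U (pt b) -> mkseq a m = mkseq b m.
  move=> gd a b Ua Ub; apply: (@eq_from_nth _ (a 0%N)); rewrite !size_mkseq// => k.
  have {}gd j : (j < m)%N -> a j = b j.
    elim/ltn_ind: j => j IHj jm; apply/eqP; apply: contraT => abj.
    have := block_dist (fun i ij => IHj i ij (ltn_trans ij jm)) abj (pt_in a j.+1) (pt_in b j.+1).
    have := gd j jm; rewrite /bad -ltNge => lt1 le1.
    have := ediam_ge Ua Ub; rewrite Uf lee_fin => /(le_trans le1) /(lt_le_trans lt1).
    by rewrite ltxx.
  by move=> km; rewrite !nth_mkseq//; exact: gd.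
suff [m [gd cost]] : exists m, (forall k, (k < m)%N -> ~~ bad k) /\
    (N%:R ^- m <= (gam `^ s)^-1 * u `^ s + e).
  have [[a Ua]|nU] := pselect (exists a, U (pt a)).
    exists (mkseq a m); rewrite size_mkseq Uf poweR_EFin -EFinM -EFinD lee_fin; split => // b Ub.
    exact: agree.
  pose j0 := Ordinal (leq_trans (isT : (0 < 2)%N) N2).
  exists (nseq m j0); rewrite size_nseq Uf poweR_EFin -EFinM -EFinD lee_fin; split => // b Ub.
  by case: nU; exists b.
have [[m bm]|nb] := pselect (exists m, bad m).
  pose m1 := ex_minn (ex_intro (fun m => bad m) m bm).
  have [bm1 min1] : bad m1 /\ forall k, (k < m1)%N -> ~~ bad k.
    rewrite /m1; case: ex_minnP => q bq qmin; split => // k kq.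
    by apply/negP => /qmin; rewrite leqNgt kq.
  exists m1; split => //; apply: (@le_trans _ _ ((gam `^ s)^-1 * u `^ s)); last first.
    by rewrite lerDl ltW.
  have : (gam * lam ^+ m1) `^ s <= u `^ s.
    apply: ge0_ler_powR => //; rewrite nnegrE//.
    by rewrite mulr_ge0 ?exprn_ge0// ltW.
  have lamge0 := ltW lam0.
  rewrite powRM ?exprn_ge0 ?(ltW gam0)// => H.
  rewrite mulrC ler_pdivlMr// mulrC; apply: le_trans H.
  rewrite ler_pM2l// -powR_mulrn// -powRrM mulrC powRrM powR_mulrn ?powR_ge0//.
  rewrite -exprVn; apply: lerXn2r; rewrite ?nnegrE ?invr_ge0 ?powR_ge0 ?(ltW Nr0)//.
  by rewrite -[_^-1]mul1r ler_pdivrMr// mulrC.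
have [m Hm] : exists m, N%:R ^- m <= e.
  have : (fun n => (N%:R^-1 : R) ^+ n) @ \oo --> (0 : R).
    by apply: cvg_expr; rewrite ger0_norm ?invr_ge0 ?ltW// invf_lt1 ?ltr1n.
  move=> /cvgrPdist_le/(_ e e0)[m _ Hm]; exists m.
  have := Hm m (leqnn m); rewrite sub0r normrN ger0_norm ?exprVn//.
exists m; split; first by move=> k _; apply/negP => bk; apply: nb; exists k.
apply: le_trans Hm _; rewrite lerDr mulr_ge0 ?powR_ge0// invr_ge0 ltW//.
Qed.

(** The mass distribution principle without a measure.  Each set of a cover lies
    over one cylinder of the code space; if the natural masses of these cylinders
    add up to less than one, then one can keep choosing a next letter for which
    the mass relative to the current cylinder stays below one, and the limiting
    code gives a point that no set of the cover contains. *)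
Lemma cantor_positive (C : set (set 'rV[R]_d)) : countable_cover C F ->
  ((gam `^ s / 2)%:E <= \esum_(U in C) (ediam U `^ s))%E.
Proof.
move=> [cC FC]; rewrite leNgt; apply/negP => lt1.
have g0 : 0 < gam `^ s by rewrite powR_gt0.
have /countable_injP[q qinj] := cC.
(* these errors add up to at most [1 / 2] *)
have e_gt0 U : 0 < 1 / 4 * (1 / 2) ^+ (q U) :> R.
  by rewrite mulr_gt0 ?exprn_gt0 ?divr_gt0.
pose v U := projT1 (cid (cylinder_of_set U (e_gt0 U))).
have vcost U : ((N%:R ^- size (v U))%:E <=
    (gam `^ s)^-1%:E * (ediam U `^ s) + (1 / 4 * (1 / 2) ^+ (q U))%:E)%E.
  by rewrite /v; case: cid => ? [].
have vcode U a : U (pt a) -> mkseq a (size (v U)) = v U.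
  by rewrite /v; case: cid => ? [_] /=; exact.
pose mass U := (N%:R ^- size (v U))%:E : \bar R.
have mass0 U : (0 <= mass U)%E by rewrite lee_fin invr_ge0 exprn_ge0// ltW.
pose D (w : seq 'I_N) := [set U | C U /\ prefix w (v U)].
(* the total mass of the chosen cylinders below [w], relative to the mass of [w] *)
pose cost w := ((N%:R ^+ size w)%:E * \esum_(U in D w) mass U)%E.
have cost0 : (cost [::] < 1)%E.
  rewrite /cost expr0 mul1e.
  apply: (@le_lt_trans _ _ (\esum_(U in C) ((gam `^ s)^-1%:E * (ediam U `^ s) +
     (1 / 4 * (1 / 2) ^+ (q U))%:E))%E).
    apply: (@le_trans _ _ (\esum_(U in C) mass U)%E).
      by apply: le_esum_set => U [].
    by apply: le_esum => U _; exact: vcost.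
  rewrite esumD; last first.
  - by move=> U _; rewrite lee_fin ltW.
  - by move=> U _; rewrite mule_ge0 ?poweR_ge0// lee_fin invr_ge0 ltW.
  rewrite esumZl ?invr_ge0 ?ltW//; last by move=> U; exact: poweR_ge0.
  have le2 : (\esum_(U in C) (1 / 4 * (1 / 2) ^+ (q U))%:E <= (1 / 2 : R)%:E)%E.
    have -> : (\esum_(U in C) (1 / 4 * (1 / 2 : R) ^+ (q U))%:E =
       \esum_(k in q @` C) (1 / 4 * (1 / 2 : R) ^+ k)%:E)%E.
      by rewrite (esum_image C q).
    apply: (@le_trans _ _ (\esum_(k in [set: nat]) (1 / 4 * (1 / 2 : R) ^+ k)%:E)%E).
      exact: le_esum_set.
    apply: le_trans (@esum_geometric _ (1 / 2) _ (1 / 4) _ _ _) _; [lra|lra| |].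
      by move=> k; rewrite lexx andbT lee_fin mulr_ge0// exprn_ge0.
    by rewrite lee_fin; have -> : (1 / 4 / (1 - 1 / 2) = 1 / 2 :> R) by field.
  have lt2 : ((gam `^ s)^-1%:E * (\esum_(U in C) (ediam U `^ s)) < (1 / 2 : R)%:E)%E.
    by rewrite lte_pdivrMl// -EFinM mulrA mulr1.
  apply: lt_le_trans (lte_leD _ lt2 le2) _; last by rewrite -EFinD lee_fin; lra.
  rewrite ge0_fin_numE; first exact: le_lt_trans le2 (ltry _).
  by apply: esum_ge0 => U _; rewrite lee_fin ltW.
(* the relative mass at [w] is the average of those at the [N] next words *)
have cost_next w : (cost w < 1)%E -> exists j, (cost (rcons w j) < 1)%E.
  move=> cw; apply: contrapT => /forallNP H.
  have {}H j : ((N%:R ^- (size w).+1)%:E <= \esum_(U in D (rcons w j)) mass U)%E.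
    have := H j; rewrite /cost size_rcons => /negP; rewrite -leNgt => {}H.
    by rewrite -[(_ ^- _)%:E]mule1 lee_pdivrMl ?exprn_gt0.
  have dD i j U : [set: 'I_N] i -> [set: 'I_N] j -> D (rcons w i) U ->
      D (rcons w j) U -> i = j.
    move=> _ _ [_ /prefixP[t1 e1]] [_ /prefixP[t2]].
    by rewrite e1 !cat_rcons => /eqP; rewrite eqseq_cat// eqxx/= eqseq_cons => /andP[/eqP].
  have : (\esum_(U in \bigcup_(j in [set: 'I_N]) D (rcons w j)) mass U <=
      \esum_(U in D w) mass U)%E.
    apply: le_esum_set => U [j _ [CU /prefixP[t vE]]]; split => //.
    by apply/prefixP; exists (j :: t); rewrite vE cat_rcons.
  rewrite (esum_bigcup_disjoint _ dD)// => le1.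
  have : ((N%:R ^- (size w))%:E <= \esum_(U in D w) mass U)%E.
    apply: le_trans le1.
    apply: (@le_trans _ _ (\esum_(j in [set: 'I_N]) (N%:R ^- (size w).+1)%:E)%E); last first.
      exact: le_esum.
    apply: le_trans (esum_ge_seq (s := enum 'I_N) _ (enum_uniq _) _) => //.
      by rewrite sumEFin lee_fin big_const_seq count_predT size_enum_ord iter_addr_0
        -[X in (_ <= X)%R]mulr_natl exprS invfM mulrA divff ?mul1r// gt_eqF.
  rewrite -[(_ ^- _)%:E]mule1 lee_pdivrMl ?exprn_gt0// -/(cost w) leNgt.
  by rewrite cw.
have [j0 _] := cost_next _ cost0.
pose nxt w := if pselect (exists j, (cost (rcons w j) < 1)%E) is left h
  then projT1 (cid h) else j0.
pose wd := fix wd k := if k is k'.+1 then rcons (wd k') (nxt (wd k')) else [::].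
have wd_cost k : (cost (wd k) < 1)%E.
  elim: k => //= k /cost_next h; rewrite /nxt.
  by case: pselect => // h'; case: cid.
pose a k := nxt (wd k).
have wdE k : mkseq a k = wd k.
  have wdS l : wd l.+1 = rcons (wd l) (a l) by [].
  elim: k => [//|k IH]; rewrite wdS -IH -cats1 -[in LHS]addn1 mkseqD.
  by congr (_ ++ _); rewrite /mkseq/= addn0.
have [U CU Ua] := FC _ (ptF a).
have := wd_cost (size (v U)); rewrite -wdE (vcode _ _ Ua) ltNge /cost.
suff -> : (1 <= (N%:R ^+ size (v U))%:E * (\esum_(U0 in D (v U)) mass U0))%E by [].
rewrite -lee_pdivrMl ?exprn_gt0// mule1.
by apply: (@esum_ge1 _ _ _ mass U) => //; split => //; exact: prefix_refl.
Qed.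

End cantor.

Lemma pigeonhole_seq (T : Type) (K : finType) (g : T -> K) (s : seq T) (k0 : K) :
  exists k, (size s <= #|K| * count (fun x => g x == k) s)%N.
Proof.
have sumE : (\sum_(k : K) count (fun x => g x == k) s = size s)%N.
  elim: s => [|x s IH] /=; first by rewrite big1.
  rewrite big_split /= IH -[RHS]add1n; congr (_ + _)%N.
  by rewrite (bigD1 (g x))//= eqxx big1 ?addn0// => k; rewrite eq_sym => /negbTE ->.
have [k _ kmax] := @arg_maxnP K k0 xpredT (fun k => count (fun x => g x == k) s) isT.
exists k; rewrite -sumE -[leqRHS]sum_nat_const; apply: leq_sum => j _.
exact: kmax.
Qed.

Section grid.
Context {R : realType} {d : nat}.

(** Each point has a cell of a fine grid to itself.  Colour the cells by the residues
    of their indices: two points of the same colour are far apart because some index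
    differs by at least the modulus, and one colour is used by a fixed proportion of
    the points. *)
Lemma separated_subfamily (M : nat) (T : eqType) (y : T -> 'rV[R]_d) (h : R)
    (s : seq T) : (0 < d)%N -> 0 < h -> uniq s ->
  (forall u v, u \in s -> v \in s -> u != v -> h <= enorm (y u - y v)) ->
  exists s', [/\ subseq s' s, (size s <= (2 * d * M).+1 ^ d * size s')%N &
    forall u v, u \in s' -> v \in s' -> u != v -> M%:R * h <= enorm (y u - y v)].
Proof.
move=> d0 h0 us sep.
pose L := (2 * d * M).+1.
pose h1 := h / (2 * d)%:R.
have dd : 0 < (2 * d)%:R :> R by rewrite ltr0n muln_gt0.
have h1_gt0 : 0 < h1 by rewrite divr_gt0.
pose cell u i := Num.floor (y u 0 i / h1).
pose col u : {ffun 'I_d -> 'I_L} := [ffun i => inord `|(cell u i %% L)%Z|%N].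
have [k Hk] := pigeonhole_seq col s [ffun=> ord0].
exists [seq u <- s | col u == k]; split.
- exact: filter_subseq.
- by move: Hk; rewrite size_filter card_ffun !card_ord.
move=> u v; rewrite !mem_filter => /andP[/eqP uk us'] /andP[/eqP vk vs'] uv.
have colE i : (cell u i = cell v i %[mod L])%Z.
  have : col u i = col v i by rewrite uk vk.
  rewrite !ffunE => /(congr1 val) /=.
  have lt w : (`|(cell w i %% L)%Z|%N < L)%N.
    by rewrite -ltz_nat gez0_abs ?modz_ge0// ltz_pmod.
  rewrite !inordK// => E.
  by rewrite -[LHS]gez0_abs ?modz_ge0// -[RHS]gez0_abs ?modz_ge0// E.
have cellP w i : (cell w i)%:~R * h1 <= y w 0 i < ((cell w i)%:~R + 1) * h1.
  rewrite -ler_pdivlMr// -ltr_pdivrMr//.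
  have /andP[-> lt1] := @Num.Theory.floor_itv R (y w 0 i / h1).
  by rewrite intrD in lt1.
have [i ci] : exists i, cell u i != cell v i.
  apply: contrapT => /forallNP all_eq.
  have := sep u v us' vs' uv; apply/negP; rewrite -ltNge.
  apply: (@le_lt_trans _ _ (d%:R * h1)); last first.
    have -> : d%:R * h1 = h / 2 by rewrite /h1 natrM; field; rewrite pnatr_eq0 -lt0n.
    by rewrite ltr_pdivrMr// ltr_pMr// ltr1n.
  apply: enorm_le_coord => i; have := all_eq i => /negP; rewrite negbK => /eqP cE.
  have := cellP u i; have := cellP v i; rewrite !mxE cE => /andP[a1 a2] /andP[b1 b2].
  by rewrite ler_norml; apply/andP; split; lra.
apply: le_trans (coord_le_enorm (y u - y v) i).
have big : (L%:Z <= `|cell u i - cell v i|)%R.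
  have dv : (L%:Z %| cell u i - cell v i)%Z.
    by rewrite -eqz_mod_dvd; apply/eqP; exact: colE.
  have nz : cell u i - cell v i != 0 by rewrite subr_eq0.
  have := dv; rewrite dvdzE => /dvdn_leq; rewrite absz_gt0 => /(_ nz) H.
  by rewrite -abszE lez_nat.
have {big} : (L%:R : R) <= `|(cell u i)%:~R - (cell v i)%:~R|.
  by rewrite -intrB -intr_norm -[L%:R]/((L%:Z)%:~R) ler_int.
have := cellP u i; have := cellP v i; rewrite !mxE.
set a := (cell u i)%:~R; set b := (cell v i)%:~R.
move=> /andP[b1 b2] /andP[a1 a2] Lab.
have key : (L%:R - 1) * h1 = M%:R * h.
  rewrite /L -natr1 addrK /h1 !natrM; field.
  by rewrite pnatr_eq0 -lt0n.
rewrite -key.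
have [ab|ab] := leP b a.
  rewrite ger0_norm ?subr_ge0// in Lab.
  apply: le_trans (ler_norm _).
  have : (L%:R - 1) * h1 <= (a - b - 1) * h1 by apply: ler_wpM2r; [exact: ltW|lra].
  by rewrite !mulrBl mul1r in a1 a2 b1 b2 *; lra.
rewrite ltr0_norm ?subr_lt0// opprB in Lab.
rewrite distrC; apply: le_trans (ler_norm _).
have : (L%:R - 1) * h1 <= (b - a - 1) * h1 by apply: ler_wpM2r; [exact: ltW|lra].
by rewrite !mulrBl mul1r in a1 a2 b1 b2 *; lra.
Qed.

End grid.

Section lower_bound.
Context {R : realType} {d : nat} {I : countType}.
Variables (X : set 'rV[R]_d) (S : I -> 'rV[R]_d -> 'rV[R]_d) (c rho : R)
  (p : 'rV[R]_d).
Hypothesis BS : bilip_system X S c rho p.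
Hypothesis d0 : (0 < d)%N.

Local Notation f := (comp_word S).
Local Notation r w := (lip_ratio X (comp_word S w)).
Local Notation F := (limit_set X S).

Definition layer (n k : nat) : set (seq I) :=
  [set w | size w = n /\ 2^-1 ^+ k.+1 < r w <= 2^-1 ^+ k].

Lemma words_layer n : words n `<=` \bigcup_(k in [set: nat]) layer n k.
Proof.
move=> w wn.
have [m Hm] : exists m, 2^-1 ^+ m.+1 < r w.
  have : (fun n => (2^-1 : R) ^+ n) @ \oo --> (0 : R).
    by apply: cvg_expr; rewrite ger0_norm// invf_lt1// ltr1n.
  move=> /cvgrPdist_lt/(_ _ (bs_gt0 BS w))[m _ Hm]; exists m.
  have := Hm m.+1 (leqnSn m); rewrite /= sub0r normrN ger0_norm//.
pose k := ex_minn (ex_intro (fun m => 2^-1 ^+ m.+1 < r w) m Hm).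
have [k1 k2] : 2^-1 ^+ k.+1 < r w /\ r w <= 2^-1 ^+ k.
  rewrite /k; case: ex_minnP => -[|q] Hq qmin; split => //.
    exact: ratio_le1 BS w.
  by rewrite leNgt; apply/negP => /qmin; rewrite ltnn.
by exists k => //; split => //; rewrite k1.
Qed.

(** If every layer were poorer than [B] times the [s]-dimensional count, the level
    sums at any exponent above [s] would decay geometrically. *)
Lemma rich_layer (s B : R) : 0 <= s -> (s%:E < pressure_h X S)%E -> 0 < B ->
  exists n k (ws : seq (seq I)), [/\ (0 < n)%N, uniq ws,
    forall w, w \in ws -> layer n k w & B <= (size ws)%:R * (2^-1 ^+ k) `^ s].
Proof.
move=> s0 sh B0; apply: contrapT => poor.
have [t st lev1] := level_ge1_below_h BS s0 sh.
pose kap := (t - s) / 2.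
have kap0 : 0 < kap by rewrite divr_gt0// subr_gt0.
have q_gt0 k : 0 < 2^-1 ^+ k :> R by rewrite exprn_gt0// invr_gt0.
have /andP[rho0 rho1] := bs_rho BS.
pose z : R := 2^-1 `^ kap.
have z01 : 0 <= z < 1.
  rewrite powR_ge0/= /z -[ltRHS](powRr0 2^-1) /powR gt_eqF//.
  by rewrite ltr_expR mul0r pmulr_rlt0// ln_lt0// invr_gt0 ltr0n/= invf_lt1// ltr1n.
have layer_sum n k : (0 < n)%N ->
    (\esum_(w in layer n k) ((r w) `^ (s + kap))%:E <= (B * z ^+ k)%:E)%E.
  move=> n0.
  apply: (@le_trans _ _ (\esum_(w in layer n k) ((2^-1 ^+ k) `^ (s + kap))%:E)%E).
    apply: le_esum => w [_ /andP[_ rk]]; rewrite lee_fin.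
    apply: ge0_ler_powR => //; rewrite ?nnegrE ?(ltW (q_gt0 k)) ?(ltW (bs_gt0 BS w))//.
    by rewrite addr_ge0// ltW.
  apply: (@le_trans _ _ (B / (2^-1 ^+ k) `^ s * (2^-1 ^+ k) `^ (s + kap))%:E).
    apply: esum_const_seq; first exact: powR_ge0.
    move=> ws uws wsl; rewrite leNgt; apply/negP => lt1; apply: poor.
    exists n, k, ws; split => //.
    rewrite -ler_pdivrMr; last by rewrite powR_gt0 ?q_gt0.
    exact: ltW lt1.
  rewrite lee_fin powRD; last by apply/implyP => _; rewrite gt_eqF.
  rewrite mulrA divfK ?gt_eqF ?powR_gt0//.
  rewrite ler_pM2l// /z.
  by rewrite powR_exprn.
have level_le n : (0 < n)%N -> (level X S n t <= ((rho `^ kap) ^+ n * (B / (1 - z)))%:E)%E.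
  move=> n0.
  apply: (@le_trans _ _ (\esum_(w in words n) (((rho `^ kap) ^+ n)%:E *
      ((r w) `^ (s + kap))%:E))%E).
    apply: le_esum => w wn; rewrite -EFinM lee_fin.
    (* one half of the gap makes the sum over the layers converge, the other half
       makes it decay with the length *)
    have -> : t = kap + (s + kap) by rewrite /kap; lra.
    have rw0 := bs_gt0 BS w.
    rewrite (@powRD _ _ kap (s + kap)); last by apply/implyP => _; rewrite gt_eqF.
    apply: ler_wpM2r; first exact: powR_ge0.
    have -> : (rho `^ kap) ^+ n = (rho ^+ n) `^ kap.
      by rewrite powR_exprn// ltW.
    apply: ge0_ler_powR; rewrite ?nnegrE ?exprn_ge0 ?(ltW rho0) ?(ltW rw0) ?(ltW kap0)//.
    by have := bs_decay BS w; rewrite wn.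
  rewrite esumZl ?exprn_ge0 ?powR_ge0//; last by move=> w; rewrite lee_fin powR_ge0.
  rewrite EFinM; apply: lee_wpmul2l; first by rewrite lee_fin exprn_ge0 ?powR_ge0.
  apply: le_trans (le_esum_set _ (@words_layer n)) _.
  apply: le_trans (esum_bigcup_le _ _ _) _.
    by move=> w; rewrite lee_fin powR_ge0.
  apply: esum_geometric => //; first exact: ltW.
  by move=> k; rewrite layer_sum// andbT esum_ge0// => w _; rewrite lee_fin powR_ge0.
pose y := rho `^ kap.
have y01 : `|y| < 1.
  rewrite ger0_norm ?powR_ge0// /y -[ltRHS](powRr0 rho) /powR gt_eqF//.
  by rewrite ltr_expR mul0r pmulr_rlt0// ln_lt0// rho0.
pose B' := B / (1 - z).
have B'0 : 0 < B' by rewrite divr_gt0// subr_gt0; case/andP: z01.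
have /cvgrPdist_lt/(_ (1 / B')) := cvg_expr y01.
rewrite divr_gt0// => /(_ isT)[m _ Hm].
have := Hm m.+1 (leqnSn m); rewrite /= sub0r normrN ger0_norm ?exprn_ge0 ?powR_ge0//.
rewrite ltr_pdivlMr// => lt1.
have := le_trans (lev1 m.+1 isT) (level_le m.+1 isT).
by rewrite lee_fin leNgt lt1.
Qed.

(** The words of a rich layer have ratios within a factor of two of each other; thinned
    out until their images are well separated, they satisfy the hypotheses of
    [cantor_positive]. *)
Lemma pressure_h_le_dimH : (pressure_h X S <= dimH F)%E.
Proof.
apply: le_ereal_inf_tmp => _ [s [s0 Hs0] <-]; rewrite leNgt; apply/negP => sh.
have [D D0 XD] := compact_bounded_dist (bs_compact BS).
have /andP[c0 c1] := bs_c BS.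
(* makes [M * lam >= 3 * (D * q)], so that images of diameter at most [D * q] whose
   base points are [M * lam] apart stay [D * q] apart *)
pose M := (Num.truncn (6 * D / c)).+1.
have MD : 6 * D / c < M%:R by exact: truncnS_gt.
pose K := ((2 * d * M).+1 ^ d)%N.
have K0 : 0 < K%:R :> R by rewrite ltr0n expn_gt0.
(* leaves [N * lam `^ s >= 2] after thinning out by the factor [K] *)
pose B : R := K%:R * (2 / (c / 2) `^ s).
have c20 : 0 < c / 2 by rewrite divr_gt0.
have B0 : 0 < B by rewrite mulr_gt0// divr_gt0// powR_gt0.
have [n [k [ws [n0 uws wsl szws]]]] := rich_layer s0 sh B0.
pose q : R := 2^-1 ^+ k.
have q0 : 0 < q by rewrite exprn_gt0// invr_gt0.
have q1 : q <= 1 by rewrite exprn_ile1// invf_le1// ler1n.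
pose lam := c / 2 * q.
have lam0 : 0 < lam by rewrite mulr_gt0.
have lamr w : w \in ws -> lam <= c * r w.
  move=> /wsl[_ /andP[rk _]]; rewrite /lam -mulrA; apply: ler_wpM2l; first exact: ltW.
  by move: rk; rewrite exprS => /ltW.
have [s' [sub szs' sep]] := @separated_subfamily R d M _ (fun w => f w p) lam ws d0 lam0 uws
  (fun u v uw vw uv => le_trans (lamr u uw)
     (bs_sep BS (etrans (wsl u uw).1 (esym (wsl v vw).1)) uv)).
have us' : uniq s' := subseq_uniq sub uws.
have s'ws w : w \in s' -> w \in ws by exact: mem_subseq.
pose N := size s'.
have qs0 : 0 < q `^ s by rewrite powR_gt0.
have cs0 : 0 < (c / 2) `^ s by rewrite powR_gt0.
have NlamB : 2 <= N%:R * lam `^ s.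
  have : B <= K%:R * N%:R * q `^ s.
    apply: le_trans szws _; apply: ler_wpM2r; first exact: ltW.
    by rewrite -natrM ler_nat.
  rewrite /B -[leRHS]mulrA ler_pM2l// ler_pdivrMr// => H.
  rewrite /lam powRM; [|exact: ltW|exact: ltW].
  by apply: le_trans H _; rewrite -mulrA [q `^ s * _]mulrC.
have lam1 : lam < 1.
  have : c / 2 * q <= c / 2 by rewrite ler_piMr// ltW.
  by rewrite -/lam; lra.
have lams1 : lam `^ s <= 1.
  rewrite -(powRr0 lam); apply: ger_powR => //; rewrite lam0/=; exact: ltW.
have N2 : (1 < N)%N.
  rewrite -(ltr_nat R); apply: lt_le_trans (_ : 2 <= _); first by rewrite ltr1n.
  by apply: le_trans NlamB _; rewrite ler_piMr.
pose J (j : 'I_N) := nth [::] s' j.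
have Js' j : J j \in s' by rewrite /J mem_nth.
pose gam := D * q.
have gam0 : 0 < gam by rewrite mulr_gt0.
have cover_ge C : countable_cover C F ->
    ((gam `^ s / 2)%:E <= \esum_(U in C) (ediam U `^ s))%E.
  apply: (@cantor_positive _ _ _ _ _ _ _ _ BS N n J lam gam s n0 N2) => //.
  - by move=> j; case: (wsl _ (s'ws _ (Js' j))).
  - by rewrite lam0.
  - by apply: le_trans NlamB; rewrite ler1n.
  - move=> j x y Xx Xy; apply: le_trans (bs_lower BS _ Xx Xy).
    by rewrite ler_wpM2r ?enorm_ge0//; apply: lamr; exact: s'ws.
  - move=> i j x y ij Hx Hy.
    have ne : J i != J j by rewrite /J nth_uniq.
    have := sep _ _ (Js' i) (Js' j) ne.
    have near w a : w \in s' -> (f w @` X) a -> enorm (a - f w p) <= D * q.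
      move=> ws'; have [_ /andP[_ rq]] := wsl _ (s'ws _ ws') => Ha.
      apply: le_trans (image_dist BS XD Ha _) _.
        by exists p => //; exact: (bs_base BS).
      by apply: ler_wpM2l; [exact: ltW|].
    have far : 3 * (D * q) <= M%:R * lam.
      have : 6 * D / c * lam <= M%:R * lam by apply: ler_wpM2r; exact: ltW.
      apply: le_trans; rewrite /lam le_eqVlt; apply/orP; left; apply/eqP.
      by field; rewrite gt_eqF.
    have := near _ _ (Js' i) Hx; have := near _ _ (Js' j) Hy.
    have := edistD (f (J i) p) x (f (J j) p); have := edistD x y (f (J j) p).
    rewrite [enorm (f (J i) p - x)]edistC /gam; lra.
have : (0 < hausdorff_measure s F)%E.
  apply: (@lt_le_trans _ _ (hausdorff_pre s 1 F)); last first.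
    by apply: ereal_sup_ubound; exists 1 => //=.
  apply: (@lt_le_trans _ _ (gam `^ s / 2)%:E).
    by rewrite lte_fin divr_gt0// powR_gt0.
  by apply: le_ereal_inf_tmp => _ [C [CF _] <-]; exact: cover_ge.
by rewrite Hs0 ltxx.
Qed.

End lower_bound.

(** * Cost of covers with restricted diameters *)

Section cover_cost.
Context {R : realType} {d : nat}.
Implicit Types (s a b : R) (E A B : set 'rV[R]_d) (C : set (set 'rV[R]_d)).

Definition fine_cover a b E : set (set (set 'rV[R]_d)) :=
  [set C | countable_cover C E /\
    forall U, C U -> (a%:E <= ediam U)%E /\ (ediam U <= b%:E)%E].

(** Taking the infimum over covers once and for all turns the construction of covers
    into estimates based on countable subadditivity. *)
Definition cover_cost s a b E : \bar R :=
  ereal_inf [set (\esum_(U in C) (ediam U `^ s))%E | C in fine_cover a b E].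

Local Open Scope ereal_scope.

Lemma cover_cost_le s a b E C : fine_cover a b E C ->
  cover_cost s a b E <= \esum_(U in C) (ediam U `^ s).
Proof. by move=> HC; apply: ereal_inf_lbound; exists C. Qed.

Lemma cover_cost_ge0 s a b E : 0 <= cover_cost s a b E.
Proof.
by apply: le_ereal_inf_tmp => _ [C _ <-]; apply: esum_ge0 => U _; exact: poweR_ge0.
Qed.

Lemma le_cover_cost s a b E E' : E `<=` E' -> cover_cost s a b E <= cover_cost s a b E'.
Proof.
move=> EE'; apply: le_ereal_inf => _ [C [[cC EC] HC] <-]; exists C => //.
by split => //; split => //; exact: subset_trans EC.
Qed.

Lemma cover_cost_lt s a b E (e : \bar R) : cover_cost s a b E < e ->
  exists2 C, fine_cover a b E C & \esum_(U in C) (ediam U `^ s) < e.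
Proof. by move=> /ereal_inf_lt[_ [C HC <-] lt]; exists C. Qed.

Lemma cover_cost0 s a b : cover_cost s a b set0 = 0.
Proof.
apply/eqP; rewrite eq_le cover_cost_ge0 andbT.
apply: le_trans (@cover_cost_le s a b _ set0 _) _; last by rewrite esum_set0.
by split => //; split.
Qed.

Lemma cover_cost_bigcup s a b E (T : choiceType) (K : set T) (A : T -> set 'rV[R]_d) :
  countable K -> E `<=` \bigcup_(k in K) A k ->
  cover_cost s a b E <= \esum_(k in K) cover_cost s a b (A k).
Proof.
move=> cK EA.
have [|] := leP +oo (\esum_(k in K) cover_cost s a b (A k)).
  by rewrite leye_eq => /eqP ->; rewrite leey.
move=> fin; apply/lee_addgt0Pr => e e0.
have /countable_injP[q qinj] := cK.
pose w k : R := (e / 2 * (1 / 2) ^+ q k)%R.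
have w0 k : (0 < w k)%R by rewrite /w mulr_gt0 ?exprn_gt0 ?divr_gt0.
have ch k : exists C, K k -> fine_cover a b (A k) C /\
    \esum_(U in C) (ediam U `^ s) <= cover_cost s a b (A k) + (w k)%:E.
  have [Kk|nK] := pselect (K k); last by exists set0.
  have lt : cover_cost s a b (A k) < cover_cost s a b (A k) + (w k)%:E.
    rewrite lteDl ?lte_fin// ge0_fin_numE ?cover_cost_ge0//.
    apply: le_lt_trans fin.
    by apply: (@esum_ge1 _ _ _ (fun k => cover_cost s a b (A k))) => //; exact: cover_cost_ge0.
  by have [C HC le1] := cover_cost_lt lt; exists C => _; split => //; exact: ltW.
pose C k := projT1 (cid (ch k)).
have CP k : K k -> fine_cover a b (A k) (C k) /\
    \esum_(U in C k) (ediam U `^ s) <= cover_cost s a b (A k) + (w k)%:E.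
  by rewrite /C; case: cid.
apply: (@le_trans _ _ (\esum_(U in \bigcup_(k in K) C k) (ediam U `^ s))).
  apply: cover_cost_le; split; first split.
  - by apply: bigcup_countable => // k Kk; case: (CP k Kk) => -[[]].
  - move=> x /EA[k Kk Ax]; have [[[_ AC] _] _] := CP k Kk.
    by have [U CU Ux] := AC _ Ax; exists U => //; exists k.
  - by move=> U [k Kk CU]; have [[_ H] _] := CP k Kk; exact: H.
apply: le_trans (esum_bigcup_le _ _ _) _; first by move=> U; exact: poweR_ge0.
apply: (@le_trans _ _ (\esum_(k in K) (cover_cost s a b (A k) + (w k)%:E))).
  by apply: le_esum => k Kk; case: (CP k Kk).
rewrite esumD; [|by move=> k _; exact: cover_cost_ge0|by move=> k _; rewrite lee_fin ltW].
apply: leeD => //.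
have -> : \esum_(k in K) (w k)%:E = \esum_(n in q @` K) (e / 2 * (1 / 2) ^+ n)%:E.
  by rewrite (esum_image K q).
apply: le_trans (le_esum_set _ (@subsetT _ _)) _.
apply: le_trans (@esum_geometric _ (1 / 2)%R _ (e / 2)%R _ _ _) _.
- by lra.
- by rewrite divr_ge0// ltW.
- by move=> k; rewrite lexx andbT lee_fin mulr_ge0 ?exprn_ge0// ?divr_ge0// ltW.
- by rewrite lee_fin; have -> : (e / 2 / (1 - 1 / 2) = e)%R by field.
Qed.

Lemma cover_costU s a b A B : cover_cost s a b (A `|` B) <= cover_cost s a b A + cover_cost s a b B.
Proof.
apply: le_trans (@cover_cost_bigcup s a b _ bool setT (fun k => if k then A else B) _ _) _.
- exact: countableP.
- by move=> x [Ax|Bx]; [exists true|exists false].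
rewrite (_ : [set: bool] = [set true] `|` [set false]); last first.
  by apply/seteqP; split => // -[] _; [left|right].
apply: le_trans (esumU_le _ _ _) _; first by move=> k; exact: cover_cost_ge0.
by rewrite !esum_set1 ?cover_cost_ge0.
Qed.

(** A ball that is small enough is itself an admissible set.  A larger one is cut up by
    balls of diameter [b] centred on a grid; their number depends only on [C1]. *)
Lemma cover_cost_ball (C1 : R) : (0 < d)%N -> exists2 N : R, (1 <= N)%R &
  forall s a b x u, (0 <= s)%R -> (0 < a <= b)%R -> (a <= 2 * u <= C1 * b)%R ->
    cover_cost s a b (ecball x u) <= (N * (2 * u) `^ s)%:E.
Proof.
move=> d0; pose m := (Num.truncn (2 * d%:R * C1)%R).+1.
pose K := {ffun 'I_d -> 'I_m}.
have K0 : (0 < #|K|)%N by rewrite card_ffun !card_ord expn_gt0.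
exists #|K|%:R; first by rewrite ler1n.
move=> s a b x u s0 /andP[a0 ab] /andP[au uC].
have u0 : (0 <= u)%R by rewrite -(pmulr_rge0 _ (ltr0n R 2)) (le_trans (ltW a0)).
have [ub|bu] := leP (2 * u)%R b.
  apply: le_trans (@cover_cost_le s a b _ [set ecball x u] _) _.
    split; first by split; [exact: countable1|move=> y xy; exists (ecball x u)].
    by move=> _ ->; rewrite ediam_ecball// !lee_fin.
  rewrite esum_set1 ?poweR_ge0// ediam_ecball// poweR_EFin lee_fin.
  by rewrite ler_peMl ?powR_ge0// ler1n.
have b0 : (0 < b)%R by exact: lt_le_trans ab.
have dd : (0 < d%:R :> R)%R by rewrite ltr0n.
pose h := (b / (2 * d%:R))%R.
have h0 : (0 < h)%R by rewrite divr_gt0// mulr_gt0.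
pose z (k : K) : 'rV[R]_d := \row_i (x 0%R i - u + h * (k i)%:R)%R.
pose C := (fun k : K => ecball (z k) (b / 2)%R) @` [set: K].
have b20 : (0 <= b / 2)%R by rewrite divr_ge0// ltW.
have dE k : ediam (ecball (z k) (b / 2)%R) = b%:E.
  by rewrite ediam_ecball//; congr EFin; field.
apply: le_trans (@cover_cost_le s a b _ C _) _.
  split; first split.
  - by apply: (sub_countable (card_image_le _ _)); exact: countableP.
  - move=> y xy.
    have ti i : (0 <= y 0 i - x 0 i + u <= 2 * u)%R.
      have := le_trans (coord_le_enorm (y - x) i) xy; rewrite !mxE ler_norml.
      by move=> /andP[h1 h2]; apply/andP; split; lra.
    have ki i : (Num.truncn ((y 0%R i - x 0%R i + u) / h)%R < m)%N.
      rewrite ltnS; apply: le_truncn.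
      have /andP[_ t2] := ti i.
      rewrite ler_pdivrMr//; apply: le_trans t2 _; apply: le_trans uC _.
      rewrite le_eqVlt; apply/orP; left; apply/eqP; rewrite /h; field.
      by rewrite gt_eqF.
    pose k : K := [ffun i => Ordinal (ki i)].
    exists (ecball (z k) (b / 2)%R); first by exists k.
    rewrite /ecball/=; have -> : (b / 2 = d%:R * h)%R by rewrite /h; field; rewrite gt_eqF.
    apply: enorm_le_coord => i; rewrite !mxE ffunE/=.
    have /andP[t1 t2] := ti i.
    have /andP[k1 k2] : ((Num.truncn ((y 0%R i - x 0%R i + u) / h))%:R <=
        (y 0%R i - x 0%R i + u) / h < (Num.truncn ((y 0%R i - x 0%R i + u) / h)).+1%:R)%R.
      by apply: truncn_itv; rewrite divr_ge0// ltW.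
    rewrite ler_pdivlMr// in k1; rewrite ltr_pdivrMr// -natr1 mulrDl mul1r in k2.
    rewrite [(_ * h)%R]mulrC in k1; rewrite [(_ * h)%R]mulrC in k2.
    by rewrite ler_norml; apply/andP; split; lra.
  - by move=> _ [k _ <-]; rewrite dE !lee_fin.
apply: le_trans (esum_image_le _ _ _) _.
apply: (@le_trans _ _ (\esum_(k in [set: K]) (b `^ s)%:E)).
  by apply: le_esum => k _; rewrite dE poweR_EFin.
apply: le_trans (esum_const_seq (powR_ge0 _ _) (M := #|K|%:R) _) _.
  by move=> l /card_uniqP <- _; rewrite ler_nat max_card.
rewrite lee_fin ler_wpM2l//; apply: ge0_ler_powR => //; rewrite ?nnegrE//.
- exact: ltW.
- by rewrite mulr_ge0.
- exact: ltW.
Qed.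

(** A set of a cover of [B] pulls back to a part of [A] that lies in one ball of
    comparable radius.  The error [e] allows [g] to replace a point by a nearby one. *)
Lemma cover_cost_transfer (C1 : R) : (0 < d)%N -> exists2 N : R, (1 <= N)%R &
  forall s a b a' b' M e L A B (g : 'rV[R]_d -> 'rV[R]_d),
    (0 <= s)%R -> (0 < a' <= b')%R -> (0 < a)%R -> (0 < L)%R ->
    (M * a + e <= L * a)%R -> (0 <= M <= L)%R ->
    (a' <= 2 * (L * a))%R -> (2 * (L * b) <= C1 * b')%R ->
    (forall x, A x -> B (g x)) ->
    (forall x y, A x -> A y -> (enorm (x - y) <= M * enorm (g x - g y) + e)%R) ->
    cover_cost s a' b' A <= (N * (2 * L) `^ s)%:E * cover_cost s a b B.
Proof.
move=> d0; have [N N1 HN] := cover_cost_ball C1 d0; exists N => //.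
move=> s a b a' b' M e L A B g s0 a'b' a0 L0 MeL /andP[M0 ML] a'L LC gA gd.
have N0 : (0 < N)%R by exact: lt_le_trans N1.
have k0 : (0 < N * (2 * L) `^ s)%R by apply: mulr_gt0 => //; apply: powR_gt0; exact: mulr_gt0.
rewrite -lee_pdivrMl//; apply: le_ereal_inf_tmp => _ [C [[cC BC] HC] <-].
rewrite lee_pdivrMl//.
apply: le_trans (@cover_cost_bigcup s a' b' A _ C (fun U => [set x | A x /\ U (g x)]) cC _) _.
  by move=> x Ax; have [U CU Ug] := BC _ (gA _ Ax); exists U.
rewrite -esumZl; [|exact: ltW|by move=> U; exact: poweR_ge0].
apply: le_esum => U CU; have [aU Ub] := HC U CU.
have UE := ediam_fin Ub; set u := fine (ediam U) in UE.
rewrite UE !lee_fin in aU Ub.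
have u0 : (0 < u)%R by exact: lt_le_trans aU.
have [[x0 [Ax0 Ux0]]|none] := pselect (exists x, A x /\ U (g x)); last first.
  rewrite (_ : [set x | _] = set0); last first.
    by apply/seteqP; split => // x Hx; case: none; exists x.
  by rewrite cover_cost0 mule_ge0 ?poweR_ge0// lee_fin ltW.
apply: (@le_trans _ _ (cover_cost s a' b' (ecball x0 (L * u)%R))).
  apply: le_cover_cost => x [Ax Ux]; rewrite /ecball/=.
  apply: le_trans (gd _ _ Ax Ax0) _.
  have gu : (enorm (g x - g x0) <= u)%R by rewrite -lee_fin -UE; exact: ediam_ge.
  have : (M * enorm (g x - g x0) <= M * u)%R by rewrite ler_wpM2l.
  have : ((L - M) * a <= (L - M) * u)%R by rewrite ler_wpM2l// subr_ge0.
  by rewrite !mulrBl; lra.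
apply: le_trans (HN s a' b' x0 (L * u)%R s0 a'b' _) _.
  apply/andP; split.
    by apply: le_trans a'L _; rewrite ler_pM2l// ler_pM2l.
  by apply: le_trans LC; rewrite ler_pM2l// ler_pM2l.
rewrite UE poweR_EFin -EFinM lee_fin mulrA powRM ?mulrA//.
- by rewrite mulr_ge0// ltW.
- exact: ltW.
Qed.

(** Replacing a cover of cost at most [eps] by the bound [cover_cost <= eps] changes
    nothing, since [eps] is arbitrary. *)
Definition adm_exponent (Delta : R) (phi : R -> R) E s : Prop := (0 <= s)%R /\
  forall eps : R, (0 < eps)%R -> exists2 delta0, (0 < delta0 <= Num.min 1 Delta)%R &
    forall delta, (0 < delta < delta0)%R -> cover_cost s (phi delta) delta E <= eps%:E.

Lemma restricted_dim_le (Delta : R) phi E s : adm_exponent Delta phi E s ->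
  restricted_dim Delta phi E <= s%:E.
Proof.
move=> [s0 H]; apply: ereal_inf_lbound; exists s => //; split => // eps e0.
have [delta0 d0 Hd] := H (eps / 2)%R (divr_gt0 e0 (ltr0n R 2)).
exists delta0 => // delta dd.
have lt1 : cover_cost s (phi delta) delta E < eps%:E.
  apply: le_lt_trans (Hd _ dd) _; rewrite lte_fin ltr_pdivrMr// ltr_pMr// ltr1n//.
have [C [HC1 HC2] HC3] := cover_cost_lt lt1.
by exists C; split => //; exact: ltW.
Qed.

Lemma cover_cost_antimono s t a b E : (0 < a)%R -> (b <= 1)%R -> (s <= t)%R ->
  cover_cost t a b E <= cover_cost s a b E.
Proof.
move=> a0 b1 st; apply: le_ereal_inf_tmp => _ [C [EC HC] <-].
apply: le_trans (cover_cost_le t (conj EC HC)) _; apply: le_esum => U CU.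
have [aU Ub] := HC U CU; have UE := ediam_fin Ub.
rewrite UE !lee_fin in aU Ub; rewrite UE !poweR_EFin lee_fin.
apply: ger_powR => //; apply/andP; split; first exact: lt_le_trans aU.
exact: le_trans b1.
Qed.

Lemma restricted_dim_lt (Delta : R) phi E s :
  (forall delta, (0 < delta < Delta)%R -> (0 < phi delta)%R) ->
  restricted_dim Delta phi E < s%:E -> adm_exponent Delta phi E s.
Proof.
move=> phi0 /ereal_inf_lt[_ [t [t0 Ht] <-]]; rewrite lte_fin => ts.
split; first exact: le_trans (ltW ts).
move=> eps e0; have [delta0 /andP[d0 d1] H] := Ht eps e0.
exists delta0; first by rewrite d0.
move=> delta /andP[dl1 dl2]; have [C [HC1 HC2 HC3]] := H delta (introT andP (conj dl1 dl2)).
move: d1; rewrite le_min => /andP[d1 d2].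
apply: le_trans (cover_cost_antimono _ _ _ (ltW ts)) _.
- by apply: phi0; rewrite dl1/= (lt_le_trans dl2).
- exact: le_trans (ltW dl2) d1.
- exact: le_trans (cover_cost_le t (conj HC1 HC2)) HC3.
Qed.

Lemma restricted_dim_ge0 (Delta : R) phi E : 0 <= restricted_dim Delta phi E.
Proof. by apply: le_ereal_inf_tmp => _ [s [s0 _] <-]; rewrite lee_fin. Qed.

End cover_cost.

(** * Covering the limit set and the marked points by each other *)

Section arithmetic.
Context {R : realFieldType}.
Implicit Types x y : R.

Lemma add2_le3 x y : y <= x -> x + 2 * y <= 3 * x. Proof. lra. Qed.
Lemma le_triple x : 0 < x -> 0 <= x <= 3 * x. Proof. by move=> x0; apply/andP; split; lra. Qed.
Lemma le_sextuple x : 0 < x -> x <= 2 * (3 * x). Proof. lra. Qed.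
Lemma sextupleE x : 2 * (3 * x) = 6 * x. Proof. lra. Qed.

Lemma le_2add2 x y : 0 < x -> 0 < y -> y <= 2 * (x + 2 * y). Proof. lra. Qed.
Lemma add3_third x : x / 3 + (x / 3 + x / 3) = x. Proof. lra. Qed.
End arithmetic.

Section dimension_bounds.
Context {R : realType} {d : nat} {I : countType}.
Variables (X : set 'rV[R]_d) (S : I -> 'rV[R]_d -> 'rV[R]_d) (c rho : R)
  (p : 'rV[R]_d).
Hypothesis BS : bilip_system X S c rho p.
Hypothesis d0 : (0 < d)%N.

Local Notation f := (comp_word S).
Local Notation r w := (lip_ratio X (comp_word S w)).
Local Notation F := (limit_set X S).

Definition ratio_sum (s : R) : \bar R := \esum_(w in [set: seq I]) ((r w) `^ s)%:E.

Let rs_ge0 s w : (0 <= ((r w) `^ s)%:E)%E. Proof. by rewrite lee_fin powR_ge0. Qed.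

Lemma ratio_sum_fine s : (ratio_sum s < +oo)%E -> exists2 G : R, 0 <= G & ratio_sum s = G%:E.
Proof.
move=> Gfin; exists (fine (ratio_sum s)); first by rewrite fine_ge0 ?esum_ge0.
by rewrite fineK// ge0_fin_numE// esum_ge0.
Qed.

(** Finitely many words carry all but [e] of the sum, and their ratios have a positive
    lower bound. *)
Lemma tail_small s (e : R) : (ratio_sum s < +oo)%E -> 0 < e ->
  exists2 kap : R, 0 < kap &
    (\esum_(w in [set w | (r w <= kap)%R]) ((r w) `^ s)%:E <= e%:E)%E.
Proof.
move=> Gfin e0; have [Y [/finite_seqP[l Yl] _ le]] := esum_tail (rs_ge0 s) Gfin e0.
have [kap k0 Hk] : exists2 kap : R, 0 < kap & forall w, w \in l -> kap < r w.
  elim: l {Yl le} => [|w l [kap k0 IH]]; first by exists 1.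
  exists (Num.min kap (r w / 2)); first by rewrite lt_min k0 divr_gt0// (bs_gt0 BS).
  move=> v; rewrite inE => /orP[/eqP ->|/IH vk].
    by rewrite gt_min ltr_pdivrMr// ltr_pMr ?ltr1n ?orbT// (bs_gt0 BS).
  by rewrite gt_min vk.
exists kap => //; apply: le_trans le; apply: le_esum_set => w wk; split => //.
by rewrite Yl => /Hk; rewrite ltNge => /negP.
Qed.

Lemma cover_cost_words s a b (k T : R) (W : set (seq I)) (A : seq I -> set 'rV[R]_d) :
  0 <= k -> (\esum_(w in W) ((r w) `^ s)%:E <= T%:E)%E ->
  (forall w, W w -> (cover_cost s a b (A w) <= (k * (r w) `^ s)%:E)%E) ->
  (cover_cost s a b (\bigcup_(w in W) A w) <= (k * T)%:E)%E.
Proof.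
move=> k0 WT HA; apply: le_trans (cover_cost_bigcup s a b (@countableP _ W) (@subset_refl _ _)) _.
apply: (@le_trans _ _ (\esum_(w in W) (k%:E * ((r w) `^ s)%:E))%E).
  by apply: le_esum => w Ww; rewrite -EFinM; exact: HA.
by rewrite esumZl// EFinM; apply: lee_wpmul2l.
Qed.

Section with_points.
Variables (P : set 'rV[R]_d) (pp : I -> 'rV[R]_d).
Hypothesis ppP : forall i, P (pp i).
Hypothesis ppS : forall i, (S i @` X) (pp i).
Hypothesis Ppp : forall x, P x -> exists i, x = pp i.

Let ppX i : X (pp i).
Proof. by have [y Xy <-] := ppS i; exact: (bs_into BS). Qed.

Let pp_word D w i x : (forall x y, X x -> X y -> enorm (x - y) <= D) ->
  (f (rcons w i) @` X) x -> enorm (x - f w (pp i)) <= D * r (rcons w i).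
Proof.
move=> XD Hx; apply: (image_dist BS XD Hx).
have [y Xy <-] := ppS i; exists y => //.
by rewrite -cats1 comp_word_catE.
Qed.

(** At scale [delta], stop each code at the first word [w i] whose image has size
    at most [delta].  Images that are not too small are sets of the cover.  The
    others, grouped by [w], are close to the images under [w] of points of [P],
    and [w] transports an efficient cover of [P] at scale [delta / r w].  When
    that scale is not small, a fixed cover of [P] is used instead; few words are
    concerned. *)
Lemma adm_limit_set (Delta : R) (Phi : R -> R) (s : R) :
  (forall x, 0 < x < Delta -> 0 < Phi x <= x) ->
  (forall x y, 0 < x -> x <= y -> y < Delta -> Phi x / x <= Phi y / y) ->
  (ratio_sum s < +oo)%E -> adm_exponent Delta Phi P s -> adm_exponent Delta Phi F s.
Proof.
move=> PhiD Phimono Gfin [s0 Padm]; split => // eps e0.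
have [G G0 GE] := ratio_sum_fine Gfin.
have [D D0 XD] := compact_bounded_dist (bs_compact BS).
have [N2 N21 HN2] := @cover_cost_ball R d 2 d0.
have [N6 N61 HN6] := @cover_cost_transfer R d 6 d0.
have N20 : 0 < N2 by exact: lt_le_trans N21.
have N60 : 0 < N6 by exact: lt_le_trans N61.
have six0 : 0 < (6 : R) `^ s by rewrite powR_gt0.
pose e' := eps / 3 / (N6 * 6 `^ s * (G + 1)).
have G1 : 0 < G + 1 by rewrite ltr_wpDl.
have e'0 : 0 < e' by rewrite !divr_gt0// !mulr_gt0.
have [dl0 /andP[dl0_gt0 dl0_le] Pcov] := Padm e' e'0.
have [dl0_1 dl0_D] : dl0 <= 1 /\ dl0 <= Delta by move: dl0_le; rewrite le_min => /andP.
pose dl1 := dl0 / 2.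
have dl1_gt0 : 0 < dl1 by rewrite divr_gt0.
have dl1_lt : dl1 < dl0 by rewrite ltr_pdivrMr// ltr_pMr// ltr1n.
pose a1 := Phi dl1.
have /andP[a1_gt0 a1_le] : 0 < a1 <= dl1.
  by apply: PhiD; rewrite dl1_gt0/= (lt_le_trans dl1_lt).
(* the constants for the fixed cover of [P] at scale [dl1] may depend on [dl1],
   because the words that need it only contribute a tail of the sum *)
pose Lam := 1 + 2 * D / a1.
have Da1 : 0 < D / a1 by rewrite divr_gt0.
have Lam1 : 1 <= Lam by rewrite /Lam lerDl -mulrA mulr_ge0// ltW.
have Lam0 : 0 < Lam by exact: lt_le_trans Lam1.
have [N3 N31 HN3] := @cover_cost_transfer R d (2 * Lam) d0.
have N30 : 0 < N3 by exact: lt_le_trans N31.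
pose k1 := N2 * (2 * D) `^ s.
have k10 : 0 < k1 by rewrite mulr_gt0// powR_gt0// mulr_gt0.
have [kap1 kap1_gt0 tail1] := tail_small Gfin (divr_gt0 (divr_gt0 e0 (ltr0n R 3)) k10).
pose k3 := N3 * (2 * Lam) `^ s * e'.
have Ls0 : 0 < (2 * Lam) `^ s by apply: powR_gt0; exact: mulr_gt0.
have k30 : 0 < k3 by apply: mulr_gt0 => //; exact: mulr_gt0.
have [kap3 kap3_gt0 tail3] := tail_small Gfin (divr_gt0 (divr_gt0 e0 (ltr0n R 3)) k30).
pose ds := Num.min (Num.min dl1 D) (Num.min (D * kap1) (dl1 * kap3)).
have ds0 : 0 < ds by rewrite !lt_min dl1_gt0 D0 !mulr_gt0.
exists ds.
  rewrite ds0/= le_min !ge_min (le_trans (ltW dl1_lt) dl0_1).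
  by rewrite (le_trans (ltW dl1_lt) dl0_D).
move=> dl /andP[dl_gt0]; rewrite !lt_min => /andP[/andP[dl_dl1 dl_D] /andP[dl_k1 dl_k3]].
have dl_Delta : dl < Delta := lt_le_trans (lt_trans dl_dl1 dl1_lt) dl0_D.
have /andP[phi0 phi_dl] : 0 < Phi dl <= dl by apply: PhiD; rewrite dl_gt0.
pose V1 := [set v | Phi dl <= D * r v <= dl].
pose B w := [set x | exists i, (f (rcons w i) @` X) x /\ D * r (rcons w i) < Phi dl].
pose W2 := [set w | dl <= r w * dl1 /\ dl < D * r w].
pose W3 := [set w | r w * dl1 < dl /\ dl < D * r w].
have cover : F `<=` (\bigcup_(v in V1) (f v @` X)) `|`
    ((\bigcup_(w in W2) B w) `|` (\bigcup_(w in W3) B w)).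
  move=> x /(limit_setP BS)[z Hz].
  have ex : exists n, D * r (mkseq z n) <= dl.
    have [N HN] := ratio_to0 BS (divr_gt0 dl_gt0 D0).
    exists N; rewrite mulrC -ler_pdivlMr//; apply: HN; by rewrite size_mkseq.
  have [n Hn nmin] : exists2 n, D * r (mkseq z n) <= dl &
      forall k, (k < n)%N -> dl < D * r (mkseq z k).
    exists (ex_minn ex); case: ex_minnP => n Hn nmin // k kn.
    by rewrite ltNge; apply/negP => /nmin; rewrite leqNgt kn.
  case: n Hn nmin => [|n] Hn nmin.
    by move: Hn; rewrite /= (ratio_nil BS) mulr1 leNgt dl_D.
  have zE : mkseq z n.+1 = rcons (mkseq z n) (z n) by rewrite mkseqS.
  have [big|small] := leP (Phi dl) (D * r (mkseq z n.+1)).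
    left; exists (mkseq z n.+1); last exact: Hz.
    by rewrite /V1/= big Hn.
  have Bx : B (mkseq z n) x by exists (z n); rewrite -zE; split => //; exact: Hz.
  right; have wn := nmin n (ltnSn n).
  by have [h|h] := leP dl (r (mkseq z n) * dl1); [left|right]; exists (mkseq z n).
(* the companion of a point of [B w] is the point of [P] in the same image *)
have companion w : exists g : 'rV[R]_d -> 'rV[R]_d, (forall x, B w x -> P (g x)) /\
    forall x y, B w x -> B w y ->
      enorm (x - y) <= r w * enorm (g x - g y) + 2 * Phi dl.
  have [i0] := bs_inh BS.
  have /choice[ix Hix] : forall x, exists i, B w x ->
      (f (rcons w i) @` X) x /\ D * r (rcons w i) < Phi dl.
    by move=> x; have [[i Hi]|nB] := pselect (B w x); [exists i|exists i0].
  exists (pp \o ix); split => [x _ //=|x y Bx By /=].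
  have [Hx lx] := Hix _ Bx; have [Hy ly] := Hix _ By.
  have dx := pp_word XD Hx.
  have dy : enorm (f w (pp (ix y)) - y) <= D * r (rcons w (ix y)).
    by rewrite edistC; exact: pp_word.
  have xy := bs_upper BS w (ppX (ix x)) (ppX (ix y)).
  have t1 := edistD x (f w (pp (ix x))) y.
  have t2 := edistD (f w (pp (ix x))) (f w (pp (ix y))) y.
  by clear -xy dx dy t1 t2 lx ly; lra.
have part1 : (cover_cost s (Phi dl) dl (\bigcup_(v in V1) (f v @` X)) <= (eps / 3)%:E)%E.
  have -> : eps / 3 = k1 * (eps / 3 / k1) by rewrite [RHS]mulrC divfK ?gt_eqF.
  apply: cover_cost_words; first exact: ltW.
    apply: le_trans tail1; apply: le_esum_set => v /andP[_ vdl] /=.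
    by rewrite -(ler_pM2l D0); exact: le_trans vdl (ltW dl_k1).
  move=> v /andP[v1 v2].
  apply: (@le_trans _ _ (cover_cost s (Phi dl) dl (ecball (f v p) (D * r v)))).
    apply: le_cover_cost => x Hx; rewrite /ecball/=.
    by apply: (image_dist BS XD Hx); exists p => //; exact: (bs_base BS).
  have rv0 := bs_gt0 BS v.
  have Drv0 : 0 < D * r v by rewrite mulr_gt0.
  apply: le_trans (HN2 _ _ _ _ _ s0 _ _) _.
  - by rewrite phi0.
  - by rewrite ler_pM2l// v2 andbT; apply: le_trans v1 _; rewrite ler_peMl ?ler1n// ltW.
  - by rewrite lee_fin mulrA powRM ?mulrA// ?mulr_ge0// ltW.
have part2 : (cover_cost s (Phi dl) dl (\bigcup_(w in W2) B w) <= (eps / 3)%:E)%E.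
  apply: (@le_trans _ _ (N6 * 6 `^ s * e' * G)%:E).
    apply: cover_cost_words; first exact: ltW (mulr_gt0 (mulr_gt0 N60 six0) e'0).
      by rewrite -GE; exact: le_esum_set.
    move=> w [w1 w2]; have rw0 := bs_gt0 BS w; have rw1 := ratio_le1 BS w.
    have [g [gP gd]] := companion w.
    pose eta := dl / r w.
    have eta0 : 0 < eta by rewrite divr_gt0.
    have etaE : r w * eta = dl by rewrite mulrC divfK ?gt_eqF.
    have eta1 : eta <= dl1 by rewrite ler_pdivrMr// mulrC.
    have eta_dl0 : eta < dl0 by exact: le_lt_trans dl1_lt.
    have dl_eta : dl <= eta by rewrite ler_pdivlMr// ler_piMr// ltW.
    have etaD : eta < Delta by exact: lt_le_trans dl0_D.
    have /andP[pe0 pe1] : 0 < Phi eta <= eta by apply: PhiD; rewrite eta0.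
    have phi_eta : Phi dl <= r w * Phi eta.
      have := Phimono _ _ dl_gt0 dl_eta etaD.
      rewrite ler_pdivrMr// => /le_trans; apply.
      by rewrite -etaE mulrA mulrAC mulfVK ?gt_eqF// mulrC.
    apply: le_trans (HN6 s (Phi eta) eta (Phi dl) dl (r w) (2 * Phi dl) (3 * r w) (B w) P g
      s0 _ pe0 _ _ _ _ _ gP gd) _.
    - by rewrite phi0.
    - by rewrite mulr_gt0.
    - by rewrite -[3 * r w * _]mulrA; exact: add2_le3.
    - exact: le_triple.
    - rewrite -[3 * r w * _]mulrA; apply: le_trans phi_eta _.
      by apply: le_sextuple; exact: mulr_gt0.
    - by rewrite -[3 * r w * _]mulrA etaE sextupleE.
    have := Pcov eta (introT andP (conj eta0 eta_dl0)) => Pe.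
    apply: le_trans (lee_wpmul2l _ Pe) _; first by rewrite lee_fin mulr_ge0 ?powR_ge0// ltW.
    rewrite -EFinM lee_fin sextupleE.
    rewrite powRM; [|by []|exact: ltW].
    by rewrite [leLHS](_ : _ = N6 * 6 `^ s * e' * r w `^ s)//; ring.
  rewrite lee_fin /e'.
  have -> : N6 * 6 `^ s * (eps / 3 / (N6 * 6 `^ s * (G + 1))) * G = eps / 3 * (G / (G + 1)).
    by field; rewrite !gt_eqF.
  by rewrite ler_piMr ?divr_ge0 ?(ltW e0)// ler_pdivrMr// mul1r lerDl.
have part3 : (cover_cost s (Phi dl) dl (\bigcup_(w in W3) B w) <= (eps / 3)%:E)%E.
  have -> : eps / 3 = k3 * (eps / 3 / k3) by rewrite [RHS]mulrC divfK ?gt_eqF.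
  apply: cover_cost_words; first exact: ltW.
    apply: le_trans tail3; apply: le_esum_set => w [w1 _] /=.
    by rewrite -(ler_pM2r dl1_gt0) [leRHS]mulrC; exact: ltW (lt_trans w1 dl_k3).
  move=> w [w1 w2]; have rw0 := bs_gt0 BS w.
  have [g [gP gd]] := companion w.
  have La1 : Lam * r w * a1 = r w * a1 + 2 * (D * r w).
    by rewrite /Lam; field; rewrite gt_eqF.
  have ra0 : 0 < r w * a1 by rewrite mulr_gt0.
  apply: le_trans (HN3 s a1 dl1 (Phi dl) dl (r w) (2 * Phi dl) (Lam * r w) (B w) P g
      s0 _ a1_gt0 _ _ _ _ _ gP gd) _.
  - by rewrite phi0.
  - by rewrite mulr_gt0.
  - by rewrite La1 lerD2l ler_pM2l// ltW// (le_lt_trans phi_dl).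
  - by rewrite ltW//= ler_peMl// ltW.
  - rewrite La1; apply: le_trans (le_trans phi_dl (ltW w2)) _.
    by apply: le_2add2 => //; exact: lt_trans w2.
  - by rewrite -!mulrA ler_pM2l// ler_pM2l// ltW.
  have Pe := Pcov dl1 (introT andP (conj dl1_gt0 dl1_lt)).
  apply: le_trans (lee_wpmul2l _ Pe) _; first by rewrite lee_fin mulr_ge0 ?powR_ge0// ltW.
  rewrite -EFinM lee_fin /k3 [2 * (Lam * r w)]mulrA powRM; [|by rewrite mulr_ge0 ?ltW|exact: ltW].
  by rewrite [leLHS](_ : _ = N3 * (2 * Lam) `^ s * e' * r w `^ s)//; ring.
apply: le_trans (le_cover_cost _ _ _ cover) _.
apply: le_trans (cover_costU _ _ _ _ _) _.
apply: le_trans (leeD part1 (le_trans (cover_costU _ _ _ _ _) (leeD part2 part3))) _.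
by rewrite -!EFinD lee_fin add3_third.
Qed.

End with_points.

End dimension_bounds.

(** * Hausdorff and restricted dimensions of the limit set *)

Section hausdorff_dimension.
Context {R : realType} {d : nat}.
Implicit Types (E : set 'rV[R]_d) (x y : \bar R).

Lemma lee_of_real_gt x y : (0 <= x)%E ->
  (forall s : R, (x < s%:E)%E -> (y <= s%:E)%E) -> (y <= x)%E.
Proof.
case: x => [x| |]// x0 H; last by rewrite leey.
by apply/lee_addgt0Pr => e e0; apply: H; rewrite lte_fin ltrDl.
Qed.

Lemma dimH_le E (s : R) : 0 <= s ->
  (forall delta eps : R, 0 < delta -> 0 < eps -> (hausdorff_pre s delta E <= eps%:E)%E) ->
  (dimH E <= s%:E)%E.
Proof.
move=> s0 H; apply: ereal_inf_lbound; exists s => //; split => //.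
apply/eqP; rewrite eq_le; apply/andP; split.
  apply: ge_ereal_sup => _ [delta /= delta0 <-].
  by apply/lee_addgt0Pr => e e0; rewrite add0e; exact: H.
apply: le_trans (_ : hausdorff_pre s 1 E <= _)%E; last first.
  by apply: ereal_sup_ubound; exists 1 => /=.
by apply: le_ereal_inf_tmp => _ [C _ <-]; apply: esum_ge0 => U _; exact: poweR_ge0.
Qed.

Lemma hausdorff_pre_le s delta E C : countable_cover C E ->
  (forall U, C U -> (ediam U <= delta%:E)%E) ->
  (hausdorff_pre s delta E <= \esum_(U in C) (ediam U `^ s))%E.
Proof. by move=> HC Hd; apply: ereal_inf_lbound; exists C. Qed.

Lemma dimH_countable E : countable E -> (dimH E <= 0)%E.
Proof.
move=> cE; apply: lee_of_real_gt => // s; rewrite lte_fin => s0.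
apply: dimH_le; first exact: ltW.
move=> delta eps delta0 e0.
have d1 (x : 'rV[R]_d) : ediam [set x] = 0%E.
  apply/eqP; rewrite eq_le ediam_ge0 andbT.
  by apply/(ediam_leP _ (lexx 0)) => _ _ -> ->; rewrite subrr enorm0.
pose C : set (set 'rV[R]_d) := [set [set x] | x in E].
have HC : (hausdorff_pre s delta E <= \esum_(U in C) (ediam U `^ s))%E.
  apply: hausdorff_pre_le.
    split; first exact: sub_countable (card_image_le _ _) cE.
    by move=> x Ex; exists [set x] => //; exists x.
  by move=> _ [x Ex <-]; rewrite d1 lee_fin ltW.
apply: le_trans HC _; rewrite esum1 ?lee_fin ?ltW// => _ [x _ <-].
by rewrite d1 poweR0r ?gt_eqF.
Qed.

Lemma dimH_le_restricted_dim (Delta : R) phi E : 0 < Delta ->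
  (forall delta, 0 < delta < Delta -> 0 < phi delta) ->
  (dimH E <= restricted_dim Delta phi E)%E.
Proof.
move=> D0 phi0; apply: lee_of_real_gt; first exact: restricted_dim_ge0.
move=> s /(restricted_dim_lt phi0)[s0 H]; apply: dimH_le => // delta eps dl0 e0.
have [delta0 /andP[d0 _] Hd] := H _ (divr_gt0 e0 (ltr0n R 2)).
pose eta := Num.min (delta0 / 2) delta.
have eta0 : 0 < eta by rewrite lt_min dl0 divr_gt0.
have eta1 : eta < delta0 by rewrite gt_min ltr_pdivrMr// ltr_pMr// ltr1n.
have lt1 : (cover_cost s (phi eta) eta E < eps%:E)%E.
  apply: le_lt_trans (Hd _ (introT andP (conj eta0 eta1))) _.
  by rewrite lte_fin ltr_pdivrMr// ltr_pMr// ltr1n.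
have [C [HC1 HC2] HC3] := cover_cost_lt lt1.
apply: le_trans (hausdorff_pre_le _ HC1 _) (ltW HC3) => U /HC2[_ Ueta].
by apply: le_trans Ueta _; rewrite lee_fin ge_min lexx orbT.
Qed.

End hausdorff_dimension.

Section dimension_formula.
Context {R : realType} {d : nat} {I : countType}.
Variables (X : set 'rV[R]_d) (S : I -> 'rV[R]_d -> 'rV[R]_d) (c rho : R)
  (p : 'rV[R]_d).
Hypothesis BS : bilip_system X S c rho p.
Hypothesis d0 : (0 < d)%N.

Local Notation f := (comp_word S).
Local Notation r w := (lip_ratio X (comp_word S w)).
Local Notation F := (limit_set X S).

(** The images of [X] under the words of one length cover [F], and above [pressure_h]
    their cost is a tail of a convergent sum. *)
Lemma dimH_limit_set : dimH F = pressure_h X S.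
Proof.
apply/eqP; rewrite eq_le (pressure_h_le_dimH BS d0) andbT.
apply: lee_of_real_gt; first exact: pressure_h_ge0 => s.
move=> s /(sum_above_h BS)[s0 Gfin]; apply: dimH_le; first exact: ltW.
move=> delta eps dl0 e0.
have [D D0 XD] := compact_bounded_dist (bs_compact BS).
have Ds0 : 0 < D `^ s by rewrite powR_gt0.
have [kap k0 tail] := tail_small BS Gfin (divr_gt0 e0 Ds0).
have mk0 : 0 < Num.min kap (delta / D) by rewrite lt_min k0 divr_gt0.
have [N HN] := ratio_to0 BS mk0.
have wN w : words N w -> r w <= kap /\ D * r w <= delta.
  move=> wN; have := HN w; rewrite wN => /(_ (leqnn N)); rewrite le_min => /andP[-> h].
  by split => //; rewrite mulrC -ler_pdivlMr.
have dU w : (ediam (f w @` X) <= (D * r w)%:E)%E.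
  apply/ediam_leP; first by rewrite mulr_ge0// ltW// (bs_gt0 BS).
  by move=> x y Hx Hy; exact: (image_dist BS XD Hx Hy).
apply: (@le_trans _ _ (\esum_(U in (fun w => f w @` X) @` words N) (ediam U `^ s))%E).
  apply: hausdorff_pre_le.
    split; first by apply: (sub_countable (card_image_le _ _)); exact: countableP.
    move=> x /(limit_setP BS)[z Hz]; exists (f (mkseq z N) @` X); last exact: Hz.
    by exists (mkseq z N) => //; rewrite /words/= size_mkseq.
  move=> _ [w /wN[_ h] <-]; apply: le_trans (dU w) _; by rewrite lee_fin.
apply: le_trans (esum_image_le _ _ _) _.
apply: (@le_trans _ _ (\esum_(w in words N) ((D `^ s)%:E * ((r w) `^ s)%:E))%E).
  apply: le_esum => w _; rewrite -EFinM -(powRM _ (ltW D0) (ltW (bs_gt0 BS w))) -poweR_EFin.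
  apply: gt0_ler_poweR => //; first exact: ltW.
  - by rewrite in_itv/= leey ediam_ge0.
  - by rewrite in_itv/= leey lee_fin mulr_ge0// ltW// (bs_gt0 BS).
rewrite esumZl ?powR_ge0//; last by move=> w; rewrite lee_fin powR_ge0.
rewrite -lee_pdivlMl//; apply: le_trans (le_trans _ tail) _.
  by apply: le_esum_set => w /wN[].
by rewrite -EFinM lee_fin mulrC.
Qed.

Section with_points.
Variables (P : set 'rV[R]_d) (pp : I -> 'rV[R]_d).
Hypothesis ppP : forall i, P (pp i).
Hypothesis ppS : forall i, (S i @` X) (pp i).
Hypothesis Ppp : forall x, P x -> exists i, x = pp i.

(** A point of [P] whose image has size below [Phi delta] is as good as covered
    once [F] is.  The images of size at least [Phi delta] are covered one by one;
    the cost of the large ones is a finite sum of powers of [delta], that of the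
    others is the tail of a convergent series. *)
Lemma adm_points (Delta : R) (Phi : R -> R) (s : R) :
  (forall x, 0 < x < Delta -> 0 < Phi x <= x) -> 0 < s -> (ratio_sum X S s < +oo)%E ->
  adm_exponent Delta Phi F s -> adm_exponent Delta Phi P s.
Proof.
move=> PhiD s0 Gfin [_ Fadm]; have s_ge0 := ltW s0; split => // eps e0.
have [D D0 XD] := compact_bounded_dist (bs_compact BS).
have [N1 N11 HN1] := @cover_cost_ball R d 1 d0.
have [N6 N61 HN6] := @cover_cost_transfer R d 6 d0.
have N10 : 0 < N1 by exact: lt_le_trans N11.
have N60 : 0 < N6 by exact: lt_le_trans N61.
have e30 : 0 < eps / 3 by rewrite divr_gt0.
pose k6 := N6 * (2 * 3) `^ s.
have k60 : 0 < k6 by apply: mulr_gt0 => //; apply: powR_gt0.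
have [dlF /andP[dlF0 dlF_le] Fcov] := Fadm _ (divr_gt0 e30 k60).
pose k1 := N1 * D `^ s.
have k10 : 0 < k1 by apply: mulr_gt0 => //; exact: powR_gt0.
have rs_ge0 w : (0 <= ((r w) `^ s)%:E)%E by rewrite lee_fin powR_ge0.
have [Y [/finite_seqP[l Yl] _ tail]] := esum_tail rs_ge0 Gfin (divr_gt0 e30 k10).
pose kl := N1 * ((size l)%:R + 1).
have kl0 : 0 < kl by rewrite mulr_gt0// ltr_wpDl.
pose kap := (eps / 3 / kl) `^ s^-1.
have kap0 : 0 < kap by rewrite powR_gt0 ?divr_gt0.
exists (Num.min dlF kap).
  by rewrite lt_min dlF0 kap0/= ge_min dlF_le.
move=> dl /andP[dl0]; rewrite lt_min => /andP[dl_F dl_kap].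
have dl_Delta : dl < Delta.
  by apply: lt_le_trans dl_F _; move: dlF_le; rewrite le_min => /andP[].
have /andP[phi0 phi_dl] : 0 < Phi dl <= dl by apply: PhiD; rewrite dl0.
pose A (w : seq I) := [set x | exists2 i, w = [:: i] & x = pp i].
pose Ps := [set x | exists2 i, x = pp i & D * r [:: i] < Phi dl].
pose Wt := [set w | ~ Y w /\ Phi dl <= D * r w].
pose Wf := [set w | Y w /\ Phi dl <= D * r w].
have cover : P `<=` Ps `|` ((\bigcup_(w in Wt) A w) `|` (\bigcup_(w in Wf) A w)).
  move=> x /Ppp[i xi].
  have [big|small] := leP (Phi dl) (D * r [:: i]); last by left; exists i.
  right; have [yi|nyi] := pselect (Y [:: i]); [right|left]; exists [:: i] => //; by exists i.
(* a single point is covered by a ball of any admissible diameter [t] *)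
have single w (t : R) : Phi dl <= t <= dl ->
    (cover_cost s (Phi dl) dl (A w) <= (N1 * t `^ s)%:E)%E.
  move=> /andP[t1 t2].
  have t0 : 0 < t := lt_le_trans phi0 t1.
  have [[i wi]|nw] := pselect (exists i, w = [:: i]); last first.
    rewrite (_ : A w = set0) ?cover_cost0 ?lee_fin ?mulr_ge0 ?powR_ge0 ?(ltW N10)//.
    by apply/seteqP; split => // x [i wi _]; case: nw; exists i.
  have tE : 2 * (t / 2) = t by rewrite mulrC divfK.
  apply: (@le_trans _ _ (cover_cost s (Phi dl) dl (ecball (pp i) (t / 2)))).
    apply: le_cover_cost => x [j]; rewrite wi => -[<-] ->.
    by apply: ecball_center; rewrite divr_ge0// ltW.
  rewrite -[in leRHS]tE; apply: HN1 => //; first by rewrite phi0.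
  by rewrite tE mul1r t1.
have part1 : (cover_cost s (Phi dl) dl Ps <= (eps / 3)%:E)%E.
  have /choice[g Hg] : forall x, exists y, Ps x -> exists i,
      [/\ x = pp i, D * r [:: i] < Phi dl, F y & (f [:: i] @` X) y].
    move=> x; have [[i xi small]|nP] := pselect (Ps x); last by exists x.
    by have [y [Fy Sy]] := limit_set_in_image BS [:: i]; exists y => _; exists i.
  have gd x y : Ps x -> Ps y -> enorm (x - y) <= 1 * enorm (g x - g y) + 2 * Phi dl.
    move=> Px Py; have [i [xi li _ Hi]] := Hg _ Px; have [j [yj lj _ Hj]] := Hg _ Py.
    have dx : enorm (x - g x) <= D * r [:: i].
      by apply: (image_dist BS XD _ Hi); rewrite xi; exact: ppS.
    have dy : enorm (g y - y) <= D * r [:: j].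
      by apply: (image_dist BS XD Hj); rewrite yj; exact: ppS.
    have t1 := edistD x (g x) y; have t2 := edistD (g x) (g y) y.
    by rewrite mul1r; clear -dx dy t1 t2 li lj; lra.
  have gF x : Ps x -> F (g x) by move=> /Hg[i []].
  apply: le_trans (HN6 s (Phi dl) dl (Phi dl) dl 1 (2 * Phi dl) 3 Ps F g
    s_ge0 _ phi0 _ _ _ _ _ gF gd) _.
  - by rewrite phi0.
  - by [].
  - by rewrite mul1r; exact: add2_le3.
  - by rewrite ler01 ler1n.
  - exact: le_sextuple.
  - by rewrite sextupleE.
  have Fe := Fcov dl (introT andP (conj dl0 dl_F)).
  apply: le_trans (lee_wpmul2l _ Fe) _; first by rewrite lee_fin ltW.
  by rewrite -EFinM lee_fin mulrC divfK ?gt_eqF.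
have part2 : (cover_cost s (Phi dl) dl (\bigcup_(w in Wt) A w) <= (eps / 3)%:E)%E.
  have -> : eps / 3 = k1 * (eps / 3 / k1) by rewrite [RHS]mulrC divfK ?gt_eqF.
  apply: cover_cost_words; first exact: ltW.
    by apply: le_trans tail; apply: le_esum_set => w [nY _].
  move=> w [nY big].
  apply: le_trans (single w (Num.min (D * r w) dl) _) _.
    by rewrite le_min big phi_dl ge_min lexx orbT.
  have rw0 := bs_gt0 BS w.
  rewrite lee_fin /k1 -mulrA ler_pM2l// -(powRM _ (ltW D0) (ltW rw0)).
  have Drw0 : 0 <= D * r w by rewrite mulr_ge0// ltW.
  apply: ge0_ler_powR => //.
  - by rewrite nnegrE le_min Drw0 ltW.
  - by rewrite ge_min lexx.
have part3 : (cover_cost s (Phi dl) dl (\bigcup_(w in Wf) A w) <= (eps / 3)%:E)%E.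
  apply: le_trans (cover_cost_bigcup _ _ _ (@countableP _ Wf) (@subset_refl _ _)) _.
  apply: (@le_trans _ _ (\esum_(w in Wf) (N1 * dl `^ s)%:E)%E).
    by apply: le_esum => w _; apply: single; rewrite phi_dl lexx.
  apply: le_trans (esum_const_seq _ (M := (size l)%:R) _) _.
  - by rewrite mulr_ge0 ?powR_ge0// ltW.
  - move=> ws uws wsY; rewrite ler_nat; apply: uniq_leq_size => // w /wsY[+ _].
    by rewrite Yl.
  have dls : dl `^ s <= eps / 3 / kl.
    have -> : eps / 3 / kl = kap `^ s.
      by rewrite /kap -powRrM mulVf ?gt_eqF// powRr1// divr_ge0 ?ltW.
    by apply: ge0_ler_powR => //; rewrite ?nnegrE ltW.
  rewrite lee_fin; apply: (@le_trans _ _ (kl * (eps / 3 / kl))); last first.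
    by rewrite mulrC divfK ?gt_eqF.
  rewrite mulrA [(size l)%:R * N1]mulrC; apply: ler_pM => //.
  - by rewrite mulr_ge0// ltW.
  - exact: powR_ge0.
  - by rewrite ler_pM2l// lerDl.
apply: le_trans (le_cover_cost _ _ _ cover) _.
apply: le_trans (cover_costU _ _ _ _ _) _.
apply: le_trans (leeD part1 (le_trans (cover_costU _ _ _ _ _) (leeD part2 part3))) _.
by rewrite -!EFinD lee_fin add3_third.
Qed.

(** The bound by [pressure_h] comes first: it ensures that the sums of powers of the
    ratios converge at every exponent above the dimension of [F], which [adm_points]
    requires. *)
Lemma restricted_dim_limit_set (Delta : R) (Phi : R -> R) : 0 < Delta ->
  (forall x, 0 < x < Delta -> 0 < Phi x <= x) ->
  (forall x y, 0 < x -> x <= y -> y < Delta -> Phi x / x <= Phi y / y) ->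
  restricted_dim Delta Phi F = maxe (pressure_h X S) (restricted_dim Delta Phi P).
Proof.
move=> De0 PhiD Phimono.
have Phi0 x : 0 < x < Delta -> 0 < Phi x by move=> /PhiD/andP[].
have hF : (pressure_h X S <= restricted_dim Delta Phi F)%E.
  by rewrite -dimH_limit_set; exact: dimH_le_restricted_dim.
apply/eqP; rewrite eq_le ge_max hF/=; apply/andP; split.
  apply: lee_of_real_gt; first by rewrite le_max pressure_h_ge0.
  move=> s; rewrite gt_max => /andP[/(sum_above_h BS)[s0 Gfin] /(restricted_dim_lt Phi0) Ps].
  by apply: restricted_dim_le; exact: (adm_limit_set BS d0 ppP ppS).
apply: lee_of_real_gt; first exact: restricted_dim_ge0.
move=> s Fs; have [s0 Gfin] := sum_above_h BS (le_lt_trans hF Fs).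
by apply: restricted_dim_le; apply: adm_points => //; exact: restricted_dim_lt.
Qed.

Lemma dimH_points : (dimH P <= 0)%E.
Proof.
apply: dimH_countable; apply: (sub_countable _ (@countableP I setT)).
apply: card_le_trans (card_image_le pp setT).
by apply: subset_card_le => x /Ppp[i ->]; exists i.
Qed.

End with_points.
End dimension_formula.

(** * Upper box dimension *)

Lemma longest_seq (R : realType) (T : Type) (Q : seq T -> Prop) (M : R) :
  Q [::] -> (forall l, Q l -> (size l)%:R <= M) ->
  exists l, Q l /\ forall l', Q l' -> (size l' <= size l)%N.
Proof.
move=> Q0 QM.
have ex : exists n, `[< exists2 l, Q l & size l = n >] by exists 0%N; apply/asboolP; exists [::].
have bd n : `[< exists2 l, Q l & size l = n >] -> (n <= Num.truncn M)%N.
  move=> /asboolP[l Ql <-].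
  by rewrite truncn_ge_nat ?QM//; apply: le_trans (QM _ Ql).
case: (ex_maxnP ex bd) => n /asboolP[l Ql ln] nmax.
by exists l; split => // l' Ql'; rewrite ln; apply: nmax; apply/asboolP; exists l'.
Qed.

Section box_dimension.
Context {R : realType} {d : nat}.
Implicit Types (E : set 'rV[R]_d) (s delta : R).

Local Open Scope ereal_scope.

Lemma covering_number_ge0 delta E : 0 <= covering_number delta E.
Proof. by apply: le_ereal_inf_tmp => _ [n _ <-]; rewrite lee_fin. Qed.

Lemma covering_number_ge1 delta E : E !=set0 -> 1 <= covering_number delta E.
Proof.
move=> [x Ex]; apply: le_ereal_inf_tmp => _ [n [U [_ EU]] <-].
by have [k _] := EU _ Ex; rewrite lee_fin ler1n (leq_ltn_trans _ (ltn_ord k)).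
Qed.

Lemma covering_number_le_seq delta E (l : seq (set 'rV[R]_d)) :
  (forall U, U \in l -> ediam U <= delta%:E) ->
  (forall x, E x -> exists2 U, U \in l & U x) ->
  covering_number delta E <= ((size l)%:R)%:E.
Proof.
move=> ld lE; apply: ereal_inf_lbound; exists (size l) => //.
exists (fun k => nth set0 l k); split => [k|x /lE[U Ul Ux]].
  by apply: ld; rewrite mem_nth.
by exists (Ordinal (etrans (index_mem U l) Ul)); rewrite /= nth_index.
Qed.

(** The covering number is an infimum of integers; at most one extra set is needed, and
    the factor [2] absorbs it. *)
Lemma covering_number_sets delta E (M : R) : (1 <= M)%R ->
  covering_number delta E <= M%:E -> exists n (U : 'I_n -> set 'rV[R]_d),
    [/\ (n%:R <= 2 * M)%R, forall k, ediam (U k) <= delta%:E &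
        forall x, E x -> exists k, U k x].
Proof.
move=> M1 EM.
have : covering_number delta E < (M + 1)%:E.
  by apply: le_lt_trans EM _; rewrite lte_fin ltrDl.
move=> /ereal_inf_lt[_ [n [U [Ud EU]] <-]]; rewrite lte_fin => nM.
exists n, U; split => //; first by lra.
Qed.

Lemma upper_dimB_le E s (C delta0 : R) : (0 < C)%R -> (0 < delta0)%R ->
  (forall delta, (0 < delta < delta0)%R ->
     covering_number delta E <= (C * delta `^ (- s))%:E) ->
  upper_dimB E <= s%:E.
Proof.
move=> C0 dl0 H; apply/lee_addgt0Pr => e e0.
rewrite /upper_dimB limf_esupE.
pose d1 := Num.min (Num.min delta0 1%R) (expR (- (`|ln C| / e)))%R.
have d10 : (0 < d1)%R by rewrite !lt_min dl0 ltr01 expR_gt0.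
apply: ereal_inf_le => /=.
exists (ereal_sup ((fun delta : R => lne (covering_number delta E) *
    ((- ln delta)^-1)%:E) @` [set t | 0 < t < d1]%R)).
  exists [set t | 0 < t < d1]%R => //.
  near=> t; apply/andP; split; near: t; first exact: nbhs_right_gt.
  exact: nbhs_right_lt.
apply: ge_ereal_sup => _ [t /andP[t0 t1] <-].
move: t1; rewrite !lt_min => /andP[/andP[td t1] te].
have lt0 : (0 < - ln t)%R by rewrite oppr_gt0 ln_lt0// t0.
rewrite lee_pdivrMr// -EFinD -EFinM.
apply: (@le_trans _ _ (lne (C * t `^ (- s))%:E)).
  rewrite lee_lne; first by apply: H; rewrite t0.
  - by rewrite in_itv/= covering_number_ge0 leey.
  - by rewrite in_itv/= lee_fin mulr_ge0 ?powR_ge0 ?leey// ltW.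
rewrite lne_EFin; last by rewrite mulr_gt0// powR_gt0.
rewrite lee_fin lnM ?posrE ?powR_gt0// ln_powR mulrDl addrC mulNr mulrN lerD2l.
apply: le_trans (ler_norm _) _.
rewrite mulrC -ler_pdivrMr// lerNr.
by rewrite -[leRHS]expRK ler_ln ?posrE ?expR_gt0// ltW.
Unshelve. all: by end_near. Qed.

Lemma upper_dimB_lt E s : upper_dimB E < s%:E ->
  exists2 delta0 : R, (0 < delta0 <= 1)%R & forall delta, (0 < delta < delta0)%R ->
     covering_number delta E <= (delta `^ (- s))%:E.
Proof.
rewrite /upper_dimB limf_esupE => /ereal_inf_lt[_ [V V0 <-] Vs].
have [e /= e0 eV] := V0.
exists (Num.min e 1)%R; first by rewrite lt_min e0 ltr01/= ge_min lexx orbT.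
move=> t /andP[t0]; rewrite lt_min => /andP[te t1].
have Vt : V t by apply: eV => //=; rewrite sub0r normrN gtr0_norm.
have lt0 : (0 < - ln t)%R by rewrite oppr_gt0 ln_lt0// t0.
have : lne (covering_number t E) * ((- ln t)^-1)%:E <= s%:E.
  by apply: le_trans (ltW Vs); apply: ereal_sup_ubound; exists t.
rewrite lee_pdivrMr// -EFinM mulrN -mulNr -ln_powR -lne_EFin ?powR_gt0//.
rewrite lee_lne//.
- by rewrite in_itv/= covering_number_ge0 leey.
- by rewrite in_itv/= lee_fin powR_ge0 leey.
Qed.

Lemma upper_dimB_ge0 E : E !=set0 -> 0 <= upper_dimB E.
Proof.
move=> E0; rewrite leNgt; apply/negP => lt0.
have [s s0 Es] : exists2 s : R, (s < 0)%R & upper_dimB E < s%:E.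
  case: (upper_dimB E) lt0 => [u| |]//.
    by rewrite lte_fin => u0; exists (u / 2)%R; rewrite ?lte_fin; lra.
  by exists (-1)%R; rewrite ?ltrN10 ?ltNyr.
have [dl0 /andP[dl00 dl01] H] := upper_dimB_lt Es.
have h0 : (0 < dl0 / 2 < dl0)%R by apply/andP; split; lra.
have := le_trans (covering_number_ge1 (dl0 / 2)%R E0) (H _ h0).
rewrite lee_fin leNgt => /negP; apply.
rewrite -[ltRHS](powRr0 (dl0 / 2)%R) /powR gt_eqF; last by case/andP: h0.
by rewrite ltr_expR mul0r pmulr_rlt0 ?oppr_gt0// ln_lt0//; apply/andP; split; lra.
Qed.

(** Requiring all diameters to be equal to [delta] makes the sum of the
    [s]-th powers of the diameters a multiple of the number of sets. *)
Lemma upper_dimB_restricted E : (0 < d)%N -> E !=set0 ->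
  upper_dimB E = restricted_dim 1 (fun delta => delta `^ 1^-1)%R E.
Proof.
move=> d0 [x0 Ex0].
have phiE (t : R) : (0 < t)%R -> (t `^ 1^-1 = t)%R by move=> t0; rewrite invr1 powRr1// ltW.
have phi0 (t : R) : (0 < t < 1)%R -> (0 < t `^ 1^-1)%R by move=> /andP[t0 _]; rewrite phiE.
apply/eqP; rewrite eq_le; apply/andP; split.
  apply: lee_of_real_gt; first exact: restricted_dim_ge0.
  move=> s /(restricted_dim_lt phi0)[s0 H].
  have [dl0 /andP[dl00 _] Hd] := H 1%R ltr01.
  apply: (@upper_dimB_le _ _ 2 dl0) => // t /andP[t0 t1].
  have : cover_cost s (t `^ 1^-1) t E < 2%:E.
    by apply: le_lt_trans (Hd t _) _; rewrite ?t0// lte_fin ltr1n.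
  move=> /cover_cost_lt[C [[cC EC] HC] cost].
  have dU U : C U -> ediam U = t%:E.
    by move=> /HC[]; rewrite phiE// => h1 h2; apply/eqP; rewrite eq_le h1 h2.
  have ts0 : (0 < t `^ s)%R by rewrite powR_gt0.
  have bound l : uniq l /\ (forall U, U \in l -> C U) -> ((size l)%:R <= 2 * t `^ (- s))%R.
    move=> [ul lC]; rewrite powRN ler_pdivlMr// -lee_fin; apply: ltW.
    apply: le_lt_trans cost.
    have := esum_ge_seq (fun U => poweR_ge0 (ediam U) s) ul lC.
    apply: le_trans; rewrite big_seq (eq_bigr (fun=> (t `^ s)%:E)) => [|U Ul].
      rewrite -big_seq sumEFin lee_fin big_const_seq count_predT iter_addr_0.
      by rewrite -[X in (_ <= X)%R]mulr_natl.
    by rewrite dU ?poweR_EFin//; exact: lC.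
  have Q0 : uniq ([::] : seq (set 'rV[R]_d)) /\ (forall U, U \in [::] -> C U) by [].
  have [l [[ul lC] lmax]] := longest_seq Q0 bound.
  have CL U : C U -> U \in l.
    move=> CU; apply: contraT => Ul.
    have := lmax (U :: l); rewrite /= Ul ul => /(_ (conj isT _)); rewrite ltnn; apply.
    by move=> V; rewrite inE => /orP[/eqP -> //|]; exact: lC.
  apply: (@le_trans _ _ ((size l)%:R)%:E); last by rewrite lee_fin; exact: bound.
  apply: covering_number_le_seq; first by move=> U /lC /dU ->.
  by move=> x /EC[U CU Ux]; exists U => //; exact: CL.
have B0 : 0 <= upper_dimB E by apply: upper_dimB_ge0; exists x0.
apply: lee_of_real_gt => // s Bs.
have [s1 s10 [Bs1 s1s]] : exists2 s1 : R, (0 <= s1)%R & upper_dimB E < s1%:E /\ (s1 < s)%R.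
  case: (upper_dimB E) B0 Bs => [u| |]//; rewrite lee_fin lte_fin => u0 us.
  by exists ((u + s) / 2)%R; rewrite ?lte_fin; [|split]; lra.
have [dl0 /andP[dl00 dl01] H] := upper_dimB_lt Bs1.
apply: restricted_dim_le; split; first exact: le_trans (ltW s1s).
move=> eps e0.
pose k := (2 * 2 `^ s1)%R.
have k0 : (0 < k)%R by rewrite mulr_gt0// powR_gt0.
have ss0 : (0 < s - s1)%R by rewrite subr_gt0.
pose kap := ((eps / k) `^ (s - s1)^-1)%R.
have kap0 : (0 < kap)%R by rewrite powR_gt0// divr_gt0.
exists (Num.min dl0 kap).
  by rewrite lt_min dl00 kap0/= minxx ge_min dl01.
move=> t /andP[t0]; rewrite lt_min => /andP[t_dl0 t_kap].
have t20 : (0 < t / 2)%R by rewrite divr_gt0.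
have t2t : (t / 2 < t)%R by rewrite ltr_pdivrMr// ltr_pMr// ltr1n.
have M1 : (1 <= (t / 2) `^ (- s1))%R.
  rewrite powRN -[leLHS]invr1 lef_pV2 ?posrE ?powR_gt0// -[leRHS](powRr0 (t / 2)%R).
  by apply: ger_powR => //; apply/andP; split => //; lra.
have [|n [U [nM Ud EU]]] := covering_number_sets M1 (H (t / 2)%R _).
  by rewrite t20 (lt_trans t2t).
have /choice[z Hz] : forall k, exists z, (exists y, E y /\ U k y) -> E z /\ U k z.
  by move=> j; have [[y Hy]|none] := pselect (exists y, E y /\ U j y); [exists y|exists x0].
rewrite phiE//.
have dC j : ediam (ecball (z j) (t / 2)%R) = t%:E.
  by rewrite ediam_ecball ?(ltW t20)//; congr EFin; rewrite mulrC divfK.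
apply: le_trans (cover_cost_le s (C := [set ecball (z j) (t / 2)%R | j in [set: 'I_n]]) _) _.
  split; first split.
  - by apply: (sub_countable (card_image_le _ _)); exact: countableP.
  - move=> y Ey; have [j Uy] := EU y Ey; exists (ecball (z j) (t / 2)%R); first by exists j.
    have [Ez Uz] := Hz j (ex_intro _ y (conj Ey Uy)).
    by have /(ediam_leP _ (ltW t20)) := Ud j; exact.
  - by move=> _ [j _ <-]; rewrite dC !lexx.
apply: le_trans (esum_image_le _ _ _) _.
apply: (@le_trans _ _ (\esum_(j in [set: 'I_n]) (t `^ s)%:E)).
  by apply: le_esum => j _; rewrite dC poweR_EFin.
apply: le_trans (esum_const_seq (powR_ge0 _ _) (M := n%:R) _) _.
  by move=> l /card_uniqP <- _; rewrite ler_nat -[leqRHS]card_ord max_card.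
rewrite lee_fin.
apply: (@le_trans _ _ (2 * (t / 2) `^ (- s1) * t `^ s)%R).
  by apply: ler_wpM2r => //; exact: powR_ge0.
have -> : (2 * (t / 2) `^ (- s1) * t `^ s = k * t `^ (s - s1))%R.
  rewrite powRB; last by apply/implyP => _; rewrite gt_eqF.
  rewrite powRN powRM ?invr_ge0 ?(ltW t0)// /k -[(2^-1)%R]powR_inv1// -powRrM mulN1r powRN.
  by field; rewrite !gt_eqF ?powR_gt0.
rewrite mulrC -ler_pdivlMr//.
have -> : (eps / k = kap `^ (s - s1))%R.
  by rewrite /kap -powRrM mulVf ?gt_eqF// powRr1// divr_ge0// ltW.
by apply: ge0_ler_powR; rewrite ?nnegrE ltW.
Qed.

End box_dimension.

(** * Packing dimension *)

Section packing_upper.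
Context {R : realType} {d : nat}.
Implicit Types (E : set 'rV[R]_d).

Lemma packing_pre_ge0 s E : (0 <= packing_pre s E)%E.
Proof.
apply: le_ereal_inf_tmp => _ [delta _ <-].
apply: le_trans (_ : \esum_(q in set0) (ediam (ecball q.1 q.2) `^ s) <= _)%E.
  by rewrite esum_set0.
by apply: ereal_sup_ubound; exists set0 => //; split => //; exact: trivIset_set0.
Qed.

(** Balls of a packing with radii comparable to [2 ^- k] have centres at mutual
    distance at least [2 ^- k.+1], so there are no more of them than sets in a
    cover at that scale; summing over [k] gives a geometric series. *)
Lemma packing_pre_eq0 s s1 (delta0 : R) E : (0 < d)%N -> 0 <= s1 < s -> 0 < delta0 ->
  (forall delta, 0 < delta < delta0 ->
     (covering_number delta E <= (delta `^ (- s1))%:E)%E) ->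
  packing_pre s E = 0%E.
Proof.
move=> d0 /andP[s10 s1s] dl00 H.
have s0 : 0 <= s by exact: le_trans (ltW s1s).
apply/eqP; rewrite eq_le packing_pre_ge0 andbT.
apply/lee_addgt0Pr => e e0; rewrite add0e.
pose h : R := 2^-1.
have h0 : 0 < h by rewrite invr_gt0.
have h1 : h < 1 by rewrite invf_lt1// ltr1n.
have hk k : 0 < h ^+ k by rewrite exprn_gt0.
pose z := h `^ (s - s1).
have z01 : 0 <= z < 1.
  rewrite powR_ge0/= /z -[ltRHS](powRr0 h) /powR gt_eqF//.
  by rewrite ltr_expR mul0r pmulr_rlt0 ?subr_gt0// ln_lt0// h0.
have z0 : 0 <= z by case/andP: z01.
pose M := 2 * (h `^ (- s1)) * 2 `^ s.
have M0 : 0 < M.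
  by apply: mulr_gt0; [apply: mulr_gt0 => //; exact: powR_gt0|exact: powR_gt0].
have to0 : forall y : R, 0 <= y < 1 -> forall e : R, 0 < e -> exists N, forall n, (N <= n)%N -> y ^+ n < e.
  move=> y /andP[y0 y1] e' e'0.
  have : (fun n => y ^+ n) @ \oo --> (0 : R) by apply: cvg_expr; rewrite ger0_norm.
  move=> /cvgrPdist_lt/(_ _ e'0)[N _ HN]; exists N => n Nn.
  by have := HN n Nn; rewrite sub0r normrN ger0_norm// exprn_ge0.
have z1 : 0 < 1 - z by rewrite subr_gt0; case/andP: z01.
have [N1 HN1] := to0 z z01 (e * (1 - z) / M) (divr_gt0 (mulr_gt0 e0 z1) M0).
have [N2 HN2] := to0 h (introT andP (conj (ltW h0) h1)) _ dl00.
pose N := maxn N1 N2.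
have zN : z ^+ N < e * (1 - z) / M by apply: HN1; exact: leq_maxl.
have hN k : h ^+ (N + k) < delta0 by apply: HN2; rewrite (leq_trans (leq_maxr N1 N2))// leq_addr.
apply: (@le_trans _ _ (ereal_sup [set (\esum_(q in Q) (ediam (ecball q.1 q.2) `^ s))%E |
    Q in is_packing (h ^+ N) E])).
  by apply: ereal_inf_lbound; exists (h ^+ N) => //=.
apply: ge_ereal_sup => _ [Q [Qball Qdisj] <-].
pose Qk k := [set q | Q q /\ h ^+ (N + k).+1 < q.2 <= h ^+ (N + k)].
have Qcover : Q `<=` \bigcup_(k in [set: nat]) Qk k.
  move=> q Qq; have [_ /andP[q0 qN]] := Qball q Qq.
  have [m Hm] : exists m, h ^+ m.+1 < q.2.
    have [m Hm] := to0 h (introT andP (conj (ltW h0) h1)) _ q0.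
    by exists m; exact: Hm.
  pose k := ex_minn (ex_intro (fun m => h ^+ m.+1 < q.2) m Hm).
  have [k1 kmin] : h ^+ k.+1 < q.2 /\ forall m, h ^+ m.+1 < q.2 -> (k <= m)%N.
    by rewrite /k; case: ex_minnP.
  have k2 : q.2 <= h ^+ k.
    case: k k1 kmin => [|k] k1 kmin.
      by apply: le_trans qN _; rewrite exprn_ile1// ltW.
    by rewrite leNgt; apply/negP => /kmin; rewrite ltnn.
  have Nk : (N <= k)%N.
    rewrite leqNgt; apply/negP => kN.
    have : h ^+ N <= h ^+ k.+1 by apply: ler_wiXn2l; rewrite ?(ltW h0) ?(ltW h1).
    by rewrite leNgt (lt_le_trans k1).
  by exists (k - N)%N => //; rewrite /Qk/= subnKC// k1 k2.
apply: le_trans (le_esum_set _ Qcover) _.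
apply: le_trans (esum_bigcup_le _ _ _) _; first by move=> q; exact: poweR_ge0.
apply: (@le_trans _ _ (M * z ^+ N / (1 - z))%:E); last first.
  by rewrite lee_fin ler_pdivrMr// mulrC -ler_pdivlMr// ltW.
apply: esum_geometric => //; first by rewrite mulr_ge0 ?exprn_ge0// ltW.
move=> k; rewrite esum_ge0/=; last by move=> q _; exact: poweR_ge0.
pose t := h ^+ (N + k); have t0 : 0 < t := hk _.
have ht : h ^+ (N + k).+1 = h * t by rewrite exprS.
have ht0 : 0 < h * t by rewrite mulr_gt0.
have M1 : 1 <= (h * t) `^ (- s1).
  rewrite powRN -[leLHS]invr1 lef_pV2 ?posrE ?powR_gt0// -[leRHS](powRr0 (h * t)).
  apply: ger_powR => //; rewrite ht0/= -ht exprn_ile1// ltW//.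
have [|n [U [nM Ud EU]]] := covering_number_sets M1 (H (h * t) _).
  by rewrite ht0 -ht -addnS hN.
apply: (@le_trans _ _ (\esum_(q in Qk k) ((2 * t) `^ s)%:E)%E).
  apply: le_esum => q [Qq /andP[_ qt]].
  have [_ /andP[q0 _]] := Qball q Qq.
  rewrite ediam_ecball ?(ltW q0)// poweR_EFin lee_fin.
  apply: ge0_ler_powR => //; rewrite ?nnegrE ?mulr_ge0 ?(ltW q0) ?(ltW t0)//.
  by rewrite ler_pM2l.
apply: le_trans (esum_const_seq (powR_ge0 _ _) (M := n%:R) _) _.
  move=> l ul lQ; rewrite ler_nat.
  have Ql q : q \in l -> exists j, U j q.1.
    by move=> /lQ[/Qball[Eq _] _]; exact: EU.
  have /choice[idx Hidx] : forall q : 'rV[R]_d * R, exists o : option 'I_n,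
      q \in l -> exists2 j, o = Some j & U j q.1.
    move=> q; have [ql|nql] := boolP (q \in l); last by exists None.
    by have [j Uj] := Ql q ql; exists (Some j) => _; exists j.
  have sz : size [seq Some j | j <- enum 'I_n] = n by rewrite size_map size_enum_ord.
  rewrite -(size_map idx) -[leqRHS]sz; apply: uniq_leq_size.
    rewrite map_inj_in_uniq// => q q' ql q'l E12.
    have [j E1 U1] := Hidx _ ql; have [j' E2 U2] := Hidx _ q'l.
    have jj : j' = j by move: E12; rewrite E1 E2 => -[].
    rewrite jj in U2.
    have [Qq /andP[qt _]] := lQ _ ql; have [Qq' /andP[_ _]] := lQ _ q'l.
    apply: (Qdisj q q') => //; exists q'.1; split.
      rewrite /ecball/=; apply: ltW; apply: le_lt_trans qt.
      by rewrite ht; have /(ediam_leP _ (ltW ht0)) := Ud j; exact.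
    by apply: ecball_center; apply: ltW; have [_ /andP[]] := Qball q' Qq'.
  move=> _ /mapP[q ql ->]; have [j -> _] := Hidx _ ql.
  by rewrite mem_map ?mem_enum// => a b [].
rewrite lee_fin.
apply: (@le_trans _ _ (2 * (h * t) `^ (- s1) * (2 * t) `^ s)).
  by apply: ler_wpM2r => //; exact: powR_ge0.
have -> : M * z ^+ N * z ^+ k = M * t `^ (s - s1).
  by rewrite -mulrA -exprD /z powR_exprn// ltW.
rewrite powRB; last by apply/implyP => _; rewrite gt_eqF.
rewrite (powRM _ (ltW h0) (ltW t0)) (powRM _ _ (ltW t0))// [t `^ (- s1)]powRN /M.
by rewrite [leLHS](_ : _ = 2 * h `^ (- s1) * 2 `^ s * (t `^ s / t `^ s1))//; ring.
Qed.

End packing_upper.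

Section packing_dimension.
Context {R : realType} {d : nat}.
Implicit Types (E A : set 'rV[R]_d).

Lemma dimP_le_upper_dimB E : (0 < d)%N -> E !=set0 -> (dimP E <= upper_dimB E)%E.
Proof.
move=> d0 E0; have B0 := upper_dimB_ge0 E0.
apply: lee_of_real_gt => // s Bs.
have [s1 /andP[s10 s1s] Bs1] : exists2 s1 : R, 0 <= s1 < s & (upper_dimB E < s1%:E)%E.
  case: (upper_dimB E) B0 Bs => [u| |]//; rewrite lee_fin lte_fin => u0 us.
  by exists ((u + s) / 2); rewrite ?lte_fin; [apply/andP; split|]; lra.
have [dl0 /andP[dl00 _] H] := upper_dimB_lt Bs1.
have P0 := packing_pre_eq0 d0 (introT andP (conj s10 s1s)) dl00 H.
apply: ereal_inf_lbound; exists s => //; split; first exact: le_trans (ltW s1s).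
apply/eqP; rewrite eq_le; apply/andP; split.
  apply: ereal_inf_lbound; exists (fun=> E); first by move=> x Ex; exists 0%N.
  by apply: eseries0 => i _ _; exact: P0.
by apply: le_ereal_inf_tmp => _ [A _ <-]; apply: nneseries_ge0 => i _ _; exact: packing_pre_ge0.
Qed.

(** A maximal [2 * eta]-separated subset of [A] is a packing by balls of radius
    [eta], hence small, and the balls of radius [3 * eta] about it cover the
    closure of [A]. *)
Lemma packing_net s A : (0 < d)%N -> 0 <= s -> (packing_pre s A < 1)%E ->
  exists2 dl0 : R, 0 < dl0 & forall eta, 0 < eta < dl0 ->
    exists l : seq 'rV[R]_d, (size l)%:R <= (2 * eta) `^ (- s) /\
      forall y, closure A y -> exists2 a, a \in l & enorm (y - a) <= 3 * eta.
Proof.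
move=> d0 s0 /ereal_inf_lt[_ [dl0 /= dl00 <-] sup1].
exists dl0 => // eta /andP[eta0 eta1].
have e2s : 0 < (2 * eta) `^ s by apply: powR_gt0; rewrite mulr_gt0.
pose Q (l : seq 'rV[R]_d) := [/\ uniq l, forall a, a \in l -> A a &
  forall a b, a \in l -> b \in l -> a != b -> 2 * eta < enorm (a - b)].
have bound l : Q l -> (size l)%:R <= (2 * eta) `^ (- s).
  move=> [ul lA sep]; rewrite powRN -[leRHS]mul1r ler_pdivlMr// -lee_fin; apply: ltW.
  apply: le_lt_trans sup1.
  pose QQ := [set q : 'rV[R]_d * R | q.1 \in l /\ q.2 = eta].
  apply: (@le_trans _ _ (\esum_(q in QQ) (ediam (ecball q.1 q.2) `^ s))%E); last first.
    apply: ereal_sup_ubound; exists QQ => //; split.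
      by move=> q [ql ->]; split; [exact: lA|rewrite eta0 ltW].
    move=> [a ra] [b rb] [/= al ->] [/= bl ->] [y [ya yb]].
    have [->//|ab] := eqVneq a b.
    exfalso; have := sep a b al bl ab; have := edistD a y b.
    by move: ya yb; rewrite /ecball/= [enorm (y - a)]edistC; lra.
  have inj : injective (fun a : 'rV[R]_d => (a, eta)) by move=> a b [].
  apply: le_trans (esum_ge_seq (s := [seq (a, eta) | a <- l]) _ _ _); last first.
  - by move=> q /mapP[a al ->]; split.
  - by rewrite map_inj_uniq.
  - by move=> q; exact: poweR_ge0.
  rewrite big_map (eq_bigr (fun=> ((2 * eta) `^ s)%:E)); last first.
    by move=> a _; rewrite ediam_ecball ?(ltW eta0)// poweR_EFin.
  rewrite sumEFin lee_fin big_const_seq count_predT iter_addr_0.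
  by rewrite -[X in _ <= X]mulr_natl.
have Q0 : Q [::] by [].
have [l [[ul lA sep] lmax]] := longest_seq Q0 bound.
exists l; split; first exact: bound.
move=> y /closure_eball/(_ _ eta0)[x Ax xy].
have [[a al ax]|far] := pselect (exists2 a, a \in l & enorm (x - a) <= 2 * eta).
  exists a => //; apply: le_trans (edistD _ x _) _.
  by move: xy ax; rewrite [enorm (x - y)]edistC; lra.
have xl : x \notin l.
  by apply/negP => xl; apply: far; exists x => //; rewrite subrr enorm0 mulr_ge0// ltW.
have far' a : a \in l -> 2 * eta < enorm (x - a).
  by move=> al; rewrite ltNge; apply/negP => h; apply: far; exists a.
have := lmax (x :: l); rewrite /= ltnn => H; exfalso.
suff /H : Q (x :: l) by [].
split; first by rewrite /= xl.
  by move=> a; rewrite inE => /orP[/eqP ->|/lA].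
move=> a b; rewrite !inE => /orP[/eqP ->|al] /orP[/eqP ->|bl] ab.
- by rewrite eqxx in ab.
- exact: far'.
- by rewrite edistC; exact: far'.
- exact: sep.
Qed.

End packing_dimension.

Section baire.
Context {R : realType} {d : nat} {I : countType}.
Variables (X : set 'rV[R]_d) (S : I -> 'rV[R]_d -> 'rV[R]_d) (c rho : R)
  (p : 'rV[R]_d).
Hypothesis BS : bilip_system X S c rho p.
Hypothesis d0 : (0 < d)%N.

Local Notation f := (comp_word S).
Local Notation r w := (lip_ratio X (comp_word S w)).
Local Notation F := (limit_set X S).

(** The Baire category theorem for the code space: otherwise every word could be
    prolonged so as to avoid the next set, and the limiting code would avoid them
    all.  Working with codes matters because [F] need not be closed. *)
Lemma baire_limit_set (A : nat -> set 'rV[R]_d) : F `<=` \bigcup_k A k ->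
  exists w k, forall x, F x -> closure (A k) (f w x).
Proof.
move=> FA; apply: contrapT => none.
have [D D0 XD] := compact_bounded_dist (bs_compact BS).
have [i0] := bs_inh BS.
have ext w k : exists u : seq I, (0 < size u)%N /\
    forall x, (f (w ++ u) @` X) x -> ~ A k x.
  have [x Fx nx] : exists2 x, F x & ~ closure (A k) (f w x).
    apply: contrapT => H; apply: none; exists w, k => x Fx.
    by apply: contrapT => nx; apply: H; exists x.
  have [e e0 eA] : exists2 e : R, 0 < e & forall y, A k y -> e <= enorm (y - f w x).
    apply: contrapT => H; apply: nx; apply: closure_eballP => e e0.
    apply: contrapT => H'; apply: H; exists e => // y Ay; rewrite leNgt.
    by apply/negP => lt1; apply: H'; exists y.
  have [z Hz] := (limit_setP BS x).1 Fx.
  have [N HN] := ratio_to0 BS (divr_gt0 (divr_gt0 e0 (ltr0n R 2)) D0).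
  exists (mkseq z N.+1); rewrite size_mkseq; split => // y Hy Ay.
  have fwx : (f (w ++ mkseq z N.+1) @` X) (f w x).
    by have [a Xa <-] := Hz N.+1; exists a => //; rewrite comp_word_catE.
  have := le_trans (eA y Ay) (image_dist BS XD Hy fwx).
  apply/negP; rewrite -ltNge; apply: (@le_lt_trans _ _ (e / 2)).
    rewrite mulrC -ler_pdivlMr//; apply: HN.
    by rewrite size_cat size_mkseq (leq_trans (leqnSn N)) ?leq_addl.
  by rewrite ltr_pdivrMr// ltr_pMr// ltr1n.
pose u w k := projT1 (cid (ext w k)).
have uP w k : (0 < size (u w k))%N /\ forall x, (f (w ++ u w k) @` X) x -> ~ A k x.
  by rewrite /u; case: cid.
pose W := fix W k := if k is k'.+1 then W k' ++ u (W k') k' else [::].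
have WS k : W k.+1 = W k ++ u (W k) k by [].
have size_W k : (k <= size (W k))%N.
  elim: k => // k IH; rewrite WS size_cat -addn1 leq_add//.
  by case: (uP (W k) k).
have W_prefix k m : (k <= m)%N -> exists t, W m = W k ++ t.
  move=> /subnKC <-; elim: (m - k)%N => [|j [t IH]].
    by exists [::]; rewrite addn0 cats0.
  by rewrite addnS WS IH -catA; eexists.
pose z n := nth i0 (W n.+1) n.
have zW k : mkseq z (size (W k)) = W k.
  apply: (@eq_from_nth _ i0); rewrite size_mkseq// => n nk.
  rewrite nth_mkseq// /z.
  have [h|h] := leqP n.+1 k.
    by have [t ->] := W_prefix _ _ h; rewrite nth_cat size_W.
  by have [t ->] := W_prefix _ _ (ltnW h); rewrite nth_cat nk.
have [x Hx] := code_point BS z.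
have Fx : F x by apply/(limit_setP BS); exists z.
have [k _ Ax] := FA _ Fx.
have [_ /(_ x)] := uP (W k) k; rewrite -WS -(zW k.+1) => H.
exact: H (Hx _) Ax.
Qed.

(** One piece of a countable decomposition is dense in a copy [f w @` F] of [F].  A packing
    bound for this piece bounds the covering numbers of its closure, and [f w] has a
    Lipschitz inverse. *)
Lemma upper_dimB_le_dimP : (upper_dimB F <= dimP F)%E.
Proof.
apply: le_ereal_inf_tmp => _ [s [s0 Hs] <-].
have : (packing_measure s F < 1)%E by rewrite Hs.
move=> /ereal_inf_lt[_ [A FA <-] sum1].
have A1 k : (packing_pre s (A k) < 1)%E.
  apply: le_lt_trans sum1.
  have := @nneseries_lim_ge R (fun k => packing_pre s (A k)) xpredT 0%N k.+1
    (fun n _ _ => packing_pre_ge0 s (A n)).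
  apply: le_trans; rewrite big_nat_recr//= leeDr//.
  by apply: sume_ge0 => i _; exact: packing_pre_ge0.
have [w [k wk]] := baire_limit_set FA.
have [dl0 dl00 net] := packing_net d0 s0 (A1 k).
have rw0 := bs_gt0 BS w.
have c0 : 0 < c by case/andP: (bs_c BS).
pose kap := c * r w / 6.
have kap0 : 0 < kap by rewrite divr_gt0// mulr_gt0.
apply: (@upper_dimB_le _ _ _ _ ((2 * kap) `^ (- s)) (dl0 / kap)).
- by apply: powR_gt0; exact: mulr_gt0.
- by rewrite divr_gt0.
move=> t /andP[t0 t1].
have eta0 : 0 < kap * t by rewrite mulr_gt0.
have eta1 : kap * t < dl0 by rewrite mulrC -ltr_pdivlMr.
have [l [lsz lnet]] := net (kap * t) (introT andP (conj eta0 eta1)).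
pose V (a : 'rV[R]_d) := [set x | F x /\ enorm (f w x - a) <= 3 * (kap * t)].
apply: (@le_trans _ _ ((size (map V l))%:R)%:E).
  apply: covering_number_le_seq.
    move=> _ /mapP[a al ->]; apply/(ediam_leP _ (ltW t0)) => x y [Fx xa] [Fy ya].
    have := bs_lower BS w (limit_set_sub BS Fx) (limit_set_sub BS Fy).
    have := edistD (f w x) a (f w y); rewrite [enorm (a - f w y)]edistC => h1 h2.
    have cr0 : 0 < c * r w by rewrite mulr_gt0.
    rewrite -(ler_pM2l cr0); apply: le_trans h2 (le_trans h1 _).
    apply: le_trans (lerD xa ya) _; rewrite /kap.
    by rewrite [leLHS](_ : _ = c * r w * t)//; field.
  move=> x Fx; have [a al ax] := lnet _ (wk x Fx).
  by exists (V a); [exact: map_f|].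
rewrite size_map lee_fin; apply: le_trans lsz _.
rewrite -(powRM _ _ (ltW t0)); last by rewrite mulr_ge0 ?(ltW kap0).
by rewrite mulrA.
Qed.

Lemma dimP_limit_set : dimP F = upper_dimB F.
Proof.
apply/eqP; rewrite eq_le upper_dimB_le_dimP andbT.
by apply: dimP_le_upper_dimB => //; exact: limit_set_inh BS.
Qed.

End baire.

(** * The dimension formulas *)

Section scale_functions.
Context {R : realType}.

Lemma power_scale_le (theta x : R) : 0 < theta <= 1 -> 0 < x < 1 ->
  0 < x `^ theta^-1 <= x.
Proof.
move=> /andP[t0 t1] /andP[x0 x1]; rewrite powR_gt0//=.
by apply: ge1r_powR; [rewrite x0 ltW|rewrite -[leLHS]invr1 lef_pV2 ?posrE].
Qed.

Lemma power_scale_ratio (theta x y : R) : 0 < theta <= 1 -> 0 < x -> x <= y ->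
  x `^ theta^-1 / x <= y `^ theta^-1 / y.
Proof.
move=> /andP[t0 t1] x0 xy; have y0 : 0 < y := lt_le_trans x0 xy.
have E (u : R) : 0 < u -> u `^ theta^-1 / u = u `^ (theta^-1 - 1).
  move=> u0; rewrite powRB; last by apply/implyP => _; rewrite gt_eqF.
  by rewrite powRr1 ?ltW.
rewrite !E//; apply: ge0_ler_powR; rewrite ?nnegrE ?(ltW x0) ?(ltW y0)//.
by rewrite subr_ge0 -[leLHS]invr1 lef_pV2 ?posrE.
Qed.

(** A positive ratio [Phi delta / delta] that tends to [0] cannot be
    nonincreasing. *)
Lemma admissible_ratio_mono (Delta : R) (Phi : R -> R) :
  monotonically_admissible Delta Phi ->
  forall x y, 0 < x -> x <= y -> y < Delta -> Phi x / x <= Phi y / y.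
Proof.
move=> [D0 _ PhiD [mono|anti] lim0] x y x0 xy yD.
  by apply: mono => //=; rewrite ?x0 ?(lt_le_trans x0 xy)//= (le_lt_trans xy).
have D2 : 0 < Delta / 2 by rewrite divr_gt0.
have D2D : Delta / 2 < Delta by rewrite ltr_pdivrMr// ltr_pMr// ltr1n.
have /andP[P0 _] := PhiD (Delta / 2) (introT andP (conj D2 D2D)).
have q0 : 0 < Phi (Delta / 2) / (Delta / 2) by rewrite divr_gt0.
exfalso; move/cvgrPdist_lt: lim0 => /(_ _ q0) near0.
have [t [lt1 t0 t1]] : exists t, [/\ `|0 - Phi t / t| < Phi (Delta / 2) / (Delta / 2),
    0 < t & t < Delta / 2].
  apply: (@filter_ex _ ((0 : R)^'+)).
  near=> t; split; near: t => //; [exact: nbhs_right_gt|exact: nbhs_right_lt].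
have tD : 0 < t < Delta by rewrite t0 (lt_trans t1).
have /andP[Pt0 _] := PhiD t tD.
have := anti t (Delta / 2) tD (introT andP (conj D2 D2D)) (ltW t1).
move: lt1; rewrite sub0r normrN gtr0_norm ?divr_gt0// => lt1.
by rewrite leNgt lt1.
Unshelve. all: by end_near. Qed.

End scale_functions.

Unset Implicit Arguments.
Set Strict Implicit.
Set Printing Implicit Defensive.

Theorem theorem3p5 (R : realType) (d : nat) (hd : (0 < d)%N) (I : countType)
    (X : set 'rV[R]_d) (S : I -> 'rV[R]_d -> 'rV[R]_d)
    (hS : is_CIFS X S)
    (P : set 'rV[R]_d)
    (hPsub : P `<=` \bigcup_i (S i @` X))
    (hP1 : forall i : I, exists x, P `&` (S i @` X) = [set x]) :
  [/\ upper_dimB (limit_set X S) = dimP (limit_set X S) /\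
      dimP (limit_set X S) = maxe (pressure_h X S) (upper_dimB P),
      forall theta : R, 0 <= theta <= 1 ->
        upper_dim_theta theta (limit_set X S)
        = maxe (pressure_h X S) (upper_dim_theta theta P) &
      forall (Delta : R) (Phi : R -> R), monotonically_admissible Delta Phi ->
        upper_dim_Phi Delta Phi (limit_set X S)
        = maxe (pressure_h X S) (upper_dim_Phi Delta Phi P)].
Proof.
have [c [rho [p BS]]] := CIFS_bilip_system hd hS.
have /choice[pp Hpp] := hP1.
have pp_in i : (P `&` (S i @` X)) (pp i) by rewrite Hpp.
have ppP i : P (pp i) by case: (pp_in i).
have ppS i : (S i @` X) (pp i) by case: (pp_in i).
have Ppp x : P x -> exists i, x = pp i.
  move=> Px; have [i _ Sx] := hPsub x Px; exists i.
  by have : (P `&` (S i @` X)) x by []; rewrite Hpp.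
have dimF := restricted_dim_limit_set BS hd ppP ppS Ppp.
have theta_dim (theta : R) : 0 < theta <= 1 ->
    restricted_dim 1 (fun delta => delta `^ theta^-1) (limit_set X S) =
    maxe (pressure_h X S) (restricted_dim 1 (fun delta => delta `^ theta^-1) P).
  move=> t01; apply: dimF => //; first by move=> x; exact: power_scale_le.
  by move=> x y x0 xy _; exact: power_scale_ratio.
have F0 : limit_set X S !=set0 := limit_set_inh BS.
have P0 : P !=set0 by have [i] := bs_inh BS; exists (pp i).
split.
- split; first by rewrite (dimP_limit_set BS hd).
  rewrite (dimP_limit_set BS hd) !upper_dimB_restricted//.
  by apply: theta_dim; rewrite ltr01 lexx.
- move=> theta /andP[t0 t1]; rewrite /upper_dim_theta; case: eqP => [_|tn0].
    rewrite (dimH_limit_set BS hd); apply/esym/max_idPl.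
    exact: le_trans (dimH_points Ppp) (pressure_h_ge0 X S).
  by apply: theta_dim; rewrite t1 andbT lt_neqAle t0 eq_sym; move/eqP: tn0 => ->.
- move=> Delta Phi adm; have [D0 _ PhiD _ _] := adm.
  by apply: dimF => //; exact: admissible_ratio_mono.
Qed.
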